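(* Let $m$ be a positive integer and $0<x<\pi$. Then $$\sum_{n=1}^\infty\frac{(-1)^{n-1}\cos nx}{n^{2m-1}}=\frac{(-1)^{m-1}\pi^{2m-2}}{(2m-2)!}\bigg(2^{2m-2}\zeta'\Big(2-2m,1-\frac x{2\pi}\Big)+2^{2m-2}\zeta'\Big(2-2m,\frac x{2\pi}\Big)-\zeta'\Big(2-2m,1-\frac x\pi\Big)-\zeta'\Big(2-2m,\frac x\pi\Big)\bigg).$$
   Context: For $0<a\le 1$, $\zeta(s,a)$ denotes the Hurwitz zeta function, defined for $\Re s>1$ by $\zeta(s,a)=\sum_{k=0}^\infty (k+a)^{-s}$ and extended by analytic continuation to all complex $s\neq 1$. Throughout, $\zeta'(s,a)$ denotes the partial derivative $\frac{\partial}{\partial s}\zeta(s,a)$ with respect to the first variable $s$. *)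

(* Defs.v *)
From Stdlib Require Import Reals.
From Coquelicot Require Import Coquelicot.
Open Scope R_scope.

(* b^(-s) for a real b > 0 and complex s, i.e. exp(-s * ln b). *)
Definition cpow_neg (b : R) (s : C) : C :=
  (exp (- Re s * ln b) * cos (- Im s * ln b),
   exp (- Re s * ln b) * sin (- Im s * ln b)).

(* Z is the Hurwitz zeta function zeta(., a): holomorphic on C \ {1} and equal
   to sum_{k>=0} (k+a)^(-s) for Re s > 1.  (By the identity theorem such a Z
   is unique: it is the analytic continuation of the Dirichlet series.) *)
Definition is_hurwitz_zeta (a : R) (Z : C -> C) : Prop :=
  (forall s : C, s <> RtoC 1 -> ex_derive Z s) /\
  (forall s : C, 1 < Re s ->
      is_series (fun k : nat => cpow_neg (INR k + a) s) (Z s)).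

(* Main.v *)
Require Import Defs.
From Stdlib Require Import Reals Factorial Lra Lia.
From Coquelicot Require Import Coquelicot.
Open Scope R_scope.

(** Put F(s) = zeta(s,a) + zeta(s,1-a) with 0 < a < 1. For Re s > 2, Gamma(s) F(s) is the Mellin
    transform of h(t) = sum_n (e^(-(n+a)t) + e^(-(n+1-a)t)) = cosh((1/2-a)t) / sinh(t/2). Subtracting
    the expansions of e^(-t) and h(t) at 0 continues both transforms to Re s > -2k-1, and the identity
    theorem carries Gamma F = M(h) along horizontal lines above the real axis to -2k + iy. Letting
    y -> 0, Gamma has a pole of residue 1/(2k)! at -2k while M(h) is regular there because h is odd, so
    F(-2k) = 0 and F'(-2k) = (2k)! M(h)(-2k). The partial fraction expansion
    h(t) = 2/t + sum_n 4 t cos(2 pi n a) / (t^2 + (2 pi n)^2), which is a Fourier series in a, then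
    turns M(h)(-2k) into the integral of a sum of Lorentzians, with value
    (-1)^k (2 pi)^(-2k) sum_n cos(2 pi n a) / n^(2k+1). The theorem combines a = x/(2 pi) and a = x/pi,
    since the alternating series is the full series minus twice its even part.

    The identity theorem must start from mere complex differentiability; it is obtained from
    Goursat's theorem, which makes all Fourier coefficients on circles vanish. *)

(** * Complex differentiability and the complex exponential *)

(** [is_hurwitz_zeta] grants complex differentiability at each point and nothing about the
    derivative, so Cauchy theory has to enter in Goursat's form. Only the spreading of zeros from a
    disc to a larger concentric one is needed, and no power series are built. The continuation runs
    at heights 0 < Im s < 1 because every pole in play, those of both transforms at integers and
    that of zeta at 1, is real. With t = e^v a Mellin transform splits into two Laplace transforms
    on a half-line, the part t < 1 at s and the part t > 1 at -s, so one theorem on differentiation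
    under the integral serves Gamma and M(h) alike. At k = 0 the series of cos(2 pi n a) / n
    converges only conditionally, which rules out dominated convergence in the last integral. The
    truncated integrals are arctangent series whose weights decrease in n, and Abel summation bounds
    their tails uniformly in the truncation. One Fourier theorem, convergence at the single point 0,
    is used twice: for the identity theorem and for the partial fractions. *)

Definition cderiv (f : C -> C) (z d : C) : Prop :=
  forall eps : R, 0 < eps -> exists delta : R, 0 < delta /\
    forall h : C, Cmod h < delta -> Cmod (f (z + h) - f z - h * d)%C <= eps * Cmod h.

(** The hypotheses on zeta use the default module structure on C, whereas the rules for products and
    compositions below are taken for C as a module over itself. Both unfold to [cderiv], which
    serves as the common form. *)
Lemma cderiv_of_is_derive (f : C -> C) (z d : C) :
  is_derive f z d -> cderiv f z d.
Proof.
intros [_ H] eps Heps.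
destruct (H z (fun P HP => HP) (mkposreal eps Heps)) as [del Hdel].
exists del; split; [apply cond_pos|].
intros h Hh.
assert (E : (z + h - z = h)%C) by ring.
specialize (Hdel (z + h)%C).
assert (Hb : @ball (AbsRing_UniformSpace C_AbsRing) z del (z + h)%C).
{ change (Cmod (z + h - z)%C < del). now rewrite E. }
specialize (Hdel Hb).
change (Cmod ((f (z + h) - f z) - (z + h - z) * d)%C <= eps * Cmod (z + h - z)%C) in Hdel.
now rewrite E in Hdel.
Qed.

Lemma Cplus_sub_cancel (z y : C) : y = (z + (y - z))%C.
Proof. ring. Qed.

Lemma cderiv_iff_K (f : C -> C) (z d : C) :
  @is_derive C_AbsRing (AbsRing_NormedModule C_AbsRing) f z d <-> cderiv f z d.
Proof.
split.
- intros [_ H] eps Heps.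
  destruct (H z (fun P HP => HP) (mkposreal eps Heps)) as [del Hdel].
  exists del; split; [apply cond_pos|].
  intros h Hh.
  assert (E : (z + h - z = h)%C) by ring.
  specialize (Hdel (z + h)%C).
  assert (Hb : @ball (AbsRing_UniformSpace C_AbsRing) z del (z + h)%C).
  { change (Cmod (z + h - z)%C < del). now rewrite E. }
  specialize (Hdel Hb).
  change (Cmod ((f (z + h) - f z) - (z + h - z) * d)%C <= eps * Cmod (z + h - z)%C) in Hdel.
  now rewrite E in Hdel.
- intros H. split; [apply is_linear_scal_l|].
  intros x Hx eps.
  assert (Hzx : z = x) by exact (is_filter_lim_locally_unique (V := AbsRing_NormedModule C_AbsRing) z x Hx). subst x.
  destruct (H eps (cond_pos eps)) as [del [Hd Hdel]].
  exists (mkposreal del Hd). intros y Hy.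
  specialize (Hdel (y - z)%C Hy).
  replace (z + (y - z))%C with (y : C) in Hdel by exact (Cplus_sub_cancel z y).
  exact Hdel.
Qed.

Lemma cderiv_const (c z : C) : cderiv (fun _ => c) z 0.
Proof. apply cderiv_iff_K. exact (is_derive_const (K := C_AbsRing) (V := AbsRing_NormedModule C_AbsRing) c z). Qed.

Lemma cderiv_id (z : C) : cderiv (fun w => w) z 1.
Proof. apply cderiv_iff_K. exact (is_derive_id (K := C_AbsRing) z). Qed.

Lemma cderiv_plus (f g : C -> C) (z a b : C) :
  cderiv f z a -> cderiv g z b -> cderiv (fun w => f w + g w)%C z (a + b)%C.
Proof.
intros Hf Hg. apply cderiv_iff_K.
apply (is_derive_plus (K := C_AbsRing) (V := AbsRing_NormedModule C_AbsRing) f g); now apply cderiv_iff_K.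
Qed.

Lemma cderiv_mult (f g : C -> C) (z a b : C) :
  cderiv f z a -> cderiv g z b ->
  cderiv (fun w => f w * g w)%C z (a * g z + f z * b)%C.
Proof.
intros Hf Hg. apply cderiv_iff_K.
apply (is_derive_mult (K := C_AbsRing) f g); [now apply cderiv_iff_K| now apply cderiv_iff_K|].
intros n m. apply Cmult_comm.
Qed.

Lemma cderiv_comp (f g : C -> C) (z a b : C) :
  cderiv f (g z) a -> cderiv g z b -> cderiv (fun w => f (g w)) z (b * a)%C.
Proof.
intros Hf Hg. apply cderiv_iff_K.
apply (is_derive_comp (K := C_AbsRing) (V := AbsRing_NormedModule C_AbsRing) f g);
  now apply cderiv_iff_K.
Qed.

Lemma cderiv_ext (f g : C -> C) (z d : C) :
  (forall w, f w = g w) -> cderiv f z d -> cderiv g z d.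
Proof.
intros E H eps He. destruct (H eps He) as [del [Hd Hdel]].
exists del; split; [easy|]. intros h Hh. rewrite <- !E. now apply Hdel.
Qed.

Lemma cderiv_opp (f : C -> C) (z a : C) :
  cderiv f z a -> cderiv (fun w => - f w)%C z (- a)%C.
Proof.
intros Hf.
replace (- a)%C with (0 * f z + (- (1)) * a)%C by ring.
apply (cderiv_ext (fun w => (- (1)) * f w)%C); [intros w; ring|].
apply (cderiv_mult (fun _ => (- (1))%C) f); [apply cderiv_const|easy].
Qed.

Lemma cderiv_inv (z : C) : z <> 0 -> cderiv Cinv z (- / (z * z))%C.
Proof.
intros Hz eps He.
assert (Hm : 0 < Cmod z) by now apply Cmod_gt_0.
set (r := Cmod z) in *.
(* The first bound keeps |z + h| >= r / 2, so the error |h|^2 / (|z + h| r^2) is at most 2 |h|^2 /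
   r^3; the second bound makes this at most eps |h|. *)
exists (Rmin (r / 2) (eps * r ^ 3 / 2)). split.
{ apply Rmin_pos; [lra|]. apply Rmult_lt_0_compat; [|lra].
  apply Rmult_lt_0_compat; [easy|]. now apply pow_lt. }
intros h Hh.
assert (H1 : Cmod h < r / 2) by (eapply Rlt_le_trans; [exact Hh|apply Rmin_l]).
assert (H2 : Cmod h < eps * r ^ 3 / 2) by (eapply Rlt_le_trans; [exact Hh|apply Rmin_r]).
assert (H3 : r / 2 <= Cmod (z + h)%C).
{ assert (r <= Cmod (z + h)%C + Cmod (- h)%C).
  { unfold r. replace z with ((z + h) + - h)%C at 1 by ring. apply Cmod_triangle. }
  rewrite Cmod_opp in H. lra. }
assert (Hzh : (z + h)%C <> 0) by (apply Cmod_gt_0; lra).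
replace (/ (z + h) - / z - h * (- / (z * z)))%C with (h * h * / ((z + h) * (z * z)))%C
  by (field; tauto).
rewrite !Cmod_mult, Cmod_inv, !Cmod_mult by (repeat apply Cmult_neq_0; tauto).
fold r.
pose proof (Cmod_ge_0 h).
assert (K : / (Cmod (z + h) * (r * r)) <= / (r / 2 * (r * r))).
{ apply Rinv_le_contravar; [repeat apply Rmult_lt_0_compat; lra|].
  apply Rmult_le_compat_r; [nra|easy]. }
apply Rle_trans with (Cmod h * Cmod h * / (r / 2 * (r * r))).
{ apply Rmult_le_compat_l; [nra|easy]. }
rewrite Rmult_assoc, Rmult_comm. apply Rmult_le_compat_r; [easy|].
apply Rle_trans with (eps * r ^ 3 / 2 * / (r / 2 * (r * r))).
- apply Rmult_le_compat_r; [|lra]. left. apply Rinv_0_lt_compat. repeat apply Rmult_lt_0_compat; lra.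
- right. field. lra.
Qed.

Definition cexp (z : C) : C := (exp (Re z) * cos (Im z), exp (Re z) * sin (Im z)).

Lemma cexp_plus (z w : C) : cexp (z + w) = (cexp z * cexp w)%C.
Proof.
unfold cexp, Cmult, Cplus, Re, Im; simpl.
rewrite exp_plus, cos_plus, sin_plus. f_equal; ring.
Qed.

Lemma cexp_0 : cexp 0 = 1.
Proof. unfold cexp, RtoC, Re, Im; simpl. rewrite exp_0, cos_0, sin_0. f_equal; ring. Qed.

Lemma Cmod_cexp (z : C) : Cmod (cexp z) = exp (Re z).
Proof.
unfold cexp, Cmod; simpl.
replace (_ + _) with (exp (Re z) * exp (Re z) * (Rsqr (sin (Im z)) + Rsqr (cos (Im z))))
  by (unfold Rsqr; ring).
rewrite sin2_cos2, Rmult_1_r. apply sqrt_square. left; apply exp_pos.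
Qed.

Lemma exp_le (x y : R) : x <= y -> exp x <= exp y.
Proof. intros [H|H]; [left; now apply exp_increasing|subst; right; easy]. Qed.

Lemma exp_sub_1_le (x : R) : Rabs (exp x - 1) <= Rabs x * exp (Rabs x).
Proof.
destruct (MVT_gen exp 0 x exp) as [c [Hc E]].
- intros; apply is_derive_exp.
- intros; apply derivable_continuous, derivable_exp.
- rewrite exp_0, Rminus_0_r in E. rewrite E, Rabs_mult, Rmult_comm.
  apply Rmult_le_compat_l; [apply Rabs_pos|].
  rewrite Rabs_pos_eq by (left; apply exp_pos).
  assert (c <= Rabs x).
  { destruct (Rle_dec 0 x).
    - rewrite Rmin_left, Rmax_right in Hc by lra. rewrite Rabs_pos_eq; lra.
    - rewrite Rmin_right, Rmax_left in Hc by lra. rewrite Rabs_left; lra. }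
  now apply exp_le.
Qed.

Lemma exp_sub_1_sub_le (x : R) : Rabs (exp x - 1 - x) <= Rabs x ^ 2 * exp (Rabs x).
Proof.
destruct (MVT_gen (fun x => exp x - x) 0 x (fun x => exp x - 1)) as [c [Hc E]].
- intros. auto_derive; [easy|ring].
- intros. apply derivable_continuous. intros y. reg.
- rewrite exp_0, !Rminus_0_r in E.
  replace (exp x - 1 - x) with (exp x - x - 1) by ring.
  rewrite E, Rabs_mult, Rmult_comm.
  replace (Rabs x ^ 2 * exp (Rabs x)) with (Rabs x * (Rabs x * exp (Rabs x))) by ring.
  apply Rmult_le_compat_l; [apply Rabs_pos|].
  eapply Rle_trans; [apply exp_sub_1_le|].
  assert (Rabs c <= Rabs x).
  { destruct (Rle_dec 0 x).
    - rewrite Rmin_left, Rmax_right in Hc by lra. rewrite !Rabs_pos_eq; lra.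
    - rewrite Rmin_right, Rmax_left in Hc by lra.
      rewrite (Rabs_left x) by lra. apply Rabs_le; lra. }
  apply Rmult_le_compat; try easy; [apply Rabs_pos|left; apply exp_pos|].
  now apply exp_le.
Qed.

Lemma sin_abs_le (x : R) : Rabs (sin x) <= Rabs x.
Proof.
destruct (MVT_gen sin 0 x cos) as [c [Hc E]].
- intros; apply is_derive_sin.
- intros; apply derivable_continuous, derivable_sin.
- rewrite sin_0, !Rminus_0_r in E. rewrite E, Rabs_mult.
  rewrite <- (Rmult_1_l (Rabs x)) at 2.
  apply Rmult_le_compat_r; [apply Rabs_pos|]. apply Rabs_le, COS_bound.
Qed.

Lemma cos_sub_1_le (x : R) : Rabs (cos x - 1) <= Rabs x ^ 2.
Proof.
destruct (MVT_gen cos 0 x (fun x => - sin x)) as [c [Hc E]].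
- intros; apply is_derive_cos.
- intros; apply derivable_continuous, derivable_cos.
- rewrite cos_0, !Rminus_0_r in E. rewrite E, Rabs_mult, Rabs_Ropp.
  replace (Rabs x ^ 2) with (Rabs x * Rabs x) by ring.
  apply Rmult_le_compat_r; [apply Rabs_pos|].
  eapply Rle_trans; [apply sin_abs_le|].
  destruct (Rle_dec 0 x).
  + rewrite Rmin_left, Rmax_right in Hc by lra. rewrite !Rabs_pos_eq; lra.
  + rewrite Rmin_right, Rmax_left in Hc by lra.
      rewrite (Rabs_left x) by lra. apply Rabs_le; lra.
Qed.

(** The mean value theorem gives a cubic bound, good enough for |x| <= 1. For 1 < |x| <= 2 the sine
    has the sign of x, so the difference is at most |x|; beyond 2, the bound 2 |x| is below
    |x|^2. *)
Lemma sin_sub_le (x : R) : Rabs (sin x - x) <= Rabs x ^ 2.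
Proof.
destruct (Rle_dec (Rabs x) 1) as [H1|H1].
- destruct (MVT_gen (fun x => sin x - x) 0 x (fun x => cos x - 1)) as [c [Hc E]].
  + intros. auto_derive; [easy|ring].
  + intros. apply derivable_continuous. intros y. reg.
  + rewrite sin_0, !Rminus_0_r in E. rewrite E, Rabs_mult.
    replace (Rabs x ^ 2) with (Rabs x * Rabs x) by ring.
    apply Rmult_le_compat_r; [apply Rabs_pos|].
    eapply Rle_trans; [apply cos_sub_1_le|].
    assert (Rabs c <= Rabs x).
    { destruct (Rle_dec 0 x).
      - rewrite Rmin_left, Rmax_right in Hc by lra. rewrite !Rabs_pos_eq; lra.
      - rewrite Rmin_right, Rmax_left in Hc by lra.
        rewrite (Rabs_left x) by lra. apply Rabs_le; lra. }
    pose proof (Rabs_pos c). nra.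
- assert (Rabs x <= Rabs x ^ 2) by nra.
  destruct (Rle_dec (Rabs x) 2).
  + destruct (Rle_dec 0 x).
    * rewrite (Rabs_pos_eq x) in * by lra. pose proof (sin_gt_0 x). pose proof PI2_3_2. unfold PI2 in *.
      pose proof (SIN_bound x).
      assert (0 < sin x) by (apply H0; lra). apply Rabs_le; lra.
    * rewrite (Rabs_left x) in * by lra. pose proof (sin_gt_0 (- x)). pose proof PI2_3_2. unfold PI2 in *.
      rewrite sin_neg in H0. pose proof (SIN_bound x). assert (0 < - sin x) by (apply H0; lra). apply Rabs_le; lra.
  + pose proof (sin_abs_le x). pose proof (Rabs_triang (sin x) (- x)). rewrite Rabs_Ropp in H2.
    unfold Rminus. nra.
Qed.

Lemma Cmod_le_abs (z : C) : Cmod z <= Rabs (Re z) + Rabs (Im z).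
Proof.
replace z with (RtoC (Re z) + Ci * RtoC (Im z))%C at 1.
- eapply Rle_trans; [apply Cmod_triangle|].
  rewrite Cmod_mult, Cmod_Ci, !Cmod_R. lra.
- destruct z; unfold RtoC, Ci, Cmult, Cplus, Re, Im; simpl. f_equal; ring.
Qed.

Lemma im_le_Cmod (z : C) : Rabs (Im z) <= Cmod z.
Proof.
eapply Rle_trans; [|apply Rmax_Cmod]. apply Rmax_r.
Qed.

Lemma cexp_sub_1_sub_re (z : C) :
  Rabs (Re (cexp z - 1 - z)%C) <= 2 * Cmod z ^ 2 * exp (Cmod z).
Proof.
destruct z as [x y]. set (r := Cmod (x, y)).
assert (Hx : Rabs x <= r) by apply (re_le_Cmod (x, y)).
assert (Hy : Rabs y <= r) by apply (im_le_Cmod (x, y)).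
unfold cexp, Cminus, Cplus, Copp, RtoC, Re, Im; simpl.
replace (exp x * cos y + - (1) + - x) with ((exp x - 1 - x) + exp x * (cos y - 1)) by ring.
eapply Rle_trans; [apply Rabs_triang|]. rewrite Rabs_mult.
rewrite (Rabs_pos_eq (exp x)) by (left; apply exp_pos).
pose proof (exp_sub_1_sub_le x). pose proof (cos_sub_1_le y).
pose proof (Rabs_pos x). pose proof (Rabs_pos y).
assert (exp (Rabs x) <= exp r) by (apply exp_le; lra).
assert (exp x <= exp r) by (apply exp_le; pose proof (Rle_abs x); lra).
assert (Rabs x ^ 2 <= r ^ 2) by (apply pow_incr; lra).
assert (Rabs y ^ 2 <= r ^ 2) by (apply pow_incr; lra).
assert (Rabs x ^ 2 * exp (Rabs x) <= r ^ 2 * exp r).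
{ apply Rmult_le_compat; try easy; [apply pow_le; lra|left; apply exp_pos]. }
assert (exp x * Rabs (cos y - 1) <= exp r * r ^ 2).
{ apply Rmult_le_compat; try lra; [left; apply exp_pos|apply Rabs_pos]. }
simpl in *. lra.
Qed.

Lemma cexp_sub_1_sub_im (z : C) :
  Rabs (Im (cexp z - 1 - z)%C) <= 2 * Cmod z ^ 2 * exp (Cmod z).
Proof.
destruct z as [x y]. set (r := Cmod (x, y)).
assert (Hx : Rabs x <= r) by apply (re_le_Cmod (x, y)).
assert (Hy : Rabs y <= r) by apply (im_le_Cmod (x, y)).
unfold cexp, Cminus, Cplus, Copp, RtoC, Re, Im; simpl.
replace (exp x * sin y + - 0 + - y) with (exp x * (sin y - y) + (exp x - 1) * y) by ring.
eapply Rle_trans; [apply Rabs_triang|]. rewrite !Rabs_mult.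
rewrite (Rabs_pos_eq (exp x)) by (left; apply exp_pos).
pose proof (exp_sub_1_le x). pose proof (sin_sub_le y).
pose proof (Rabs_pos x). pose proof (Rabs_pos y).
assert (exp (Rabs x) <= exp r) by (apply exp_le; lra).
assert (exp x <= exp r) by (apply exp_le; pose proof (Rle_abs x); lra).
assert (Rabs y ^ 2 <= r ^ 2) by (apply pow_incr; lra).
assert (Rabs x * exp (Rabs x) <= r * exp r).
{ apply Rmult_le_compat; try easy; left; apply exp_pos. }
assert (exp x * Rabs (sin y - y) <= exp r * r ^ 2).
{ apply Rmult_le_compat; try lra; [left; apply exp_pos|apply Rabs_pos]. }
assert (Rabs (exp x - 1) * Rabs y <= (r * exp r) * r).
{ apply Rmult_le_compat; try lra; apply Rabs_pos. }
simpl in *. lra.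
Qed.

Lemma cderiv_cexp (z : C) : cderiv cexp z (cexp z).
Proof.
intros eps He.
assert (Hz : 0 < exp (Re z)) by apply exp_pos.
assert (He1 : 0 < exp 1) by apply exp_pos.
(* For |h| < 1 the second-order error is at most 4 e |h|^2, and the factor [cexp z] has modulus
   e^(Re z). *)
exists (Rmin 1 (eps / (4 * exp 1 * exp (Re z)))). split.
{ apply Rmin_pos; [lra|]. apply Rdiv_lt_0_compat; [easy|]. repeat apply Rmult_lt_0_compat; lra. }
intros h Hh.
assert (H1 : Cmod h < 1) by (eapply Rlt_le_trans; [exact Hh|apply Rmin_l]).
assert (H2 : Cmod h < eps / (4 * exp 1 * exp (Re z))) by (eapply Rlt_le_trans; [exact Hh|apply Rmin_r]).
rewrite cexp_plus.
replace (cexp z * cexp h - cexp z - h * cexp z)%C with (cexp z * (cexp h - 1 - h))%C by ring.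
rewrite Cmod_mult, Cmod_cexp.
pose proof (Cmod_ge_0 h) as H0.
assert (K : Cmod (cexp h - 1 - h) <= 4 * Cmod h ^ 2 * exp 1).
{ eapply Rle_trans; [apply Cmod_le_abs|].
  pose proof (cexp_sub_1_sub_re h). pose proof (cexp_sub_1_sub_im h).
  assert (exp (Cmod h) <= exp 1) by (apply exp_le; lra).
  assert (Cmod h ^ 2 * exp (Cmod h) <= Cmod h ^ 2 * exp 1).
  { apply Rmult_le_compat_l; [apply pow_le|]; lra. }
  lra. }
apply Rle_trans with (exp (Re z) * (4 * Cmod h ^ 2 * exp 1)).
{ apply Rmult_le_compat_l; lra. }
replace (exp (Re z) * (4 * Cmod h ^ 2 * exp 1)) with (Cmod h * (4 * exp 1 * exp (Re z)) * Cmod h) by ring.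
apply Rmult_le_compat_r; [easy|].
apply Rmult_le_reg_r with (/ (4 * exp 1 * exp (Re z))).
- apply Rinv_0_lt_compat. repeat apply Rmult_lt_0_compat; lra.
- rewrite Rmult_assoc, Rinv_r. 2: apply Rgt_not_eq; repeat apply Rmult_lt_0_compat; lra. unfold Rdiv in H2; lra.
Qed.

Lemma cderiv_continuous (f : C -> C) (z d : C) : cderiv f z d ->
  forall eps : R, 0 < eps -> exists delta : R, 0 < delta /\
    forall h : C, Cmod h < delta -> Cmod (f (z + h) - f z)%C < eps.
Proof.
intros H eps He.
destruct (H 1 Rlt_0_1) as [del [Hd Hdel]].
pose proof (Cmod_ge_0 d) as H0.
exists (Rmin del (eps / (2 + Cmod d))). split.
{ apply Rmin_pos; [easy|]. apply Rdiv_lt_0_compat; lra. }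
intros h Hh.
assert (H1 : Cmod h < del) by (eapply Rlt_le_trans; [exact Hh|apply Rmin_l]).
assert (H2 : Cmod h < eps / (2 + Cmod d)) by (eapply Rlt_le_trans; [exact Hh|apply Rmin_r]).
specialize (Hdel h H1).
replace (f (z + h) - f z)%C with ((f (z + h) - f z - h * d) + h * d)%C by ring.
pose proof (Cmod_triangle (f (z + h) - f z - h * d)%C (h * d)%C).
rewrite Cmod_mult in H3. pose proof (Cmod_ge_0 h).
assert (Cmod h * (2 + Cmod d) < eps).
{ apply (Rmult_lt_compat_r (2 + Cmod d)) in H2; [|lra].
  replace (eps / (2 + Cmod d) * (2 + Cmod d)) with eps in H2 by (field; lra). easy. }
nra.
Qed.

(** The real differential is multiplication by d, which is the Cauchy-Riemann equations. Total
    differentiability is recorded, not just the partial derivatives, because Goursat's argument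
    needs the affine approximation in all directions. *)
Lemma differentiable_re_of_cderiv (f : C -> C) (x y : R) (d : C) :
  cderiv f (x, y) d ->
  differentiable_pt_lim (fun u v => Re (f (u, v))) x y (Re d) (- Im d) /\
  differentiable_pt_lim (fun u v => Im (f (u, v))) x y (Im d) (Re d).
Proof.
intros H.
assert (G : forall eps : posreal, exists del : posreal, forall u v,
  Rabs (u - x) < del -> Rabs (v - y) < del ->
  Cmod (f (u, v) - f (x, y) - ((u - x)%R, (v - y)%R) * d)%C <= eps * Rmax (Rabs (u - x)) (Rabs (v - y))).
{ intros eps.
  (* Halved because the modulus is at most twice the maximum of the coordinates. *)
  assert (He : 0 < eps / 2) by (pose proof (cond_pos eps); lra).
  destruct (H _ He) as [del [Hd Hdel]].
  assert (Hd2 : 0 < del / 2) by lra.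
  exists (mkposreal _ Hd2). simpl. intros u v Hu Hv.
  assert (Hl : Cmod (u - x, v - y) <= 2 * Rmax (Rabs (u - x)) (Rabs (v - y))).
  { pose proof (Cmod_le_abs (u - x, v - y)). simpl in H0.
    pose proof (Rmax_l (Rabs (u - x)) (Rabs (v - y))).
    pose proof (Rmax_r (Rabs (u - x)) (Rabs (v - y))). unfold Re, Im in H0; simpl in H0. lra. }
  assert (Hm : Rmax (Rabs (u - x)) (Rabs (v - y)) < del / 2) by (now apply Rmax_lub_lt).
  assert (E : ((x, y) + ((u - x)%R, (v - y)%R) = (u, v))%C) by (unfold Cplus; simpl; f_equal; ring).
  specialize (Hdel (u - x, v - y)%R). rewrite E in Hdel.
  eapply Rle_trans; [apply Hdel; lra|]. nra. }
split; intros eps; destruct (G eps) as [del Hdel]; exists del; intros u v Hu Hv;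
  eapply Rle_trans; [|apply (Hdel u v Hu Hv)| |apply (Hdel u v Hu Hv)].
- eapply Rle_trans; [|apply re_le_Cmod]. right. f_equal.
  destruct (f (u, v)), (f (x, y)), d. unfold Re, Im, Cminus, Cplus, Copp, Cmult; simpl. ring.
- eapply Rle_trans; [|apply im_le_Cmod]. right. f_equal.
  destruct (f (u, v)), (f (x, y)), d. unfold Re, Im, Cminus, Cplus, Copp, Cmult; simpl. ring.
Qed.

(** * Goursat's theorem on rectangles *)

(** Counterclockwise circulation of the form P du + Q dv around the rectangle with lower left corner
    (x, y) and sides l, h. *)
Definition rect_circ (P Q : R -> R -> R) (x l y h : R) : R :=
  RInt (fun u => P u y - P u (y + h)) x (x + l) +
  RInt (fun v => Q (x + l) v - Q x v) y (y + h).

Lemma differentiable_continuous_1 (P : R -> R -> R) (x y a b : R) :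
  differentiable_pt_lim P x y a b -> continuous (fun u => P u y) x.
Proof.
intros H. apply (continuous_comp_2 (fun u : R => u) (fun _ => y) P).
- apply continuous_id.
- apply continuous_const.
- apply continuity_2d_pt_filterlim, differentiable_continuity_pt; now exists a, b.
Qed.

Lemma differentiable_continuous_2 (P : R -> R -> R) (x y a b : R) :
  differentiable_pt_lim P x y a b -> continuous (fun v => P x v) y.
Proof.
intros H. apply (continuous_comp_2 (fun _ => x) (fun v : R => v) P).
- apply continuous_const.
- apply continuous_id.
- apply continuity_2d_pt_filterlim, differentiable_continuity_pt; now exists a, b.
Qed.

(** Each inner edge is traversed twice, in opposite directions. *)
Lemma rect_circ_split (P Q : R -> R -> R) (x l1 l2 y h1 h2 : R) :
  0 <= l1 -> 0 <= l2 -> 0 <= h1 -> 0 <= h2 ->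
  (forall u v, x <= u <= x + l1 + l2 -> y <= v <= y + h1 + h2 ->
     continuous (fun t => P t v) u /\ continuous (fun t => Q u t) v) ->
  rect_circ P Q x (l1 + l2) y (h1 + h2) =
    rect_circ P Q x l1 y h1 + rect_circ P Q (x + l1) l2 y h1 +
    rect_circ P Q x l1 (y + h1) h2 + rect_circ P Q (x + l1) l2 (y + h1) h2.
Proof.
intros Hl1 Hl2 Hh1 Hh2 HC. unfold rect_circ.
assert (EP : forall v a b, y <= v <= y + h1 + h2 -> x <= a <= b -> b <= x + l1 + l2 ->
  ex_RInt (fun t => P t v) a b).
{ intros v a b Hv Ha Hb. apply (ex_RInt_continuous (V := R_CompleteNormedModule)). intros z Hz.
  rewrite Rmin_left, Rmax_right in Hz by lra. now apply HC; [lra|]. }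
assert (EQ : forall u a b, x <= u <= x + l1 + l2 -> y <= a <= b -> b <= y + h1 + h2 ->
  ex_RInt (fun t => Q u t) a b).
{ intros u a b Hu Ha Hb. apply (ex_RInt_continuous (V := R_CompleteNormedModule)). intros z Hz.
  rewrite Rmin_left, Rmax_right in Hz by lra. now apply HC; [|lra]. }
assert (MP : forall v w a b, y <= v <= y + h1 + h2 -> y <= w <= y + h1 + h2 ->
  x <= a <= b -> b <= x + l1 + l2 ->
  RInt (fun u => P u v - P u w) a b = RInt (fun u => P u v) a b - RInt (fun u => P u w) a b).
{ intros. apply (RInt_minus (V := R_CompleteNormedModule)); now apply EP. }
assert (MQ : forall u w a b, x <= u <= x + l1 + l2 -> x <= w <= x + l1 + l2 ->
  y <= a <= b -> b <= y + h1 + h2 ->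
  RInt (fun v => Q u v - Q w v) a b = RInt (fun v => Q u v) a b - RInt (fun v => Q w v) a b).
{ intros. apply (RInt_minus (V := R_CompleteNormedModule)); now apply EQ. }
assert (CP : forall v, y <= v <= y + h1 + h2 -> RInt (fun u => P u v) x (x + (l1 + l2)) =
  RInt (fun u => P u v) x (x + l1) + RInt (fun u => P u v) (x + l1) (x + l1 + l2)).
{ intros. symmetry. rewrite <- Rplus_assoc.
  apply (RInt_Chasles (V := R_CompleteNormedModule)); apply EP; lra. }
assert (CQ : forall u, x <= u <= x + l1 + l2 -> RInt (fun v => Q u v) y (y + (h1 + h2)) =
  RInt (fun v => Q u v) y (y + h1) + RInt (fun v => Q u v) (y + h1) (y + h1 + h2)).
{ intros. symmetry. rewrite <- Rplus_assoc.
  apply (RInt_Chasles (V := R_CompleteNormedModule)); apply EQ; lra. }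
rewrite !MP, !MQ by lra. rewrite !CP, !CQ by lra.
rewrite <- !(Rplus_assoc x), <- !(Rplus_assoc y). ring.
Qed.

(* Near a point where P, Q are differentiable with P_y = Q_x, the affine parts cancel. *)
Lemma rect_circ_small (P Q : R -> R -> R) (p q a b c eps : R) :
  0 < eps ->
  differentiable_pt_lim P p q a b -> differentiable_pt_lim Q p q b c ->
  exists delta, 0 < delta /\ forall x l y h,
    0 < l < delta -> 0 < h < delta -> x <= p <= x + l -> y <= q <= y + h ->
    (forall u v, x <= u <= x + l -> y <= v <= y + h ->
     continuous (fun t => P t v) u /\ continuous (fun t => Q u t) v) ->
    Rabs (rect_circ P Q x l y h) <= 2 * eps * Rmax l h * (l + h).
Proof.
intros He HP HQ.
destruct (HP (mkposreal eps He)) as [d1 H1].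
destruct (HQ (mkposreal eps He)) as [d2 H2]. simpl in H1, H2.
exists (Rmin d1 d2). split. { apply Rmin_pos; apply cond_pos. }
intros x l y h Hl Hh Hx Hy HC.
set (m := Rmax l h).
pose proof (Rmin_l d1 d2). pose proof (Rmin_r d1 d2).
assert (B : forall u v, x <= u <= x + l -> y <= v <= y + h ->
  Rabs (u - p) <= m /\ Rabs (v - q) <= m /\ Rabs (u - p) < Rmin d1 d2 /\ Rabs (v - q) < Rmin d1 d2).
{ intros u v Hu Hv.
  assert (Rabs (u - p) <= l) by (apply Rabs_le; lra).
  assert (Rabs (v - q) <= h) by (apply Rabs_le; lra).
  pose proof (Rmax_l l h). pose proof (Rmax_r l h). unfold m. repeat split; lra. }
assert (BP : forall u v, x <= u <= x + l -> y <= v <= y + h ->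
  Rabs (P u v - P p q - (a * (u - p) + b * (v - q))) <= eps * m).
{ intros u v Hu Hv. destruct (B u v Hu Hv) as (A1 & A2 & A3 & A4).
  eapply Rle_trans; [apply H1; lra|]. apply Rmult_le_compat_l; [lra|]. now apply Rmax_lub. }
assert (BQ : forall u v, x <= u <= x + l -> y <= v <= y + h ->
  Rabs (Q u v - Q p q - (b * (u - p) + c * (v - q))) <= eps * m).
{ intros u v Hu Hv. destruct (B u v Hu Hv) as (A1 & A2 & A3 & A4).
  eapply Rle_trans; [apply H2; lra|]. apply Rmult_le_compat_l; [lra|]. now apply Rmax_lub. }
unfold rect_circ.
assert (E1 : ex_RInt (fun u => P u y - P u (y + h)) x (x + l)).
{ apply (ex_RInt_minus (V := R_NormedModule));
  apply (ex_RInt_continuous (V := R_CompleteNormedModule)); intros z Hz;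
  rewrite Rmin_left, Rmax_right in Hz by lra; apply HC; lra. }
assert (E2 : ex_RInt (fun v => Q (x + l) v - Q x v) y (y + h)).
{ apply (ex_RInt_minus (V := R_NormedModule));
  apply (ex_RInt_continuous (V := R_CompleteNormedModule)); intros z Hz;
  rewrite Rmin_left, Rmax_right in Hz by lra; apply HC; lra. }
(* The affine part of P contributes -b h l through the horizontal edges, that of Q contributes b h l
   through the vertical ones ([K2]); the shared b is what makes them cancel. *)
assert (K1 : Rabs (RInt (fun u => P u y - P u (y + h)) x (x + l) + b * h * l) <= l * (2 * eps * m)).
{ replace (b * h * l) with (RInt (fun _ => b * h) x (x + l)).
  2: { rewrite RInt_const. change scal with Rmult. simpl. ring. }
  rewrite <- (RInt_plus (V := R_CompleteNormedModule)); [|easy|apply ex_RInt_const].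
  replace (l * (2 * eps * m)) with ((x + l - x) * (2 * eps * m)) by ring.
  apply abs_RInt_le_const; [lra| |].
  - apply (ex_RInt_plus (V := R_NormedModule)); [easy|apply ex_RInt_const].
  - intros u Hu. change plus with Rplus. simpl.
    pose proof (BP u y Hu ltac:(lra)) as X1. pose proof (BP u (y + h) Hu ltac:(lra)) as X2.
    replace (P u y - P u (y + h) + b * h) with
      ((P u y - P p q - (a * (u - p) + b * (y - q))) - (P u (y + h) - P p q - (a * (u - p) + b * (y + h - q)))) by ring.
    unfold Rminus at 1. eapply Rle_trans; [apply Rabs_triang|]. rewrite Rabs_Ropp. lra. }
assert (K2 : Rabs (RInt (fun v => Q (x + l) v - Q x v) y (y + h) - b * h * l) <= h * (2 * eps * m)).
{ replace (b * h * l) with (RInt (fun _ => b * l) y (y + h)).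
  2: { rewrite RInt_const. change scal with Rmult. simpl. ring. }
  rewrite <- (RInt_minus (V := R_CompleteNormedModule)); [|easy|apply ex_RInt_const].
  replace (h * (2 * eps * m)) with ((y + h - y) * (2 * eps * m)) by ring.
  apply abs_RInt_le_const; [lra| |].
  - apply (ex_RInt_minus (V := R_NormedModule)); [easy|apply ex_RInt_const].
  - intros v Hv. change minus with Rminus. simpl.
    pose proof (BQ x v ltac:(lra) Hv) as X1. pose proof (BQ (x + l) v ltac:(lra) Hv) as X2.
    change (Rabs (Q (x + l) v - Q x v - b * l) <= 2 * eps * m).
    replace (Q (x + l) v - Q x v - b * l) with
      ((Q (x + l) v - Q p q - (b * (x + l - p) + c * (v - q))) - (Q x v - Q p q - (b * (x - p) + c * (v - q)))) by ring.
    unfold Rminus at 1. eapply Rle_trans; [apply Rabs_triang|]. rewrite Rabs_Ropp. lra. }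
set (A := RInt _ x (x + l)) in *. set (D := RInt _ y (y + h)) in *.
replace (A + D) with ((A + b * h * l) + (D - b * h * l)) by ring.
eapply Rle_trans; [apply Rabs_triang|]. lra.
Qed.

(** Selects a quarter whose circulation is at least K in absolute value. The last one is taken by
    default: if the total is at least 4 K and the other three fail, it must succeed. *)
Definition quarter (P Q : R -> R -> R) (l h K : R) (s : R * R) : R * R :=
  let (x, y) := s in
  if Rle_dec K (Rabs (rect_circ P Q x l y h)) then (x, y)
  else if Rle_dec K (Rabs (rect_circ P Q (x + l) l y h)) then (x + l, y)
  else if Rle_dec K (Rabs (rect_circ P Q x l (y + h) h)) then (x, y + h)
  else (x + l, y + h).

Fixpoint nested (P Q : R -> R -> R) (x l y h K : R) (n : nat) : R * R :=
  match n with
  | O => (x, y)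
  | S n => quarter P Q (l / 2 ^ S n) (h / 2 ^ S n) (K / 4 ^ S n) (nested P Q x l y h K n)
  end.

Lemma quarter_fst (P Q : R -> R -> R) (l h K : R) (s : R * R) : 0 <= l ->
  fst s <= fst (quarter P Q l h K s) <= fst s + l.
Proof. destruct s as [x y]. unfold quarter. intros. repeat destruct Rle_dec; simpl; lra. Qed.

Lemma quarter_snd (P Q : R -> R -> R) (l h K : R) (s : R * R) : 0 <= h ->
  snd s <= snd (quarter P Q l h K s) <= snd s + h.
Proof. destruct s as [x y]. unfold quarter. intros. repeat destruct Rle_dec; simpl; lra. Qed.

(** Nested intervals: the left ends grow and the right ends [u n + l / 2 ^ n] decrease. *)
Lemma halving_limit (u : nat -> R) (l : R) : 0 <= l ->
  (forall n, u n <= u (S n) <= u n + l / 2 ^ S n) ->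
  exists p, forall n, u n <= p <= u n + l / 2 ^ n.
Proof.
intros Hl Hu.
assert (G : Un_growing u) by (intros n; apply Hu).
assert (Hp : forall n, l / 2 ^ n = 2 * (l / 2 ^ S n)).
{ intros n. simpl. field. apply pow_nonzero; lra. }
assert (Hd : forall n k, u (n + k)%nat + l / 2 ^ (n + k) <= u n + l / 2 ^ n).
{ intros n. induction k; [rewrite Nat.add_0_r; lra|].
  rewrite Nat.add_succ_r. pose proof (Hu (n + k)%nat). rewrite (Hp (n + k)%nat) in IHk. lra. }
assert (Hpos : forall n, 0 <= l / 2 ^ n).
{ intros. apply Rmult_le_pos; [easy|]. left. apply Rinv_0_lt_compat, pow_lt; lra. }
destruct (growing_cv u G) as [p Hpl].
{ exists (u O + l / 2 ^ 0). intros z [n ->]. pose proof (Hd O n). simpl in *. pose proof (Hpos n). lra. }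
exists p. intros n. split; [now apply growing_ineq|].
apply Rnot_lt_le. intros Hlt.
destruct (Hpl (p - (u n + l / 2 ^ n)) ltac:(lra)) as [N HN].
specialize (HN (n + N)%nat ltac:(lia)). unfold Rdist in HN.
pose proof (Hd n N). pose proof (Hpos (n + N)%nat).
rewrite Rabs_left1 in HN; lra.
Qed.

(** Bisection: a nonzero circulation K would leave at least K / 4^n in the n-th nested rectangle,
    whereas differentiability at the common point makes the circulation there o(4^(-n)). No
    continuity of the derivatives is assumed. *)
Theorem goursat (P Q : R -> R -> R) (x l y h : R) : 0 < l -> 0 < h ->
  (forall u v, x <= u <= x + l -> y <= v <= y + h -> exists a b c,
     differentiable_pt_lim P u v a b /\ differentiable_pt_lim Q u v b c) ->
  rect_circ P Q x l y h = 0.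
Proof.
intros Hl Hh HD.
assert (HC : forall u v, x <= u <= x + l -> y <= v <= y + h ->
   continuous (fun t => P t v) u /\ continuous (fun t => Q u t) v).
{ intros u v Hu Hv. destruct (HD u v Hu Hv) as (a & b & c & H1 & H2). split.
  - eapply differentiable_continuous_1; eassumption.
  - eapply differentiable_continuous_2; eassumption. }
apply Rabs_eq_0. apply Rle_antisym; [|apply Rabs_pos]. apply Rnot_lt_le. intros HK.
set (K := Rabs (rect_circ P Q x l y h)) in *.
set (s := nested P Q x l y h K).
assert (Hpl : forall n, 0 < l / 2 ^ n) by (intros; apply Rdiv_lt_0_compat; [easy|apply pow_lt; lra]).
assert (Hph : forall n, 0 < h / 2 ^ n) by (intros; apply Rdiv_lt_0_compat; [easy|apply pow_lt; lra]).
destruct (halving_limit (fun n => fst (s n)) l) as [p Hp]; [lra| |].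
{ intros n. apply (quarter_fst P Q (l / 2 ^ S n) (h / 2 ^ S n) (K / 4 ^ S n) (s n)). left; apply Hpl. }
destruct (halving_limit (fun n => snd (s n)) h) as [q Hq]; [lra| |].
{ intros n. apply (quarter_snd P Q (l / 2 ^ S n) (h / 2 ^ S n) (K / 4 ^ S n) (s n)). left; apply Hph. }
assert (Hin : forall n, x <= fst (s n) /\ fst (s n) + l / 2 ^ n <= x + l /\
                        y <= snd (s n) /\ snd (s n) + h / 2 ^ n <= y + h).
{ induction n; [simpl; lra|].
  pose proof (quarter_fst P Q (l / 2 ^ S n) (h / 2 ^ S n) (K / 4 ^ S n) (s n) (Rlt_le _ _ (Hpl (S n)))).
  pose proof (quarter_snd P Q (l / 2 ^ S n) (h / 2 ^ S n) (K / 4 ^ S n) (s n) (Rlt_le _ _ (Hph (S n)))).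
  change (quarter _ _ _ _ _ (s n)) with (s (S n)) in *.
  assert (l / 2 ^ n = 2 * (l / 2 ^ S n)) by (simpl; field; apply pow_nonzero; lra).
  assert (h / 2 ^ n = 2 * (h / 2 ^ S n)) by (simpl; field; apply pow_nonzero; lra).
  lra. }
assert (HB : forall n, K / 4 ^ n <= Rabs (rect_circ P Q (fst (s n)) (l / 2 ^ n) (snd (s n)) (h / 2 ^ n))).
{ induction n.
  - simpl. replace (l / 1) with l by field. replace (h / 1) with h by field. unfold K. lra.
  - set (l' := l / 2 ^ S n). set (h' := h / 2 ^ S n). set (K' := K / 4 ^ S n).
    assert (El : l / 2 ^ n = l' + l') by (unfold l'; simpl; field; apply pow_nonzero; lra).
    assert (Eh : h / 2 ^ n = h' + h') by (unfold h'; simpl; field; apply pow_nonzero; lra).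
    assert (EK : K / 4 ^ n = 4 * K') by (unfold K'; simpl; field; apply pow_nonzero; lra).
    assert (Hl' : 0 < l') by apply Hpl. assert (Hh' : 0 < h') by apply Hph.
    pose proof (Hin n) as Hi.
    rewrite El, Eh in IHn, Hi. rewrite rect_circ_split in IHn; try lra.
    2: { intros; apply HC; lra. }
    change (s (S n)) with (quarter P Q l' h' K' (s n)).
    destruct (s n) as [xn yn]; simpl in IHn. unfold quarter.
    destruct Rle_dec as [?|N1]; [easy|].
    destruct Rle_dec as [?|N2]; [easy|].
    destruct Rle_dec as [?|N3]; [easy|]. simpl.
    set (A1 := rect_circ P Q xn l' yn h') in *. set (A2 := rect_circ P Q (xn + l') l' yn h') in *.
    set (A3 := rect_circ P Q xn l' (yn + h') h') in *.
    set (A4 := rect_circ P Q (xn + l') l' (yn + h') h') in *.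
    pose proof (Rabs_triang (A1 + A2 + A3) A4). pose proof (Rabs_triang (A1 + A2) A3).
    pose proof (Rabs_triang A1 A2). lra. }
destruct (HD p q) as (a & b & c & D1 & D2).
{ pose proof (Hp O). simpl in H. lra. }
{ pose proof (Hq O). simpl in H. lra. }
set (m := Rmax l h). assert (Hm : 0 < m) by (eapply Rlt_le_trans; [exact Hl|apply Rmax_l]).
(* Chosen so that the local bound 2 eps (m / 2^n) (l + h) / 2^n equals half of K / 4^n. *)
set (eps := K / (4 * m * (l + h))).
assert (Hmm : 0 < m * (l + h)) by (apply Rmult_lt_0_compat; lra).
assert (He : 0 < eps) by (apply Rdiv_lt_0_compat; lra).
destruct (rect_circ_small P Q p q a b c eps He D1 D2) as [del [Hdel Hs]].
destruct (pow_lt_1_zero (/ 2) ltac:(rewrite Rabs_pos_eq; lra) (del / m) ltac:(now apply Rdiv_lt_0_compat)) as [n Hn].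
specialize (Hn n (le_n _)). rewrite Rabs_pos_eq in Hn by (apply pow_le; lra).
assert (E2 : (/ 2) ^ n = / 2 ^ n) by (rewrite pow_inv; reflexivity).
assert (Hn2 : m / 2 ^ n < del).
{ unfold Rdiv. rewrite <- E2. apply (Rmult_lt_compat_l m) in Hn; [|easy].
  replace (m * (del / m)) with del in Hn by (field; lra). easy. }
assert (Hip : 0 < / 2 ^ n) by (apply Rinv_0_lt_compat, pow_lt; lra).
assert (l / 2 ^ n <= m / 2 ^ n) by (apply Rmult_le_compat_r; [lra|apply Rmax_l]).
assert (h / 2 ^ n <= m / 2 ^ n) by (apply Rmult_le_compat_r; [lra|apply Rmax_r]).
pose proof (Hin n) as Hi.
assert (F := Hs (fst (s n)) (l / 2 ^ n) (snd (s n)) (h / 2 ^ n)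
  ltac:(split; [apply Hpl|lra]) ltac:(split; [apply Hph|lra]) (Hp n) (Hq n)
  ltac:(intros; apply HC; lra)).
pose proof (HB n) as G.
assert (Rmax (l / 2 ^ n) (h / 2 ^ n) <= m / 2 ^ n) by (now apply Rmax_lub).
assert (F2 : 2 * eps * Rmax (l / 2 ^ n) (h / 2 ^ n) * (l / 2 ^ n + h / 2 ^ n) <=
   2 * eps * (m / 2 ^ n) * (l / 2 ^ n + h / 2 ^ n)).
{ apply Rmult_le_compat_r; [pose proof (Hpl n); pose proof (Hph n); lra|].
  apply Rmult_le_compat_l; lra. }
replace (2 * eps * (m / 2 ^ n) * (l / 2 ^ n + h / 2 ^ n)) with (K / 4 ^ n / 2) in F2.
- assert (0 < K / 4 ^ n) by (apply Rdiv_lt_0_compat; [easy|apply pow_lt; lra]). lra.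
- unfold eps. replace (4 ^ n) with (2 ^ n * 2 ^ n) by (rewrite <- Rpow_mult_distr; f_equal; ring).
  field. repeat split; try lra. apply pow_nonzero; lra.
Qed.

(** * Riemann-Lebesgue lemma and pointwise convergence of Fourier series *)

(** Integral and derivative lemmas leave equalities typed in the carrier of a structure on R;
    retyping them lets [ring] and [field] recognize the operations. *)
Ltac to_R := match goal with |- @eq _ ?a ?b => change (@eq R a b) end.

Lemma ex_RInt_cont (f : R -> R) (a b : R) : (forall x, continuous f x) -> ex_RInt f a b.
Proof. intros H. apply (ex_RInt_continuous (V := R_CompleteNormedModule)). intros; apply H. Qed.

Lemma RInt_Chasles_R (f : R -> R) (a b c : R) : (forall x, continuous f x) ->
  RInt f a c = RInt f a b + RInt f b c.
Proof.
intros H. symmetry. apply (RInt_Chasles (V := R_CompleteNormedModule)); now apply ex_RInt_cont.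
Qed.

Lemma RInt_plus_R (f g : R -> R) (a b : R) :
  (forall x, continuous f x) -> (forall x, continuous g x) ->
  RInt (fun x => f x + g x) a b = RInt f a b + RInt g a b.
Proof.
intros. apply (RInt_plus (V := R_CompleteNormedModule)); now apply ex_RInt_cont.
Qed.

Lemma RInt_scal_R (c : R) (f : R -> R) (a b : R) : (forall x, continuous f x) ->
  RInt (fun x => c * f x) a b = c * RInt f a b.
Proof.
intros. apply (RInt_scal (V := R_CompleteNormedModule)); now apply ex_RInt_cont.
Qed.

Lemma RInt_of_primitive (F f : R -> R) (a b : R) :
  (forall x, is_derive F x (f x)) -> (forall x, continuous f x) -> RInt f a b = F b - F a.
Proof.
intros H C. apply is_RInt_unique. apply (is_RInt_derive (V := R_CompleteNormedModule)); intros; auto.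
Qed.

Lemma abs_RInt_le_cont (f : R -> R) (a b M : R) : a <= b -> (forall x, continuous f x) ->
  (forall x, a <= x <= b -> Rabs (f x) <= M) -> Rabs (RInt f a b) <= (b - a) * M.
Proof. intros. apply abs_RInt_le_const; try easy. now apply ex_RInt_cont. Qed.

Lemma RInt_shift (f : R -> R) (c a b : R) : (forall x, continuous f x) ->
  RInt (fun x => f (x + c)) a b = RInt f (a + c) (b + c).
Proof.
intros H. pose proof (RInt_comp_lin (V := R_CompleteNormedModule) f 1 c a b) as E.
rewrite !Rmult_1_l in E. rewrite <- E by now apply ex_RInt_cont.
apply RInt_ext. intros. change scal with Rmult. simpl. rewrite !Rmult_1_l. easy.
Qed.

Lemma RInt_reflect (g : R -> R) (b : R) : (forall x, continuous g x) ->
  RInt (fun v => g (- v)) 0 b = RInt g (- b) 0.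
Proof.
intros Hg. pose proof (RInt_comp_lin (V := R_CompleteNormedModule) g (-1) 0 0 b) as E.
replace (-1 * 0 + 0) with 0 in E by ring. replace (-1 * b + 0) with (- b) in E by ring.
specialize (E (ex_RInt_cont _ _ _ Hg)).
rewrite <- (opp_RInt_swap (V := R_CompleteNormedModule) g 0 (- b)) by now apply ex_RInt_cont.
rewrite <- E.
rewrite <- (RInt_opp (V := R_CompleteNormedModule)).
- apply RInt_ext. intros x _. change opp with Ropp. change scal with Rmult. simpl.
  replace (-1 * x + 0) with (- x) by ring. to_R. ring.
- apply (ex_RInt_comp_lin (V := R_NormedModule)). now apply ex_RInt_cont.
Qed.

Lemma continuous_mult_R (f g : R -> R) (x : R) :
  continuous f x -> continuous g x -> continuous (fun x => f x * g x) x.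
Proof. apply (continuous_mult (K := R_AbsRing)). Qed.

Lemma continuous_plus_R (f g : R -> R) (x : R) :
  continuous f x -> continuous g x -> continuous (fun x => f x + g x) x.
Proof. apply (continuous_plus (V := R_NormedModule)). Qed.

Lemma continuous_minus_R (f g : R -> R) (x : R) :
  continuous f x -> continuous g x -> continuous (fun x => f x - g x) x.
Proof. apply (continuous_minus (V := R_NormedModule)). Qed.

Lemma continuous_of_deriv (f : R -> R) (x l : R) : is_derive f x l -> continuous f x.
Proof. intros H. apply (ex_derive_continuous (V := R_NormedModule)). now exists l. Qed.

Lemma continuous_comp_R (f g : R -> R) (x : R) :
  continuous g x -> continuous f (g x) -> continuous (fun x => f (g x)) x.
Proof. apply continuous_comp. Qed.

Lemma continuous_sin_lin (a x : R) : continuous (fun x => sin (a * x)) x.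
Proof. eapply continuous_of_deriv. auto_derive; [easy|reflexivity]. Qed.

Lemma continuous_cos_lin (a x : R) : continuous (fun x => cos (a * x)) x.
Proof. eapply continuous_of_deriv. auto_derive; [easy|reflexivity]. Qed.

Lemma riemann_lebesgue (q : R -> R) (L : R) : 0 < L -> (forall x, continuous q x) ->
  forall eps, 0 < eps -> exists Lam, 0 < Lam /\ forall lam, Lam <= lam ->
    Rabs (RInt (fun v => q v * sin (lam * v)) 0 L) < eps.
Proof.
intros HL HC eps He.
destruct (ex_RInt_ub (V := R_NormedModule) q 0 L) as [M HM]; [now apply ex_RInt_cont|].
rewrite Rmin_left, Rmax_right in HM by lra.
assert (HM0 : 0 <= M).
{ eapply Rle_trans; [|apply (HM 0); lra]. apply Rabs_pos. }
assert (He1 : 0 < eps / (2 * L)) by (apply Rdiv_lt_0_compat; lra).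
destruct (unifcont_normed_1d (K := R_AbsRing) (V := R_NormedModule) q 0 L (fun x _ => HC x)
  (mkposreal _ He1)) as [del Hdel].
(* The three bounds serve uniform continuity, d < L, and end pieces of total size at most 2 d M <
   eps. *)
set (d0 := Rmin (Rmin del L) (eps / (2 * (M + 1)))).
assert (Hd0 : 0 < d0).
{ unfold d0. repeat apply Rmin_pos; [apply cond_pos|easy|]. apply Rdiv_lt_0_compat; lra. }
pose proof PI_RGT_0 as Hpi.
exists (2 * PI / d0). split; [apply Rdiv_lt_0_compat; lra|].
intros lam Hlam.
assert (Hl0 : 0 < lam) by (eapply Rlt_le_trans; [|exact Hlam]; apply Rdiv_lt_0_compat; lra).
set (d := PI / lam).
assert (Hd : 0 < d) by (apply Rdiv_lt_0_compat; lra).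
assert (Hdd : d < d0).
{ apply Rle_lt_trans with (d0 / 2); [|lra].
  unfold d. apply Rmult_le_reg_r with lam; [easy|].
  replace (PI / lam * lam) with PI by (field; lra).
  apply (Rmult_le_compat_l (d0 / 2)) in Hlam; [|lra].
  replace (d0 / 2 * (2 * PI / d0)) with PI in Hlam by (field; lra). easy. }
assert (D1 : d < del) by (eapply Rlt_le_trans; [exact Hdd|]; unfold d0; eapply Rle_trans; [apply Rmin_l|apply Rmin_l]).
assert (D2 : d < L) by (eapply Rlt_le_trans; [exact Hdd|]; unfold d0; eapply Rle_trans; [apply Rmin_l|apply Rmin_r]).
assert (D3 : d * (2 * (M + 1)) < eps).
{ apply Rlt_le_trans with (d0 * (2 * (M + 1))); [apply Rmult_lt_compat_r; lra|].
  apply Rle_trans with (eps / (2 * (M + 1)) * (2 * (M + 1))); [apply Rmult_le_compat_r; [lra|apply Rmin_r]|].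
  right; field; lra. }
set (f := fun v => q v * sin (lam * v)).
set (g := fun v => q (v + - d) * sin (lam * v)).
assert (Cf : forall x, continuous f x).
{ intros x. apply continuous_mult_R; [apply HC|apply continuous_sin_lin]. }
assert (Cs : forall x, continuous (fun v => q (v + - d)) x).
{ intros x. apply (continuous_comp_R q (fun v => v + - d)); [|apply HC].
  apply continuous_plus_R; [apply continuous_id|apply continuous_const]. }
assert (Cg : forall x, continuous g x).
{ intros x. apply continuous_mult_R; [apply Cs|apply continuous_sin_lin]. }
assert (Sh : RInt f 0 L = - RInt g d (L + d)).
{ transitivity (RInt (fun v => f (v + - d)) d (L + d)).
  - rewrite RInt_shift by easy. f_equal; ring.
  - replace (- RInt g d (L + d)) with (-1 * RInt g d (L + d)) by ring. rewrite <- RInt_scal_R by easy.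
    apply RInt_ext. intros x _. unfold f, g.
    replace (lam * (x + - d)) with (lam * x - PI) by (unfold d; field; lra).
    rewrite sin_minus, cos_PI, sin_PI. to_R. ring. }
rewrite (RInt_Chasles_R g d L (L + d)) in Sh by easy.
assert (E : 2 * RInt f 0 L = RInt f 0 d + (RInt f d L + -1 * RInt g d L) + - RInt g L (L + d)).
{ rewrite (RInt_Chasles_R f 0 d L) in * by easy. lra. }
rewrite <- (RInt_scal_R (-1) g), <- (RInt_plus_R f) in E; try easy.
2: { intros x; apply continuous_mult_R; [apply continuous_const|apply Cg]. }
assert (B1 : Rabs (RInt f 0 d) <= (d - 0) * M).
{ apply abs_RInt_le_cont; [lra|easy|]. intros x Hx. unfold f. rewrite Rabs_mult.
  assert (Rabs (q x) <= M) by (apply HM; lra).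
  assert (Rabs (sin (lam * x)) <= 1) by apply Rabs_le, SIN_bound.
  pose proof (Rabs_pos (q x)). pose proof (Rabs_pos (sin (lam * x))). nra. }
assert (B2 : Rabs (RInt g L (L + d)) <= (L + d - L) * M).
{ apply abs_RInt_le_cont; [lra|easy|]. intros x Hx. unfold g. rewrite Rabs_mult.
  assert (Rabs (q (x + - d)) <= M) by (apply HM; lra).
  assert (Rabs (sin (lam * x)) <= 1) by apply Rabs_le, SIN_bound.
  pose proof (Rabs_pos (q (x + - d))). pose proof (Rabs_pos (sin (lam * x))). nra. }
assert (B3 : Rabs (RInt (fun x => f x + -1 * g x) d L) <= (L - d) * (eps / (2 * L))).
{ apply abs_RInt_le_cont; [lra| |].
  { intros x. apply continuous_plus_R; [apply Cf|]. apply continuous_mult_R; [apply continuous_const|apply Cg]. }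
  intros x Hx. unfold f, g.
  replace (q x * sin (lam * x) + -1 * (q (x + - d) * sin (lam * x))) with
    ((q x - q (x + - d)) * sin (lam * x)) by ring.
  rewrite Rabs_mult.
  assert (Rabs (sin (lam * x)) <= 1) by apply Rabs_le, SIN_bound.
  assert (Rabs (q x - q (x + - d)) <= eps / (2 * L)).
  { left. apply (Hdel (x + - d) x); [lra|lra|].
    change (Rabs (x - (x + - d)) < del).
    replace (x - (x + - d)) with d by ring. rewrite Rabs_pos_eq; lra. }
  pose proof (Rabs_pos (q x - q (x + - d))). pose proof (Rabs_pos (sin (lam * x))). nra. }
assert (B4 : (L - d) * (eps / (2 * L)) <= eps / 2).
{ replace (eps / 2) with (L * (eps / (2 * L))) by (field; lra). apply Rmult_le_compat_r; lra. }
change (Rabs (RInt f 0 L) < eps).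
assert (Rabs (2 * RInt f 0 L) < 2 * eps).
{ rewrite E. eapply Rle_lt_trans; [apply Rabs_triang|]. rewrite Rabs_Ropp.
  eapply Rle_lt_trans; [apply Rplus_le_compat_r, Rabs_triang|]. lra. }
rewrite Rabs_mult, (Rabs_pos_eq 2) in H by lra. lra.
Qed.

(** Dirichlet kernel, the sum of e^(i n x) over |n| <= N. *)
Fixpoint dirk (N : nat) (x : R) : R :=
  match N with O => 1 | S n => dirk n x + 2 * cos (INR (S n) * x) end.

Lemma dirk_sin (N : nat) (x : R) : sin (x / 2) * dirk N x = sin ((INR N + / 2) * x).
Proof.
induction N.
- simpl. replace ((0 + / 2) * x) with (x / 2) by field. ring.
- cbn [dirk]. rewrite Rmult_plus_distr_l, IHN. rewrite S_INR.
  replace ((INR N + / 2) * x) with ((INR N + 1) * x - x / 2) by field.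
  replace ((INR N + 1 + / 2) * x) with ((INR N + 1) * x + x / 2) by field.
  rewrite sin_minus, sin_plus. ring.
Qed.

Lemma continuous_dirk (N : nat) (x : R) : continuous (dirk N) x.
Proof.
induction N; [apply continuous_const|].
apply continuous_plus_R; [easy|]. apply continuous_mult_R; [apply continuous_const|apply continuous_cos_lin].
Qed.

Lemma cos_nat_2PI (n : nat) : cos (INR n * (2 * PI)) = 1.
Proof.
replace (INR n * (2 * PI)) with (0 + 2 * INR n * PI) by ring. rewrite cos_period. apply cos_0.
Qed.

Lemma sin_nat_2PI (n : nat) : sin (INR n * (2 * PI)) = 0.
Proof.
replace (INR n * (2 * PI)) with (0 + 2 * INR n * PI) by ring. rewrite sin_period. apply sin_0.
Qed.

Lemma RInt_dirk (N : nat) : RInt (dirk N) 0 (2 * PI) = 2 * PI.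
Proof.
induction N.
- cbn [dirk]. rewrite RInt_const. change scal with Rmult. simpl. to_R. ring.
- cbn [dirk]. rewrite RInt_plus_R, IHN, RInt_scal_R; try (intros; apply continuous_cos_lin).
  2: apply continuous_dirk.
  2: intros; apply continuous_mult_R; [apply continuous_const|apply continuous_cos_lin].
  rewrite (RInt_of_primitive (fun x => sin (INR (S N) * x) / INR (S N))).
  + rewrite sin_nat_2PI, Rmult_0_r, sin_0. to_R. unfold Rdiv. ring.
  + intros x. assert (INR (S N) <> 0) by (apply not_0_INR; easy).
    set (c := INR (S N)) in *; clearbody c.
    auto_derive; [easy|]. to_R. field. easy.
  + intros; apply continuous_cos_lin.
Qed.

Lemma is_lim_slope (f : R -> R) (x l : R) : is_derive f x l ->
  is_lim (fun y => (f y - f x) / (y - x)) x l.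
Proof.
intros H. apply is_derive_Reals in H. apply is_lim_spec. intros eps.
destruct (H eps (cond_pos eps)) as [del Hdel].
exists del. intros y Hy Hne.
replace y with (x + (y - x)) at 1 by ring. apply Hdel; [lra|exact Hy].
Qed.

Lemma slope_quot_lim (g s : R -> R) (x a c : R) :
  is_derive g x a -> is_derive s x c -> c <> 0 -> s x = 0 ->
  is_lim (fun y => (g y - g x) / s y) x (a / c).
Proof.
intros Hg Hs Hc H0.
apply (is_lim_ext_loc (fun y => ((g y - g x) / (y - x)) / ((s y - s x) / (y - x)))).
- pose proof (is_lim_slope s x c Hs) as L. apply is_lim_spec in L.
  destruct (L (mkposreal (Rabs c) (Rabs_pos_lt _ Hc))) as [del Hdel]. simpl in Hdel.
  exists del. intros y Hy Hne. specialize (Hdel y Hy Hne).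
  rewrite H0, Rminus_0_r in *.
  assert (s y <> 0).
  { intros E. rewrite E in Hdel. unfold Rdiv in Hdel. rewrite Rmult_0_l, Rminus_0_l, Rabs_Ropp in Hdel. lra. }
  field. split; [easy|lra].
- apply (is_lim_div _ _ x a c); [now apply is_lim_slope|now apply is_lim_slope| |].
  + intros E. injection E. easy.
  + easy.
Qed.

(** Continuous extension of (g x - g 0) / sin(x / 2) from (0, 2 pi) to the line. The end values come
    from l'Hopital's rule: the denominator has slope 1/2 at 0 and -1/2 at 2 pi. *)
Definition quot_ext (g : R -> R) (a b x : R) : R :=
  if Rle_dec x 0 then 2 * a else if Rle_dec (2 * PI) x then -2 * b
  else (g x - g 0) / sin (x / 2).

Lemma continuous_quot_ext (g : R -> R) (a b : R) :
  (forall x, continuous g x) -> is_derive g 0 a -> is_derive g (2 * PI) b ->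
  g (2 * PI) = g 0 -> forall x, continuous (quot_ext g a b) x.
Proof.
intros HC Ha Hb Hp x. pose proof PI_RGT_0 as Hpi.
assert (Ds : forall y, is_derive (fun x => sin (x / 2)) y (cos (y / 2) / 2)).
{ intros y. auto_derive; [easy|]. to_R. unfold Rdiv. ring. }
assert (CQ : forall y, 0 < y < 2 * PI -> continuous (quot_ext g a b) y).
{ intros y Hy.
  apply (continuous_ext_loc _ (fun y => (g y - g 0) * / sin (y / 2))).
  - assert (He : 0 < Rmin y (2 * PI - y)) by (apply Rmin_pos; lra).
    exists (mkposreal _ He). intros z Hz. change (Rabs (z - y) < Rmin y (2 * PI - y)) in Hz.
    pose proof (Rmin_l y (2 * PI - y)). pose proof (Rmin_r y (2 * PI - y)).
    apply Rabs_def2 in Hz. unfold quot_ext. destruct Rle_dec; [lra|]. destruct Rle_dec; [lra|]. easy.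
  - apply continuous_mult_R.
    + apply continuous_minus_R; [apply HC|apply continuous_const].
    + apply (continuous_comp_R Rinv (fun y => sin (y / 2))); [eapply continuous_of_deriv, Ds|].
      assert (0 < sin (y / 2)) by (apply sin_gt_0; lra).
      apply (continuous_of_deriv _ _ (- 1 / sin (y / 2) ^ 2)). auto_derive; [lra|field; lra]. }
assert (KC : forall f : R -> R, forall y, (forall eps, 0 < eps -> exists del, 0 < del /\ forall z, Rabs (z - y) < del -> Rabs (f z - f y) < eps) -> continuous f y).
{ intros f y H. apply filterlim_locally. intros eps. destruct (H eps (cond_pos eps)) as [del [Hd Hdel]].
  exists (mkposreal del Hd). intros z Hz. now apply Hdel. }
destruct (Rlt_dec x 0) as [H|H].
{ apply (continuous_ext_loc _ (fun _ => 2 * a)); [|apply continuous_const].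
  assert (He : 0 < - x) by lra. exists (mkposreal _ He). intros z Hz. change (Rabs (z - x) < - x) in Hz.
  apply Rabs_def2 in Hz. unfold quot_ext. destruct Rle_dec; [easy|lra]. }
destruct (Rlt_dec (2 * PI) x) as [H'|H'].
{ apply (continuous_ext_loc _ (fun _ => -2 * b)); [|apply continuous_const].
  assert (He : 0 < x - 2 * PI) by lra. exists (mkposreal _ He). intros z Hz.
  change (Rabs (z - x) < x - 2 * PI) in Hz.
  apply Rabs_def2 in Hz. unfold quot_ext. destruct Rle_dec; [lra|]. destruct Rle_dec; [easy|lra]. }
destruct (Req_dec x 0) as [->|H0].
{ apply KC. intros eps He.
  assert (L := slope_quot_lim g (fun x => sin (x / 2)) 0 a (cos (0 / 2) / 2) Ha (Ds 0)).
  cbv beta in L. replace (0 / 2) with 0 in L by field. rewrite cos_0, sin_0 in L.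
  specialize (L ltac:(lra) eq_refl). apply is_lim_spec in L.
  destruct (L (mkposreal eps He)) as [del Hdel]. simpl in Hdel.
  exists (Rmin del PI). split; [apply Rmin_pos; [apply cond_pos|easy]|].
  intros z Hz. pose proof (Rmin_l del PI). pose proof (Rmin_r del PI).
  unfold quot_ext at 2. destruct Rle_dec; [|lra].
  unfold quot_ext. destruct (Rle_dec z 0). { rewrite Rminus_diag, Rabs_R0. easy. }
  apply Rabs_def2 in Hz as Hz'.
  destruct (Rle_dec (2 * PI) z); [lra|].
  replace (2 * a) with (a / (1 / 2)) by field. apply Hdel; [|lra].
  change (Rabs (z - 0) < del). lra. }
destruct (Req_dec x (2 * PI)) as [->|H1].
{ apply KC. intros eps He.
  assert (L := slope_quot_lim g (fun x => sin (x / 2)) (2 * PI) b (cos (2 * PI / 2) / 2) Hb (Ds (2 * PI))).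
  cbv beta in L. replace (2 * PI / 2) with PI in L by field. rewrite cos_PI, sin_PI in L.
  specialize (L ltac:(lra) eq_refl). apply is_lim_spec in L.
  destruct (L (mkposreal eps He)) as [del Hdel]. simpl in Hdel.
  exists (Rmin del PI). split; [apply Rmin_pos; [apply cond_pos|easy]|].
  intros z Hz. pose proof (Rmin_l del PI). pose proof (Rmin_r del PI).
  unfold quot_ext at 2. destruct Rle_dec; [lra|]. destruct Rle_dec; [|lra].
  unfold quot_ext. destruct (Rle_dec z 0). { apply Rabs_def2 in Hz. lra. }
  destruct (Rle_dec (2 * PI) z). { rewrite Rminus_diag, Rabs_R0. easy. }
  replace (-2 * b) with (b / (-1 / 2)) by field. rewrite <- Hp. apply Hdel; [|lra].
  change (Rabs (z - 2 * PI) < del). lra. }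
apply CQ. lra.
Qed.

(** Subtracting g(0) times the kernel, of mass 2 pi, leaves [quot_ext] against sin((N + 1/2) x),
    which the Riemann-Lebesgue lemma sends to 0. Derivatives are asked for only at the two ends, so
    that g may have a corner inside, as it does in [is_series_cosh]. *)
Theorem dirichlet_fourier (g : R -> R) (a b : R) :
  (forall x, continuous g x) -> is_derive g 0 a -> is_derive g (2 * PI) b ->
  g (2 * PI) = g 0 ->
  is_lim_seq (fun N => RInt (fun x => g x * dirk N x) 0 (2 * PI)) (2 * PI * g 0).
Proof.
intros HC Ha Hb Hp. pose proof PI_RGT_0 as Hpi.
pose proof (continuous_quot_ext g a b HC Ha Hb Hp) as Cq.
apply is_lim_seq_spec. intros eps.
destruct (riemann_lebesgue (quot_ext g a b) (2 * PI) ltac:(lra) Cq eps (cond_pos eps)) as [Lam [HL H]].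
destruct (INR_unbounded Lam) as [N0 HN0].
exists N0. intros N HN.
assert (E : RInt (fun x => g x * dirk N x) 0 (2 * PI) - 2 * PI * g 0 =
  RInt (fun x => quot_ext g a b x * sin ((INR N + / 2) * x)) 0 (2 * PI)).
{ replace (2 * PI * g 0) with (g 0 * RInt (dirk N) 0 (2 * PI)) by (rewrite RInt_dirk; ring).
  rewrite <- RInt_scal_R by apply continuous_dirk.
  rewrite <- (RInt_minus (V := R_CompleteNormedModule)).
  - apply RInt_ext. intros x Hx. rewrite Rmin_left, Rmax_right in Hx by lra.
    unfold quot_ext. destruct Rle_dec; [lra|]. destruct Rle_dec; [lra|].
    assert (0 < sin (x / 2)) by (apply sin_gt_0; lra).
    rewrite <- dirk_sin. change minus with Rminus. change (g x * dirk N x - g 0 * dirk N x = (g x - g 0) / sin (x / 2) * (sin (x / 2) * dirk N x)). field. lra.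
  - apply ex_RInt_cont. intros; apply continuous_mult_R; [easy|apply continuous_dirk].
  - apply ex_RInt_cont. intros; apply continuous_mult_R; [apply continuous_const|apply continuous_dirk]. }
rewrite E. apply H. assert (INR N0 <= INR N) by now apply le_INR. lra.
Qed.

(** * Identity theorem on discs *)

(** On the rectangle [-A, 0] x [0, 2 pi] the horizontal sides cancel by periodicity and the left
    side contributes nothing, so the right side integrates to 0. The two claims are the imaginary
    and the real part of the integral of G dz. *)
Lemma goursat_vanish (G : C -> C) (A : R) : 0 < A ->
  (forall u v, - A <= u <= 0 -> 0 <= v <= 2 * PI -> exists d, cderiv G (u, v) d) ->
  (forall u, - A <= u <= 0 -> G (u, 2 * PI) = G (u, 0)) ->
  (forall v, 0 <= v <= 2 * PI -> G (- A, v) = 0) ->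
  RInt (fun v => Re (G (0, v))) 0 (2 * PI) = 0 /\ RInt (fun v => Im (G (0, v))) 0 (2 * PI) = 0.
Proof.
intros HA HD Hper H0. pose proof PI_RGT_0 as Hpi.
assert (S : forall P Q : R -> R -> R,
  (forall u v, - A <= u <= 0 -> 0 <= v <= 2 * PI -> exists a b c,
     differentiable_pt_lim P u v a b /\ differentiable_pt_lim Q u v b c) ->
  (forall u, - A <= u <= 0 -> P u (2 * PI) = P u 0) ->
  (forall v, 0 <= v <= 2 * PI -> Q (- A) v = 0) ->
  RInt (fun v => Q 0 v) 0 (2 * PI) = 0).
{ intros P Q H1 H2 H3.
  pose proof (goursat P Q (- A) A 0 (2 * PI) HA ltac:(lra)) as E.
  unfold rect_circ in E. replace (- A + A) with 0 in E by ring. replace (0 + 2 * PI) with (2 * PI) in E by ring.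
  specialize (E H1).
  rewrite (RInt_ext _ (fun _ => 0)) in E.
  2: { intros u. rewrite Rmin_left, Rmax_right by lra. intros Hu. rewrite H2 by lra. to_R. ring. }
  rewrite RInt_const in E. change scal with Rmult in E. simpl in E. rewrite Rmult_0_r, Rplus_0_l in E.
  transitivity (RInt (fun v => Q 0 v - Q (- A) v) 0 (2 * PI)); [|exact E].
  apply RInt_ext. intros v. rewrite Rmin_left, Rmax_right by lra. intros Hv.
  rewrite H3 by lra. to_R. ring. }
split.
- apply (S (fun u v => Im (G (u, v))) (fun u v => Re (G (u, v)))).
  + intros u v Hu Hv. destruct (HD u v Hu Hv) as [d Hd].
    apply differentiable_re_of_cderiv in Hd. exists (Im d), (Re d), (- Im d). tauto.
  + intros u Hu. now rewrite Hper.
  + intros v Hv. now rewrite H0.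
- assert (E : RInt (fun v => -1 * Im (G (0, v))) 0 (2 * PI) = 0).
  { apply (S (fun u v => Re (G (u, v))) (fun u v => -1 * Im (G (u, v)))).
    + intros u v Hu Hv. destruct (HD u v Hu Hv) as [d Hd].
      apply differentiable_re_of_cderiv in Hd as [D1 D2]. exists (Re d), (- Im d), (- Re d). split; [easy|].
      replace (- Im d) with (0 * Im (G (u, v)) + (-1) * Im d) by ring.
      apply filterdiff_differentiable_pt_lim in D2. apply filterdiff_differentiable_pt_lim.
      apply (filterdiff_ext_lin _ (fun t => scal (-1) (fst t * Im d + snd t * Re d))).
      * apply (filterdiff_scal_r_fct (V := R_NormedModule) (-1)); [apply Rmult_comm|exact D2].
      * intros t. change scal with Rmult. simpl. ring.
    + intros u Hu. now rewrite Hper.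
    + intros v Hv. rewrite H0 by easy. simpl. ring. }
  rewrite (RInt_scal (V := R_CompleteNormedModule)) in E.
  + change scal with Rmult in E. simpl in E. lra.
  + apply (ex_RInt_continuous (V := R_CompleteNormedModule)). intros v Hv.
    rewrite Rmin_left, Rmax_right in Hv by lra.
    destruct (HD 0 v ltac:(lra) Hv) as [d Hd]. apply differentiable_re_of_cderiv in Hd as [D1 D2].
    exact (differentiable_continuous_2 _ _ _ _ _ D2).
Qed.

Lemma RInt_dirk_zero (g : R -> R) (N : nat) : (forall x, continuous g x) ->
  (forall n, RInt (fun v => g v * cos (INR n * v)) 0 (2 * PI) = 0) ->
  RInt (fun v => g v * dirk N v) 0 (2 * PI) = 0.
Proof.
intros HC H. induction N.
- transitivity (RInt (fun v => g v * cos (INR 0 * v)) 0 (2 * PI)); [|apply H]. apply RInt_ext. intros x _. simpl. rewrite Rmult_0_l, cos_0. easy.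
- cbn [dirk].
  rewrite (RInt_ext _ (fun v => g v * dirk N v + 2 * (g v * cos (INR (S N) * v)))).
  2: { intros x _. to_R. ring. }
  rewrite RInt_plus_R, RInt_scal_R, IHN, H; [to_R; ring| | |].
  + intros; apply continuous_mult_R; [easy|apply continuous_cos_lin].
  + intros; apply continuous_mult_R; [easy|apply continuous_dirk].
  + intros. apply continuous_mult_R; [apply continuous_const|].
    apply continuous_mult_R; [easy|apply continuous_cos_lin].
Qed.

(** Cosine coefficients suffice because only the value at 0 is recovered, where all sine terms
    vanish. *)
Lemma fourier_zero (g : R -> R) : (forall x, ex_derive g x) -> g (2 * PI) = g 0 ->
  (forall n, RInt (fun v => g v * cos (INR n * v)) 0 (2 * PI) = 0) -> g 0 = 0.
Proof.
intros HD Hp H. pose proof PI_RGT_0.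
assert (HC : forall x, continuous g x).
{ intros x. apply (ex_derive_continuous (V := R_NormedModule)), HD. }
destruct (HD 0) as [a Ha]. destruct (HD (2 * PI)) as [b Hb].
pose proof (dirichlet_fourier g a b HC Ha Hb Hp) as L.
apply (is_lim_seq_ext _ (fun _ => 0)) in L.
2: { intros N. now apply RInt_dirk_zero. }
apply is_lim_seq_unique in L. rewrite Lim_seq_const in L. injection L. nra.
Qed.

Lemma cderiv_affine_cexp (c z w : C) : cderiv (fun w => (c + z * cexp w)%C) w (z * cexp w)%C.
Proof.
replace (z * cexp w)%C with (0 + (0 * cexp w + z * cexp w))%C by ring.
apply (cderiv_plus (fun _ => c) (fun w => z * cexp w)%C); [apply cderiv_const|].
apply (cderiv_mult (fun _ => z) cexp); [apply cderiv_const|apply cderiv_cexp].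
Qed.

Lemma cderiv_cexp_scal (a w : C) : cderiv (fun w => cexp (a * w)) w (a * cexp (a * w))%C.
Proof.
replace (a * cexp (a * w))%C with ((0 * w + a * 1) * cexp (a * w))%C by ring.
apply (cderiv_comp cexp (fun w => a * w)%C); [apply cderiv_cexp|].
apply (cderiv_mult (fun _ => a) (fun w => w)); [apply cderiv_const|apply cderiv_id].
Qed.

Lemma differentiable_derive_2 (P : R -> R -> R) (x y a b : R) :
  differentiable_pt_lim P x y a b -> is_derive (fun v => P x v) y b.
Proof.
intros H. apply is_derive_Reals. replace b with (a * 0 + b * 1) by ring.
apply (derivable_pt_lim_comp_2d P (fun _ => x) (fun v => v)); [easy| |].
- apply derivable_pt_lim_const.
- apply derivable_pt_lim_id.
Qed.

(* Goursat's theorem for f (c + z e^w) e^(-k w) on a long rectangle of height 2 pi shows that all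
   Fourier coefficients of f on the circle through c + z vanish. *)
Theorem disc_identity (f : C -> C) (c : C) (R r : R) : 0 < r ->
  (forall z, Cmod (z - c)%C < R -> exists d, cderiv f z d) ->
  (forall z, Cmod (z - c)%C < r -> f z = 0) ->
  forall z, Cmod (z - c)%C < R -> f z = 0.
Proof.
intros Hr HD H0 z' Hz. pose proof PI_RGT_0 as Hpi.
set (z := (z' - c)%C) in *.
replace z' with (c + z * cexp 0)%C by (rewrite cexp_0; unfold z; ring).
destruct (Rlt_dec (Cmod z) r) as [Hs|Hs].
{ rewrite cexp_0. apply H0. replace (c + z * 1 - c)%C with z by ring. easy. }
(* By e^A > 1 + A > |z| / r, the left edge Re w = -A is mapped into the disc of radius r, where f
   vanishes. *)
set (A := Cmod z / r + 1).
assert (Hm : 0 < Cmod z) by lra.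
assert (HA : 0 < A) by (unfold A; pose proof (Rdiv_lt_0_compat _ _ Hm Hr); lra).
assert (HA2 : Cmod z * exp (- A) < r).
{ rewrite exp_Ropp. pose proof (exp_ineq1 A ltac:(lra)).
  apply Rmult_lt_reg_r with (exp A); [apply exp_pos|].
  rewrite Rmult_assoc, Rinv_l, Rmult_1_r by (apply Rgt_not_eq, exp_pos).
  apply Rle_lt_trans with (r * (1 + A)).
  - unfold A. replace (r * (1 + (Cmod z / r + 1))) with (2 * r + Cmod z) by (field; lra). lra.
  - apply Rmult_lt_compat_l; lra. }
assert (Hc : forall w, Cmod (c + z * cexp w - c)%C = Cmod z * exp (Re w)).
{ intros w. replace (c + z * cexp w - c)%C with (z * cexp w)%C by ring.
  now rewrite Cmod_mult, Cmod_cexp. }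
assert (HF : forall w, Re w <= 0 -> exists d, cderiv (fun w => f (c + z * cexp w)%C) w d).
{ intros w Hw. destruct (HD (c + z * cexp w)%C) as [d Hd].
  - rewrite Hc. assert (exp (Re w) <= 1) by (rewrite <- exp_0; now apply exp_le). nra.
  - eexists. apply (cderiv_comp f (fun w => (c + z * cexp w)%C)); [exact Hd|apply cderiv_affine_cexp]. }
set (F := fun w => f (c + z * cexp w)%C) in *.
assert (Hper : forall u, cexp (u, 2 * PI)%R = cexp (u, 0)).
{ intros u. unfold cexp; simpl. now rewrite cos_2PI, sin_2PI, cos_0, sin_0. }
(* The sign e distinguishes the multipliers e^(-k w) and e^(k w). Adding the two relations isolates
   the cosine coefficients of Re F and of Im F. *)
assert (V : forall k : nat, forall e, (e = 1 \/ e = -1) ->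
  RInt (fun v => Re (F (0, v)) * cos (INR k * v) + e * (Im (F (0, v)) * sin (INR k * v))) 0 (2 * PI) = 0 /\
  RInt (fun v => Im (F (0, v)) * cos (INR k * v) + e * -1 * (Re (F (0, v)) * sin (INR k * v))) 0 (2 * PI) = 0).
{ intros k e He.
  destruct (goursat_vanish (fun w => (F w * cexp (RtoC (- e * INR k) * w))%C) A HA) as [E1 E2].
  - intros u v Hu Hv. destruct (HF (u, v)) as [d Hd]; [simpl; lra|].
    eexists. apply (cderiv_mult F (fun w => cexp (RtoC (- e * INR k) * w))); [exact Hd|apply cderiv_cexp_scal].
  - intros u Hu. f_equal.
    + unfold F. now rewrite Hper.
    + unfold cexp, Cmult, RtoC, Re, Im; simpl.
      replace (- e * INR k * (2 * PI) + 0 * u) with (- e * (INR k * (2 * PI))) by ring.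
      replace (- e * INR k * 0 + 0 * u) with 0 by ring.
      rewrite cos_0, sin_0.
      replace (- e * INR k * u - 0 * (2 * PI)) with (- e * INR k * u - 0 * 0) by ring.
      assert (cos (- e * (INR k * (2 * PI))) = 1 /\ sin (- e * (INR k * (2 * PI))) = 0) as [-> ->]; [|easy].
      destruct He as [-> | ->].
      * replace (- (1) * (INR k * (2 * PI))) with (- (INR k * (2 * PI))) by ring.
        rewrite cos_neg, sin_neg, cos_nat_2PI, sin_nat_2PI. lra.
      * replace (- (-1) * (INR k * (2 * PI))) with (INR k * (2 * PI)) by ring.
        now rewrite cos_nat_2PI, sin_nat_2PI.
  - intros v Hv. unfold F. rewrite H0; [ring|]. rewrite Hc. exact HA2.
  - assert (T : forall v, cexp (RtoC (- e * INR k) * (0, v)) = (cos (INR k * v), - e * sin (INR k * v))).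
    { intros v. unfold cexp, Cmult, RtoC, Re, Im; simpl.
      replace (- e * INR k * 0 - 0 * v) with 0 by ring. rewrite exp_0.
      replace (- e * INR k * v + 0 * 0) with (- e * (INR k * v)) by ring.
      destruct He as [-> | ->].
      - replace (- (1) * (INR k * v)) with (- (INR k * v)) by ring.
        rewrite cos_neg, sin_neg. f_equal; ring.
      - replace (- (-1) * (INR k * v)) with (INR k * v) by ring. f_equal; ring. }
    split; [etransitivity; [|exact E1] | etransitivity; [|exact E2]]; apply RInt_ext; intros v _; rewrite T;
      destruct (F (0, v)); unfold Cmult, Re, Im; simpl; to_R; ring. }
assert (HD1 : forall v, ex_derive (fun v => Re (F (0, v))) v /\ ex_derive (fun v => Im (F (0, v))) v).
{ intros v. destruct (HF (0, v)) as [d Hd]; [simpl; lra|].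
  apply differentiable_re_of_cderiv in Hd as [D1 D2]. split.
  - exists (- Im d). exact (differentiable_derive_2 _ _ _ _ _ D1).
  - exists (Re d). exact (differentiable_derive_2 _ _ _ _ _ D2). }
assert (C1 : forall v, continuous (fun v => Re (F (0, v))) v).
{ intros x. apply (ex_derive_continuous (V := R_NormedModule)), HD1. }
assert (C2 : forall v, continuous (fun v => Im (F (0, v))) v).
{ intros x. apply (ex_derive_continuous (V := R_NormedModule)), HD1. }
assert (Z : Re (F (0, 0)) = 0 /\ Im (F (0, 0)) = 0).
{ split.
  - apply (fourier_zero (fun v => Re (F (0, v)))).
    + intros x; apply HD1.
    + unfold F. now rewrite Hper.
    + intros n. destruct (V n 1 ltac:(lra)) as [A1 _]. destruct (V n (-1) ltac:(lra)) as [A2 _].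
      rewrite RInt_plus_R, RInt_scal_R in A1, A2; try lra;
        intros; repeat apply continuous_mult_R; auto using continuous_const, continuous_cos_lin, continuous_sin_lin.
  - apply (fourier_zero (fun v => Im (F (0, v)))).
    + intros x; apply HD1.
    + unfold F. now rewrite Hper.
    + intros n. destruct (V n 1 ltac:(lra)) as [_ A1]. destruct (V n (-1) ltac:(lra)) as [_ A2].
      rewrite RInt_plus_R, RInt_scal_R in A1, A2; try lra;
        intros; repeat apply continuous_mult_R; auto using continuous_const, continuous_cos_lin, continuous_sin_lin. }
change (F (0, 0) = 0). destruct (F (0, 0)) as [p q]. simpl in Z. destruct Z as [-> ->]. easy.
Qed.

(** * Laplace transforms on the half-line *)

(** Integral over the half-line, as a limit along integer end points; it is meaningful once
    [exp_dom] ensures convergence. *)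
Definition hint (f : R -> R) : R := real (Lim_seq (fun n => RInt f 0 (INR n))).

(** Continuity is imposed on the whole line so that integrals over any segment exist without side
    conditions; the decay concerns the half-line only. *)
Definition exp_dom (f : R -> R) (M q : R) : Prop :=
  (forall x, continuous f x) /\ 0 < q /\ forall v, 0 <= v -> Rabs (f v) <= M * exp (- q * v).

Lemma exp_dom_const_nonneg (f : R -> R) (M q : R) : exp_dom f M q -> 0 <= M.
Proof.
intros (_ & _ & H). specialize (H 0 (Rle_refl 0)). rewrite Rmult_0_r, exp_0, Rmult_1_r in H.
pose proof (Rabs_pos (f 0)). lra.
Qed.

Lemma RInt_exp_dom (f : R -> R) (M q a b : R) : exp_dom f M q -> 0 <= a <= b ->
  Rabs (RInt f a b) <= M / q * exp (- q * a).
Proof.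
intros HE Hab. pose proof (exp_dom_const_nonneg _ _ _ HE) as HM. destruct HE as (HC & Hq & H).
eapply Rle_trans; [apply abs_RInt_le; [easy|now apply ex_RInt_cont]|].
assert (Ce : forall x, continuous (fun v => M * exp (- q * v)) x).
{ intros x. eapply continuous_of_deriv. auto_derive; [easy|reflexivity]. }
apply Rle_trans with (RInt (fun v => M * exp (- q * v)) a b).
- apply RInt_le; [easy| |now apply ex_RInt_cont|].
  + apply ex_RInt_norm. now apply ex_RInt_cont.
  + intros x Hx. apply H. lra.
- rewrite (RInt_of_primitive (fun v => - (M / q) * exp (- q * v))); [|  |easy].
  + pose proof (exp_pos (- q * b)).
    assert (0 <= M / q) by (apply Rmult_le_pos; [easy|left; now apply Rinv_0_lt_compat]). nra.
  + intros x. auto_derive; [easy|]. to_R. field. lra.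
Qed.

Lemma exp_decay_lim (c q : R) : 0 < q -> is_lim_seq (fun n => c * exp (- q * INR n)) 0.
Proof.
intros Hq. replace (Finite 0) with (Rbar_mult c 0) by (simpl; now rewrite Rmult_0_r).
apply is_lim_seq_scal_l.
apply (is_lim_seq_ext (fun n => (exp (- q)) ^ n)).
- intros n. induction n; [simpl; now rewrite Rmult_0_r, exp_0|].
  rewrite S_INR. simpl. rewrite IHn, <- exp_plus. f_equal. ring.
- apply is_lim_seq_geom. rewrite Rabs_pos_eq by (left; apply exp_pos).
  rewrite <- exp_0. apply exp_increasing. lra.
Qed.

Lemma hint_lim (f : R -> R) (M q : R) : exp_dom f M q ->
  is_lim_seq (fun n => RInt f 0 (INR n)) (hint f).
Proof.
intros HE. unfold hint. apply Lim_seq_correct'. apply ex_lim_seq_cauchy_corr.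
intros eps. destruct (proj2 (is_lim_seq_spec _ _) (exp_decay_lim (M / q) q (proj1 (proj2 HE))) eps) as [N HN].
exists N.
assert (W : forall n m, (N <= n)%nat -> (n <= m)%nat -> Rabs (RInt f 0 (INR n) - RInt f 0 (INR m)) < eps).
{ intros n m Hn Hm. rewrite (RInt_Chasles_R f 0 (INR n) (INR m)) by apply HE.
  replace (RInt f 0 (INR n) - (RInt f 0 (INR n) + RInt f (INR n) (INR m))) with (- RInt f (INR n) (INR m)) by ring.
  rewrite Rabs_Ropp. eapply Rle_lt_trans.
  - apply (RInt_exp_dom f M q); [easy|]. split; [apply pos_INR|now apply le_INR].
  - specialize (HN n Hn). rewrite Rminus_0_r in HN. eapply Rle_lt_trans; [apply Rle_abs|exact HN]. }
intros n m Hn Hm. destruct (Nat.le_ge_cases n m); [now apply W|]. rewrite Rabs_minus_sym. now apply W.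
Qed.

Lemma hint_tail (f : R -> R) (M q U : R) : exp_dom f M q -> 0 <= U ->
  Rabs (RInt f 0 U - hint f) <= M / q * exp (- q * U).
Proof.
intros HE HU.
assert (L : is_lim_seq (fun n => Rabs (RInt f 0 U - RInt f 0 (INR n))) (Rabs (RInt f 0 U - hint f))).
{ apply (is_lim_seq_abs _ (Finite _)). apply is_lim_seq_minus'; [apply is_lim_seq_const|eapply hint_lim; exact HE]. }
refine (is_lim_seq_le_loc _ (fun _ => M / q * exp (- q * U)) _ (Finite _) _ L (is_lim_seq_const _)).
destruct (INR_unbounded U) as [N HN]. exists N. intros n Hn. apply le_INR in Hn.
rewrite (RInt_Chasles_R f 0 U (INR n)) by apply HE.
replace (RInt f 0 U - (RInt f 0 U + RInt f U (INR n))) with (- RInt f U (INR n)) by ring.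
rewrite Rabs_Ropp. apply (RInt_exp_dom f M q); [easy|lra].
Qed.

Lemma hint_bound (f : R -> R) (M q : R) : exp_dom f M q -> Rabs (hint f) <= M / q.
Proof.
intros HE. pose proof (hint_tail f M q 0 HE (Rle_refl 0)) as H.
rewrite RInt_point, Rmult_0_r, exp_0, Rmult_1_r in H. change zero with 0 in H.
rewrite Rminus_0_l, Rabs_Ropp in H. easy.
Qed.

Lemma hint_lim_unique (f : R -> R) (l : R) :
  is_lim_seq (fun n => RInt f 0 (INR n)) l -> hint f = l.
Proof. intros H. unfold hint. now rewrite (is_lim_seq_unique _ _ H). Qed.

(** A translation by c moves the end points n to n + c and n - c, so limits along other sequences
    than the integers are needed. *)
Lemma hint_lim_at (f : R -> R) (M q : R) (u : nat -> R) : exp_dom f M q ->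
  is_lim_seq u p_infty -> is_lim_seq (fun n => RInt f 0 (u n)) (hint f).
Proof.
intros HE Hu. apply is_lim_seq_spec. intros eps.
assert (HM := exp_dom_const_nonneg _ _ _ HE). assert (Hq := proj1 (proj2 HE)).
destruct (proj2 (is_lim_seq_spec _ _) (exp_decay_lim (M / q) q Hq) eps) as [N HN].
specialize (HN N (le_n N)). rewrite Rminus_0_r in HN.
destruct (proj2 (is_lim_seq_spec _ _) Hu (INR N)) as [n0 Hn0].
exists n0. intros n Hn. specialize (Hn0 n Hn). simpl in Hn0.
pose proof (pos_INR N).
eapply Rle_lt_trans; [apply (hint_tail f M q); [easy|lra]|].
eapply Rle_lt_trans; [|exact HN]. eapply Rle_trans; [|apply Rle_abs].
apply Rmult_le_compat_l; [apply Rmult_le_pos; [easy|left; now apply Rinv_0_lt_compat]|].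
apply exp_le. nra.
Qed.

Lemma hint_plus (f g : R -> R) (M q M' q' : R) : exp_dom f M q -> exp_dom g M' q' ->
  hint (fun v => f v + g v) = hint f + hint g.
Proof.
intros Hf Hg. apply hint_lim_unique.
apply (is_lim_seq_ext (fun n => RInt f 0 (INR n) + RInt g 0 (INR n))).
- intros n. rewrite RInt_plus_R; [easy|apply Hf|apply Hg].
- apply is_lim_seq_plus'; eapply hint_lim; eassumption.
Qed.

Lemma hint_scal (c : R) (f : R -> R) (M q : R) : exp_dom f M q ->
  hint (fun v => c * f v) = c * hint f.
Proof.
intros Hf. apply hint_lim_unique.
apply (is_lim_seq_ext (fun n => c * RInt f 0 (INR n))).
- intros n. rewrite RInt_scal_R; [easy|apply Hf].
- apply (is_lim_seq_scal_l _ c (Finite _)). eapply hint_lim; eassumption.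
Qed.

Lemma hint_ext (f g : R -> R) : (forall v, f v = g v) -> hint f = hint g.
Proof.
intros H. unfold hint. f_equal. apply Lim_seq_ext. intros n. apply RInt_ext. intros; apply H.
Qed.

Lemma exp_dom_weaken (f : R -> R) (M q M' q' : R) : exp_dom f M q -> M <= M' -> 0 < q' <= q ->
  exp_dom f M' q'.
Proof.
intros H HM Hq. pose proof (exp_dom_const_nonneg _ _ _ H). destruct H as (HC & Hq0 & Hb).
repeat split; [easy|lra|]. intros v Hv. eapply Rle_trans; [now apply Hb|].
apply Rmult_le_compat; [easy|left; apply exp_pos|easy|]. apply exp_le. nra.
Qed.

Definition Ccont (g : R -> C) : Prop :=
  forall v, continuous (fun v => Re (g v)) v /\ continuous (fun v => Im (g v)) v.

Definition cdom (g : R -> C) (M q : R) : Prop :=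
  Ccont g /\ 0 < q /\ forall v, 0 <= v -> Cmod (g v) <= M * exp (- q * v).

Definition chint (g : R -> C) : C := (hint (fun v => Re (g v)), hint (fun v => Im (g v))).

Lemma cdom_re (g : R -> C) (M q : R) : cdom g M q -> exp_dom (fun v => Re (g v)) M q.
Proof.
intros (HC & Hq & Hb). repeat split; [apply HC|easy|].
intros v Hv. eapply Rle_trans; [apply re_le_Cmod|now apply Hb].
Qed.

Lemma cdom_im (g : R -> C) (M q : R) : cdom g M q -> exp_dom (fun v => Im (g v)) M q.
Proof.
intros (HC & Hq & Hb). repeat split; [apply HC|easy|].
intros v Hv. eapply Rle_trans; [apply im_le_Cmod|now apply Hb].
Qed.

Lemma cdom_const_nonneg (g : R -> C) (M q : R) : cdom g M q -> 0 <= M.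
Proof. intros H. eapply exp_dom_const_nonneg, cdom_re, H. Qed.

Lemma cdom_weaken (f : R -> C) (M q M' q' : R) : cdom f M q -> M <= M' -> 0 < q' <= q ->
  cdom f M' q'.
Proof.
intros H HM Hq. pose proof (cdom_const_nonneg _ _ _ H). destruct H as (HC & Hq0 & Hb).
split; [easy|split; [lra|]]. intros v Hv. eapply Rle_trans; [now apply Hb|].
apply Rmult_le_compat; [easy|left; apply exp_pos|easy|]. apply exp_le. nra.
Qed.

Lemma Ccont_plus (f g : R -> C) : Ccont f -> Ccont g -> Ccont (fun v => f v + g v)%C.
Proof.
intros Hf Hg v. destruct (Hf v), (Hg v). split; simpl; now apply continuous_plus_R.
Qed.

Lemma Ccont_mult (f g : R -> C) : Ccont f -> Ccont g -> Ccont (fun v => f v * g v)%C.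
Proof.
intros Hf Hg v. destruct (Hf v), (Hg v). split; simpl.
- apply continuous_minus_R; now apply continuous_mult_R.
- apply continuous_plus_R; now apply continuous_mult_R.
Qed.

Lemma Ccont_const (c : C) : Ccont (fun _ => c).
Proof. intros v. split; apply continuous_const. Qed.

Lemma Ccont_R (f : R -> R) : (forall v, continuous f v) -> Ccont (fun v => RtoC (f v)).
Proof. intros H v. split; [apply H|apply continuous_const]. Qed.

Lemma Ccont_cexp (f : R -> C) : Ccont f -> Ccont (fun v => cexp (f v)).
Proof.
intros Hf v. destruct (Hf v) as [H1 H2]. split; apply continuous_mult_R.
- apply (continuous_comp_R exp); [easy|apply continuous_of_deriv with (1 := is_derive_exp _)].
- apply (continuous_comp_R cos); [easy|apply continuous_of_deriv with (1 := is_derive_cos _)].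
- apply (continuous_comp_R exp); [easy|apply continuous_of_deriv with (1 := is_derive_exp _)].
- apply (continuous_comp_R sin); [easy|apply continuous_of_deriv with (1 := is_derive_sin _)].
Qed.

Lemma cdom_ext (f g : R -> C) (M q : R) : (forall v, f v = g v) -> cdom f M q -> cdom g M q.
Proof.
intros E (HC & Hq & Hb). split; [|split; [easy|]].
- intros v. destruct (HC v). split.
  + apply (continuous_ext (fun v => Re (f v))); [intros; now rewrite E|easy].
  + apply (continuous_ext (fun v => Im (f v))); [intros; now rewrite E|easy].
- intros v Hv. rewrite <- E. now apply Hb.
Qed.

Lemma cdom_plus (f g : R -> C) (M q M' q' : R) : cdom f M q -> cdom g M' q' ->
  cdom (fun v => f v + g v)%C (M + M') (Rmin q q').
Proof.
intros Hf Hg.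
assert (0 < Rmin q q') by (apply Rmin_pos; [apply Hf|apply Hg]).
apply (cdom_weaken _ _ _ M (Rmin q q')) in Hf; [|lra|split; [easy|apply Rmin_l]].
apply (cdom_weaken _ _ _ M' (Rmin q q')) in Hg; [|lra|split; [easy|apply Rmin_r]].
destruct Hf as (A1 & A2 & A3), Hg as (B1 & B2 & B3).
split; [now apply Ccont_plus|split; [easy|]].
intros v Hv. eapply Rle_trans; [apply Cmod_triangle|]. rewrite Rmult_plus_distr_r.
apply Rplus_le_compat; auto.
Qed.

Lemma cdom_scal (c : C) (f : R -> C) (M q : R) : cdom f M q ->
  cdom (fun v => c * f v)%C (Cmod c * M) q.
Proof.
intros (A1 & A2 & A3). split; [apply Ccont_mult; [apply Ccont_const|easy]|split; [easy|]].
intros v Hv. rewrite Cmod_mult, Rmult_assoc. apply Rmult_le_compat_l; [apply Cmod_ge_0|auto].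
Qed.

Lemma chint_ext (f g : R -> C) : (forall v, f v = g v) -> chint f = chint g.
Proof. intros H. unfold chint. f_equal; apply hint_ext; intros; now rewrite H. Qed.

Lemma chint_plus (f g : R -> C) (M q M' q' : R) : cdom f M q -> cdom g M' q' ->
  chint (fun v => f v + g v)%C = (chint f + chint g)%C.
Proof.
intros Hf Hg. unfold chint, Cplus; simpl. f_equal.
- eapply (hint_plus (fun v => Re (f v)) (fun v => Re (g v))); eapply cdom_re; eassumption.
- eapply (hint_plus (fun v => Im (f v)) (fun v => Im (g v))); eapply cdom_im; eassumption.
Qed.

Lemma chint_scal (c : C) (f : R -> C) (M q : R) : cdom f M q ->
  chint (fun v => c * f v)%C = (c * chint f)%C.
Proof.
intros Hf. pose proof (cdom_re _ _ _ Hf) as H1. pose proof (cdom_im _ _ _ Hf) as H2.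
assert (S : forall k g M q, exp_dom g M q -> exp_dom (fun v => k * g v) (Rabs k * M) q).
{ intros k g M0 q0 (A1 & A2 & A3). repeat split; [|easy|].
  - intros; apply continuous_mult_R; [apply continuous_const|easy].
  - intros v Hv. rewrite Rabs_mult, Rmult_assoc. apply Rmult_le_compat_l; [apply Rabs_pos|auto]. }
unfold chint. destruct c as [a b]. unfold Cmult; simpl. f_equal.
- rewrite (hint_ext _ (fun v => a * Re (f v) + (- b) * Im (f v))) by (intros; unfold Re, Im; ring).
  erewrite hint_plus by (apply S; eassumption). erewrite !hint_scal by eassumption. ring.
- rewrite (hint_ext _ (fun v => a * Im (f v) + b * Re (f v))) by (intros; unfold Re, Im; ring).
  erewrite hint_plus by (apply S; eassumption). erewrite !hint_scal by eassumption. ring.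
Qed.

Lemma chint_bound (f : R -> C) (M q : R) : cdom f M q -> Cmod (chint f) <= 2 * M / q.
Proof.
intros Hf. eapply Rle_trans; [apply Cmod_le_abs|].
pose proof (hint_bound _ _ _ (cdom_re _ _ _ Hf)). pose proof (hint_bound _ _ _ (cdom_im _ _ _ Hf)).
unfold chint, Re at 1, Im at 1; simpl. lra.
Qed.

Definition lap (phi : R -> R) (s : C) : C :=
  chint (fun v => cexp (- (s * RtoC v)) * RtoC (phi v))%C.

Lemma Ccont_lker (s : C) : Ccont (fun v => cexp (- (s * RtoC v))%C).
Proof.
apply (Ccont_cexp (fun v => - (s * RtoC v))%C).
intros v. split; simpl.
- eapply continuous_of_deriv. auto_derive; [easy|reflexivity].
- eapply continuous_of_deriv. auto_derive; [easy|reflexivity].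
Qed.

Lemma Cmod_lker (s : C) (v : R) : Cmod (cexp (- (s * RtoC v)))%C = exp (- Re s * v).
Proof. rewrite Cmod_cexp. f_equal. unfold Re; simpl. ring. Qed.

Lemma cdom_lap (phi : R -> R) (s : C) (M p : R) : (forall v, continuous phi v) ->
  (forall v, 0 <= v -> Rabs (phi v) <= M * exp (- p * v)) -> - p < Re s ->
  cdom (fun v => cexp (- (s * RtoC v)) * RtoC (phi v))%C M (Re s + p).
Proof.
intros HC Hb Hs. split; [|split; [lra|]].
- apply Ccont_mult; [apply Ccont_lker|now apply Ccont_R].
- intros v Hv. rewrite Cmod_mult, Cmod_lker, Cmod_R.
  replace (M * exp (- (Re s + p) * v)) with (exp (- Re s * v) * (M * exp (- p * v))).
  + apply Rmult_le_compat_l; [left; apply exp_pos|now apply Hb].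
  + replace (- (Re s + p) * v) with (- Re s * v + - p * v) by ring. rewrite exp_plus. ring.
Qed.

Lemma Cmod_cexp_sub_1_sub (z : C) : Cmod (cexp z - 1 - z)%C <= 4 * Cmod z ^ 2 * exp (Cmod z).
Proof.
eapply Rle_trans; [apply Cmod_le_abs|].
pose proof (cexp_sub_1_sub_re z). pose proof (cexp_sub_1_sub_im z). lra.
Qed.

Lemma sq_le_exp (q v : R) : 0 < q -> 0 <= v -> v ^ 2 <= 4 / q ^ 2 * exp (q * v).
Proof.
intros Hq Hv. replace (q * v) with (q * v / 2 + q * v / 2) by field. rewrite exp_plus.
assert (q * v / 2 <= exp (q * v / 2)).
{ destruct (Req_dec (q * v / 2) 0) as [E|E]; [rewrite E; left; apply exp_pos|].
  pose proof (exp_ineq1 _ E). lra. }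
assert (0 <= q * v / 2) by nra.
assert (q * v / 2 * (q * v / 2) <= exp (q * v / 2) * exp (q * v / 2)) by (apply Rmult_le_compat; easy).
apply Rle_trans with (4 / q ^ 2 * (q * v / 2 * (q * v / 2))); [right; field; lra|].
apply Rmult_le_compat_l; [|easy]. left. apply Rdiv_lt_0_compat; [lra|now apply pow_lt].
Qed.

(** Differentiation under the integral sign, by integrating the second-order bound 4 |h v|^2 e^(|h|
    v) for e^(-h v) - 1 + h v; the candidate derivative has the extra factor -v. *)
Lemma cderiv_lap (phi : R -> R) (s : C) (M p : R) : (forall v, continuous phi v) ->
  (forall v, 0 <= v -> Rabs (phi v) <= M * exp (- p * v)) -> - p < Re s ->
  exists d, cderiv (lap phi) s d.
Proof.
intros HC Hb Hs.
(* The decay margin is 4 q. A factor v or v^2 costs e^(q v) and the factor e^(|h| v) costs another,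
   so the derivative keeps rate 3 q and the error rate 2 q. *)
set (q := (Re s + p) / 4). assert (Hq : 0 < q) by (unfold q; lra).
assert (HM : 0 <= M).
{ specialize (Hb 0 (Rle_refl 0)). rewrite Rmult_0_r, exp_0 in Hb. pose proof (Rabs_pos (phi 0)). lra. }
exists (chint (fun v => cexp (- (s * RtoC v)) * RtoC (phi v) * (- RtoC v))%C).
assert (Hd : cdom (fun v => cexp (- (s * RtoC v)) * RtoC (phi v) * (- RtoC v))%C (M * (1 + 4 / q ^ 2)) (3 * q)).
{ split; [|split; [lra|]].
  - apply Ccont_mult; [apply Ccont_mult; [apply Ccont_lker|now apply Ccont_R]|].
    intros v. split; simpl; eapply continuous_of_deriv; auto_derive; easy || reflexivity.
  - intros v Hv. rewrite !Cmod_mult, Cmod_lker, Cmod_opp, !Cmod_R, (Rabs_pos_eq v) by easy.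
    assert (v <= (1 + 4 / q ^ 2) * exp (q * v)).
    { pose proof (sq_le_exp q v Hq Hv). assert (1 <= exp (q * v)) by (rewrite <- exp_0; apply exp_le; nra). nra. }
    apply Rle_trans with (exp (- Re s * v) * (M * exp (- p * v)) * ((1 + 4 / q ^ 2) * exp (q * v))).
    + apply Rmult_le_compat; [|easy| |easy].
      * apply Rmult_le_pos; [left; apply exp_pos|apply Rabs_pos].
      * apply Rmult_le_compat_l; [left; apply exp_pos|now apply Hb].
    + right. replace (exp (- (3 * q) * v)) with (exp (- Re s * v) * exp (- p * v) * exp (q * v)); [ring|].
      rewrite <- !exp_plus. f_equal. unfold q. field. }
intros eps He.
set (K := 2 * (M * (16 / q ^ 2)) / (2 * q)).
assert (HK : 0 <= K).
{ unfold K. assert (0 < / (2 * q)) by (apply Rinv_0_lt_compat; lra).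
  assert (0 < 16 / q ^ 2) by (apply Rdiv_lt_0_compat; [lra|now apply pow_lt]).
  apply Rmult_le_pos; [|lra]. apply Rmult_le_pos; [lra|]. apply Rmult_le_pos; lra. }
exists (Rmin q (eps / (K + 1))). split; [apply Rmin_pos; [easy|apply Rdiv_lt_0_compat; lra]|].
intros h Hh.
assert (H1 : Cmod h < q) by (eapply Rlt_le_trans; [exact Hh|apply Rmin_l]).
assert (H2 : Cmod h < eps / (K + 1)) by (eapply Rlt_le_trans; [exact Hh|apply Rmin_r]).
pose proof (Cmod_ge_0 h) as Hh0.
assert (Hsh : - p < Re (s + h)%C).
{ pose proof (re_le_Cmod h) as X. apply Rabs_le_between in X. unfold q in H1. simpl in *.
  unfold Re in *; simpl in *. lra. }
pose proof (cdom_lap phi s M p HC Hb Hs) as D0.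
pose proof (cdom_lap phi (s + h) M p HC Hb Hsh) as D1.
assert (E : (lap phi (s + h) - lap phi s - h * chint (fun v => cexp (- (s * RtoC v)) * RtoC (phi v) * (- RtoC v)))%C
  = chint (fun v => cexp (- (s * RtoC v)) * RtoC (phi v) * (cexp (- (h * RtoC v)) - 1 - (- (h * RtoC v))))%C).
{ symmetry.
  rewrite (chint_ext _ (fun v => (cexp (- ((s + h) * RtoC v)) * RtoC (phi v)) +
     ((- (1)) * (cexp (- (s * RtoC v)) * RtoC (phi v)) +
      (- h) * (cexp (- (s * RtoC v)) * RtoC (phi v) * (- RtoC v))))%C).
  2: { intros v. replace (- ((s + h) * RtoC v))%C with (- (s * RtoC v) + - (h * RtoC v))%C by ring.
       rewrite cexp_plus. ring. }
  erewrite chint_plus; [|exact D1|].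
  2: { apply cdom_plus; [apply cdom_scal, D0|apply cdom_scal, Hd]. }
  erewrite chint_plus; [|apply cdom_scal, D0|apply cdom_scal, Hd].
  erewrite !chint_scal; [|exact Hd|exact D0]. unfold lap. ring. }
rewrite E.
assert (D2 : cdom (fun v => cexp (- (s * RtoC v)) * RtoC (phi v) * (cexp (- (h * RtoC v)) - 1 - (- (h * RtoC v))))%C
  (M * (16 / q ^ 2) * Cmod h ^ 2) (2 * q)).
{ split; [|split; [lra|]].
  - apply Ccont_mult; [apply Ccont_mult; [apply Ccont_lker|now apply Ccont_R]|].
    apply (Ccont_plus (fun v => cexp (- (h * RtoC v)) - 1)%C).
    + apply (Ccont_plus (fun v => cexp (- (h * RtoC v)))%C); [apply Ccont_lker|apply Ccont_const].
    + intros v. split; simpl; eapply continuous_of_deriv; auto_derive; easy || reflexivity.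
  - intros v Hv. rewrite !Cmod_mult, Cmod_lker, Cmod_R.
    pose proof (Cmod_cexp_sub_1_sub (- (h * RtoC v))%C) as X.
    rewrite Cmod_opp, Cmod_mult, Cmod_R, (Rabs_pos_eq v) in X by easy.
    apply Rle_trans with (exp (- Re s * v) * (M * exp (- p * v)) * (4 * (Cmod h ^ 2 * (4 / q ^ 2 * exp (q * v))) * exp (q * v))).
    + apply Rmult_le_compat; [|apply Cmod_ge_0| |].
      * apply Rmult_le_pos; [left; apply exp_pos|apply Rabs_pos].
      * apply Rmult_le_compat_l; [left; apply exp_pos|now apply Hb].
      * eapply Rle_trans; [exact X|]. rewrite Rpow_mult_distr.
        assert (Y := sq_le_exp q v Hq Hv).
        assert (0 <= Cmod h ^ 2) by now apply pow_le. assert (0 <= v ^ 2) by now apply pow_le.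
        apply Rmult_le_compat; [nra|left; apply exp_pos| |].
        -- apply Rmult_le_compat_l; [lra|]. now apply Rmult_le_compat_l.
        -- apply exp_le. apply Rmult_le_compat_r; lra.
    + right. replace (exp (- (2 * q) * v)) with (exp (- Re s * v) * exp (- p * v) * (exp (q * v) * exp (q * v))); [field; lra|].
      rewrite <- !exp_plus. f_equal. unfold q. field. }
eapply Rle_trans; [apply chint_bound, D2|].
replace (2 * (M * (16 / q ^ 2) * Cmod h ^ 2) / (2 * q)) with (K * Cmod h * Cmod h) by (unfold K; field; lra).
apply Rmult_le_compat_r; [easy|].
apply Rle_trans with ((K + 1) * Cmod h); [nra|].
apply (Rmult_lt_compat_l (K + 1)) in H2; [|lra].
replace ((K + 1) * (eps / (K + 1))) with eps in H2 by (field; lra). lra.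
Qed.

Lemma hint_primitive (F f : R -> R) (l : R) :
  (forall v, is_derive F v (f v)) -> (forall v, continuous f v) ->
  is_lim_seq (fun n => F (INR n)) l -> hint f = l - F 0.
Proof.
intros HD HC HL. apply hint_lim_unique.
apply (is_lim_seq_ext (fun n => F (INR n) - F 0)).
- intros n. symmetry. now apply RInt_of_primitive.
- apply is_lim_seq_minus'; [easy|apply is_lim_seq_const].
Qed.

Lemma lap_one (s : C) : 0 < Re s -> chint (fun v => cexp (- (s * RtoC v)))%C = (/ s)%C.
Proof.
intros Hs.
assert (H0 : s <> 0) by (intros E; rewrite E in Hs; simpl in Hs; lra).
assert (D : cdom (fun v => cexp (- (s * RtoC v)))%C 1 (Re s)).
{ split; [apply Ccont_lker|split; [easy|]]. intros v Hv. rewrite Cmod_lker. lra. }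
(* After multiplication by s the integrand has the primitive -e^(-s v), whose coordinates involve no
   division. *)
assert (E : (s * chint (fun v => cexp (- (s * RtoC v))))%C = 1).
{ erewrite <- chint_scal by exact D. destruct s as [x y]. simpl in Hs. unfold chint, RtoC. f_equal.
  - rewrite (hint_primitive (fun v => - (exp (- x * v) * cos (y * v))) _ 0).
    + rewrite !Rmult_0_r, exp_0, cos_0. ring.
    + intros v. unfold cexp, Cmult, Copp, Re, Im; simpl. auto_derive; [easy|]. to_R.
      replace (- (x * v - y * 0)) with (- x * v) by ring.
      replace (- (x * 0 + y * v)) with (- (y * v)) by ring. rewrite cos_neg, sin_neg. ring.
    + intros v. exact (proj1 (proj1 (cdom_scal (x, y) _ _ _ D) v)).
    + apply (is_lim_seq_le_le (fun n => (-1) * exp (- x * INR n)) _ (fun n => 1 * exp (- x * INR n)));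
        [|now apply exp_decay_lim|now apply exp_decay_lim].
      intros n. pose proof (exp_pos (- x * INR n)). pose proof (COS_bound (y * INR n)). nra.
  - rewrite (hint_primitive (fun v => (exp (- x * v) * sin (y * v))) _ 0).
    + rewrite !Rmult_0_r, exp_0, sin_0. ring.
    + intros v. unfold cexp, Cmult, Copp, Re, Im; simpl. auto_derive; [easy|]. to_R.
      replace (- (x * v - y * 0)) with (- x * v) by ring.
      replace (- (x * 0 + y * v)) with (- (y * v)) by ring. rewrite cos_neg, sin_neg. ring.
    + intros v. exact (proj2 (proj1 (cdom_scal (x, y) _ _ _ D) v)).
    + apply (is_lim_seq_le_le (fun n => (-1) * exp (- x * INR n)) _ (fun n => 1 * exp (- x * INR n)));
        [|now apply exp_decay_lim|now apply exp_decay_lim].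
      intros n. pose proof (exp_pos (- x * INR n)). pose proof (SIN_bound (y * INR n)). nra. }
apply (f_equal (Cmult (/ s))) in E. rewrite Cmult_assoc, Cinv_l, Cmult_1_l, Cmult_1_r in E; easy.
Qed.

(** * Continued Mellin transforms *)

(** Sum over j < n, empty at n = 0, whereas [sum_n] includes its last index. *)
Fixpoint rsum (f : nat -> R) (n : nat) : R :=
  match n with O => 0 | S n => rsum f n + f n end.

Fixpoint csum (f : nat -> C) (n : nat) : C :=
  match n with O => RtoC 0 | S n => (csum f n + f n)%C end.

Definition cint_dom (g : R -> C) : Prop := exists M q, cdom g M q.

Lemma cint_dom_plus (f g : R -> C) : cint_dom f -> cint_dom g -> cint_dom (fun v => f v + g v)%C.
Proof. intros (M & q & H) (M' & q' & H'). eexists _, _. now apply cdom_plus; eassumption. Qed.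

Lemma cint_dom_scal (c : C) (f : R -> C) : cint_dom f -> cint_dom (fun v => c * f v)%C.
Proof. intros (M & q & H). eexists _, _. apply cdom_scal; eassumption. Qed.

Lemma cint_dom_ext (f g : R -> C) : (forall v, f v = g v) -> cint_dom f -> cint_dom g.
Proof. intros E (M & q & H). exists M, q. now apply (cdom_ext f). Qed.

Lemma chint_plus' (f g : R -> C) : cint_dom f -> cint_dom g ->
  chint (fun v => f v + g v)%C = (chint f + chint g)%C.
Proof. intros (M & q & H) (M' & q' & H'). eapply chint_plus; eassumption. Qed.

Lemma chint_scal' (c : C) (f : R -> C) : cint_dom f -> chint (fun v => c * f v)%C = (c * chint f)%C.
Proof. intros (M & q & H). eapply chint_scal; eassumption. Qed.

(** The expansion sum of beta_j t^(j-1) at t = e^(-v); it starts at 1/t because h has a simple pole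
    at 0. *)
Definition psum (beta : nat -> R) (K : nat) (v : R) : R :=
  rsum (fun j => beta j * exp (- (INR j - 1) * v)) K.

Definition mrem (phi : R -> R) (beta : nat -> R) (K : nat) (v : R) : R :=
  phi (exp (- v)) - psum beta K v.

(* [phi t = sum_(j < K) beta_j t^(j-1) + O(t^p)] at 0+, and [phi] decays faster than any power at
   infinity; both conditions are written in the variable [v = -/+ ln t]. *)
Definition mellin_data (phi : R -> R) (beta : nat -> R) (K : nat) (p : R) : Prop :=
  (forall v, continuous (fun v => phi (exp v)) v) /\
  (exists M, forall v, 0 <= v -> Rabs (mrem phi beta K v) <= M * exp (- p * v)) /\
  (forall q, exists M, forall v, 0 <= v -> Rabs (phi (exp v)) <= M * exp (- q * v)).

(* The Mellin transform [int_0^oo t^(s-1) phi t dt], continued to [Re s > -p]. *)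
Definition mel (phi : R -> R) (beta : nat -> R) (K : nat) (s : C) : C :=
  (lap (mrem phi beta K) s + csum (fun j => RtoC (beta j) / (s + RtoC (INR j - 1)))%C K +
   lap (fun v => phi (exp v)) (- s))%C.

(* [mel] with only the first [L] of its [K] polar terms, hence regular at the other poles. *)
Definition mel_partial (phi : R -> R) (beta : nat -> R) (K L : nat) (s : C) : C :=
  (lap (mrem phi beta K) s + csum (fun j => RtoC (beta j) / (s + RtoC (INR j - 1)))%C L +
   lap (fun v => phi (exp v)) (- s))%C.

Lemma continuous_rsum_exp (beta : nat -> R) (K : nat) (v : R) :
  continuous (psum beta K) v.
Proof.
induction K; [apply continuous_const|]. apply (continuous_plus_R (psum beta K)); [easy|].
set (c := - (INR K - 1)). clearbody c.
eapply continuous_of_deriv. auto_derive; [easy|reflexivity].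
Qed.

Lemma continuous_mrem (phi : R -> R) (beta : nat -> R) (K : nat) :
  (forall v, continuous (fun v => phi (exp v)) v) -> forall v, continuous (mrem phi beta K) v.
Proof.
intros H v. apply continuous_minus_R; [|apply continuous_rsum_exp].
apply (continuous_comp_R (fun v => phi (exp v)) Ropp); [|apply H].
eapply continuous_of_deriv. auto_derive; [easy|reflexivity].
Qed.

Lemma cderiv_csum (f : nat -> C -> C) (s : C) (K : nat) :
  (forall j, (j < K)%nat -> exists d, cderiv (f j) s d) ->
  exists d, cderiv (fun s => csum (fun j => f j s) K) s d.
Proof.
induction K; intros H; [exists (RtoC 0); exact (cderiv_const (RtoC 0) s)|].
destruct IHK as [d Hd]; [intros; apply H; lia|].
destruct (H K) as [d' Hd']; [lia|].
exists (d + d')%C. now apply (cderiv_plus (fun s => csum (fun j => f j s) K)).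
Qed.

Lemma cderiv_mel_partial (phi : R -> R) (beta : nat -> R) (K L : nat) (p : R) (s : C) :
  mellin_data phi beta K p -> - p < Re s ->
  (forall j, (j < L)%nat -> beta j = 0 \/ (s + RtoC (INR j - 1))%C <> 0) ->
  exists d, cderiv (mel_partial phi beta K L) s d.
Proof.
intros (HC & [M HM] & Hi) Hs Hj.
destruct (cderiv_lap (mrem phi beta K) s M p) as [d1 H1]; [now apply continuous_mrem|easy|easy|].
destruct (cderiv_csum (fun j s => RtoC (beta j) / (s + RtoC (INR j - 1)))%C s L) as [d2 H2].
(* A term with zero coefficient is identically 0, even at its own pole, division being total. *)
{ intros j Hlt. destruct (Hj j Hlt) as [E|E].
  - exists 0. apply (cderiv_ext (fun _ => 0)); [|apply cderiv_const].
    intros w. rewrite E. unfold Cdiv. ring.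
  - eexists. apply (cderiv_mult (fun _ => RtoC (beta j)) (fun s => / (s + RtoC (INR j - 1)))%C); [apply cderiv_const|].
    apply (cderiv_comp Cinv (fun s => s + RtoC (INR j - 1))%C); [now apply cderiv_inv|].
    apply (cderiv_plus (fun s => s)); [apply cderiv_id|apply cderiv_const]. }
(* One unit of decay beyond Re s makes the Laplace integral at -s converge. *)
destruct (Hi (Re s + 1)) as [M' HM'].
destruct (cderiv_lap (fun v => phi (exp v)) (- s)%C M' (Re s + 1)) as [d3 H3]; [easy|easy|unfold Re; simpl; lra|].
eexists. apply (cderiv_plus (fun s => lap (mrem phi beta K) s + csum (fun j => RtoC (beta j) / (s + RtoC (INR j - 1))) L)%C
  (fun s => lap (fun v => phi (exp v)) (- s)%C)).
- apply cderiv_plus; eassumption.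
- apply (cderiv_comp (lap (fun v => phi (exp v))) Copp); [exact H3|].
  apply cderiv_opp, cderiv_id.
Qed.

Definition wdom (g : R -> C) : Prop := cint_dom g /\ cint_dom (fun v => g (- v)).

(** Integral over the whole line, split at 0. Applied to [mker s phi] it is the convergent Mellin
    integral under t = e^v. *)
Definition wint (g : R -> C) : C := (chint (fun v => g (- v)%R) + chint g)%C.

Lemma wint_plus (f g : R -> C) : wdom f -> wdom g ->
  wint (fun v => f v + g v)%C = (wint f + wint g)%C.
Proof.
intros [H1 H2] [H3 H4]. unfold wint.
rewrite (chint_plus' (fun v => f (- v)) (fun v => g (- v))) by easy.
rewrite (chint_plus' f g) by easy. ring.
Qed.

Lemma wint_scal (c : C) (f : R -> C) : wdom f -> wint (fun v => c * f v)%C = (c * wint f)%C.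
Proof.
intros [H1 H2]. unfold wint.
rewrite (chint_scal' c (fun v => f (- v))) by easy. rewrite (chint_scal' c f) by easy. ring.
Qed.

Lemma wint_ext (f g : R -> C) : (forall v, f v = g v) -> wint f = wint g.
Proof. intros H. unfold wint. f_equal; apply chint_ext; intros; apply H. Qed.

Lemma wdom_plus (f g : R -> C) : wdom f -> wdom g -> wdom (fun v => f v + g v)%C.
Proof.
intros [H1 H2] [H3 H4]. split; [now apply cint_dom_plus|].
now apply (cint_dom_plus (fun v => f (- v)) (fun v => g (- v))).
Qed.

Lemma wdom_scal (c : C) (f : R -> C) : wdom f -> wdom (fun v => c * f v)%C.
Proof.
intros [H1 H2]. split; [now apply cint_dom_scal|]. now apply (cint_dom_scal c (fun v => f (- v))).
Qed.

Lemma wdom_ext (f g : R -> C) : (forall v, f v = g v) -> wdom f -> wdom g.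
Proof.
intros E [H1 H2]. split; [now apply (cint_dom_ext f)|].
apply (cint_dom_ext (fun v => f (- v))); [intros; apply E|easy].
Qed.

Definition mker (s : C) (phi : R -> R) (v : R) : C := (cexp (s * RtoC v) * RtoC (phi (exp v)))%C.

(** The subtracted powers can be restored: beta_j e^(-(j-1) v) has Laplace transform beta_j / (s + j
    - 1), and Re s > 1 is what the term j = 0 requires. *)
Lemma lap_add_rsum (rho : R -> R) (beta : nat -> R) (s : C) (K : nat) : 1 < Re s ->
  cint_dom (fun v => cexp (- (s * RtoC v)) * RtoC (rho v))%C ->
  let f := (fun v => cexp (- (s * RtoC v)) *
      RtoC (rho v + psum beta K v))%C in
  cint_dom f /\
  chint f = (lap rho s + csum (fun j => RtoC (beta j) / (s + RtoC (INR j - 1)))%C K)%C.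
Proof.
intros Hs HD. simpl. induction K as [|K [IH1 IH2]].
- unfold psum; cbn [rsum csum]; fold (psum beta). split.
  + apply (cint_dom_ext _ _) with (2 := HD). intros v. now rewrite Rplus_0_r.
  + unfold lap. rewrite Cplus_0_r. apply chint_ext. intros v. now rewrite Rplus_0_r.
- cbn [csum]. set (t := (s + RtoC (INR K - 1))%C).
  assert (Ht : 0 < Re t) by (unfold t, Re; simpl; unfold Re in Hs; pose proof (pos_INR K); lra).
  assert (Dt : cint_dom (fun v => cexp (- (t * RtoC v)))%C).
  { exists 1, (Re t). split; [apply Ccont_lker|split; [easy|]]. intros v Hv. rewrite Cmod_lker. lra. }
  assert (E : forall v, (cexp (- (s * RtoC v)) *
      RtoC (rho v + psum beta (S K) v))%C =
     (cexp (- (s * RtoC v)) * RtoC (rho v + psum beta K v) +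
      RtoC (beta K) * cexp (- (t * RtoC v)))%C).
  { intros v. unfold t. replace (- ((s + RtoC (INR K - 1)) * RtoC v))%C with
      (- (s * RtoC v) + RtoC (- (INR K - 1) * v))%C.
    - rewrite cexp_plus. replace (cexp (RtoC (- (INR K - 1) * v))) with (RtoC (exp (- (INR K - 1) * v))).
      + change (psum beta (S K) v) with (psum beta K v + beta K * exp (- (INR K - 1) * v)).
        rewrite !RtoC_plus, RtoC_mult. ring.
      + unfold cexp, RtoC, Re, Im; simpl. rewrite cos_0, sin_0. f_equal; ring.
    - unfold Cmult, Cplus, Copp, RtoC; simpl. f_equal; ring. }
  split.
  + eapply cint_dom_ext; [intros; symmetry; apply E|]. apply cint_dom_plus; [easy|now apply cint_dom_scal].
  + rewrite (chint_ext _ _ E). rewrite chint_plus' by (easy || now apply cint_dom_scal).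
    rewrite chint_scal' by easy. rewrite IH2, lap_one by easy. unfold Cdiv. fold t. ring.
Qed.

Lemma mel_conv (phi : R -> R) (beta : nat -> R) (K : nat) (p : R) (s : C) :
  mellin_data phi beta K p -> 1 < Re s -> - p < Re s ->
  wdom (mker s phi) /\ mel phi beta K s = wint (mker s phi).
Proof.
intros (HC & [M HM] & Hi) Hs Hp.
destruct (lap_add_rsum (mrem phi beta K) beta s K Hs) as [D E].
{ eexists _, _. apply cdom_lap; [now apply continuous_mrem|exact HM|easy]. }
assert (E1 : forall v, (cexp (- (s * RtoC v)) *
      RtoC (mrem phi beta K v + psum beta K v))%C = mker s phi (- v)).
{ intros v. unfold mker, mrem. rewrite RtoC_opp. replace (s * - RtoC v)%C with (- (s * RtoC v))%C by ring.
  f_equal. f_equal. ring. }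
destruct (Hi (Re s + 1)) as [M' HM'].
assert (D2 : cint_dom (mker s phi)).
{ exists M'. eexists. apply (cdom_ext (fun v => cexp (- (- s * RtoC v)) * RtoC (phi (exp v)))%C).
  - intros v. unfold mker. f_equal. f_equal. ring.
  - apply (cdom_lap (fun v => phi (exp v)) (- s) M' (Re s + 1)); [easy|easy|unfold Re; simpl; lra]. }
split.
- split; [easy|]. eapply cint_dom_ext; [exact E1|exact D].
- unfold mel, wint. rewrite <- E. f_equal.
  + apply chint_ext, E1.
  + apply chint_ext. intros v. unfold mker. f_equal. f_equal. ring.
Qed.

Lemma hint2_shift (f : R -> R) (c M1 q1 M2 q2 M3 q3 M4 q4 : R) :
  exp_dom f M1 q1 -> exp_dom (fun v => f (- v)) M2 q2 ->
  exp_dom (fun v => f (v + c)) M3 q3 -> exp_dom (fun v => f (- v + c)) M4 q4 ->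
  hint (fun v => f (- v + c)) + hint (fun v => f (v + c)) = hint (fun v => f (- v)) + hint f.
Proof.
intros H1 H2 H3 H4.
assert (C1 := proj1 H1). assert (C3 := proj1 H3).
assert (P : forall n : nat, RInt (fun v => f (- v + c)) 0 (INR n) + RInt (fun v => f (v + c)) 0 (INR n) =
  RInt (fun v => f (- v)) 0 (INR n - c) + RInt f 0 (INR n + c)).
{ intros n. rewrite (RInt_reflect (fun v => f (v + c))) by easy. rewrite (RInt_reflect f) by easy.
  rewrite !RInt_shift by easy. rewrite Rplus_0_l.
  replace (- INR n + c) with (- (INR n - c)) by ring.
  rewrite <- (RInt_Chasles_R f (- (INR n - c)) c (INR n + c)) by easy.
  rewrite <- (RInt_Chasles_R f (- (INR n - c)) 0 (INR n + c)) by easy. easy. }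
assert (L1 : is_lim_seq (fun n => RInt (fun v => f (- v + c)) 0 (INR n) + RInt (fun v => f (v + c)) 0 (INR n))
  (hint (fun v => f (- v + c)) + hint (fun v => f (v + c)))).
{ apply is_lim_seq_plus'; eapply hint_lim; eassumption. }
assert (L2 : is_lim_seq (fun n => RInt (fun v => f (- v + c)) 0 (INR n) + RInt (fun v => f (v + c)) 0 (INR n))
  (hint (fun v => f (- v)) + hint f)).
{ apply (is_lim_seq_ext (fun n => RInt (fun v => f (- v)) 0 (INR n - c) + RInt f 0 (INR n + c))).
  { intros; now rewrite P. }
  apply is_lim_seq_plus'.
  - eapply hint_lim_at; [eassumption|].
    eapply is_lim_seq_minus; [apply is_lim_seq_INR|apply is_lim_seq_const|easy].
  - eapply hint_lim_at; [eassumption|].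
    eapply is_lim_seq_plus; [apply is_lim_seq_INR|apply is_lim_seq_const|easy]. }
apply is_lim_seq_unique in L1. apply is_lim_seq_unique in L2. rewrite L1 in L2. now injection L2.
Qed.

(** In the variable t = e^v this is invariance of dt / t under scaling. *)
Lemma wint_shift (g : R -> C) (c : R) : wdom g -> wdom (fun v => g (v + c)) ->
  wint (fun v => g (v + c)) = wint g.
Proof.
intros [(M1 & q1 & H1) (M2 & q2 & H2)] [(M3 & q3 & H3) (M4 & q4 & H4)].
unfold wint, chint, Cplus; simpl. f_equal.
- eapply (hint2_shift (fun v => Re (g v))).
  + eapply cdom_re, H1.
  + exact (cdom_re _ _ _ H2).
  + exact (cdom_re _ _ _ H3).
  + exact (cdom_re _ _ _ H4).
- eapply (hint2_shift (fun v => Im (g v))).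
  + eapply cdom_im, H1.
  + exact (cdom_im _ _ _ H2).
  + exact (cdom_im _ _ _ H3).
  + exact (cdom_im _ _ _ H4).
Qed.

(** * The Gamma function *)

(* exp lies above its tangent at ln (q / delta). *)
Lemma exp_exp_decay (delta q : R) : 0 < delta ->
  exists M, forall v, 0 <= v -> exp (- delta * exp v) <= M * exp (- q * v).
Proof.
intros Hd. set (q' := Rmax q 1).
assert (Hq : 1 <= q') by apply Rmax_r. assert (Hqq : q <= q') by apply Rmax_l.
set (w := ln (q' / delta)).
assert (Hw : delta * exp w = q').
{ unfold w. rewrite exp_ln by (apply Rdiv_lt_0_compat; lra). field. lra. }
exists (exp (q' * (w - 1))). intros v Hv. rewrite <- exp_plus. apply exp_le.
assert (E : exp v = exp w * exp (v - w)) by (rewrite <- exp_plus; f_equal; ring).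
pose proof (exp_ineq1_le (v - w)) as T.
assert (q' * (1 + (v - w)) <= delta * exp v).
{ rewrite E, <- Rmult_assoc, Hw. apply Rmult_le_compat_l; lra. }
nra.
Qed.

Lemma rsum_ext (f g : nat -> R) (n : nat) : (forall j, (j < n)%nat -> f j = g j) -> rsum f n = rsum g n.
Proof.
induction n; intros H; [easy|]. cbn [rsum]. rewrite IHn, H; [easy|lia|]. intros; apply H; lia.
Qed.

Lemma rsum_S_l (f : nat -> R) (n : nat) : rsum f (S n) = f O + rsum (fun j => f (S j)) n.
Proof. induction n; [simpl; ring|]. cbn [rsum] in *. rewrite IHn. ring. Qed.

Definition tay (n : nat) (t : R) : R := rsum (fun i => (-1) ^ i / INR (fact i) * t ^ i) n.

Lemma is_derive_tay (n : nat) (t : R) : is_derive (tay (S n)) t (- tay n t).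
Proof.
induction n.
- unfold tay; simpl. auto_derive; [easy|ring].
- apply (is_derive_ext (fun t => tay (S n) t + (-1) ^ S n / INR (fact (S n)) * t ^ S n)); [easy|].
  replace (- tay (S n) t) with (- tay n t + (-1) ^ S n / INR (fact (S n)) * (INR (S n) * t ^ n)).
  + apply (is_derive_plus (V := R_NormedModule)); [easy|].
    apply is_derive_scal. apply is_derive_Reals. apply (derivable_pt_lim_pow t (S n)).
  + change (tay (S n) t) with (tay n t + (-1) ^ n / INR (fact n) * t ^ n).
    rewrite fact_simpl, mult_INR. cbn [pow]. pose proof (INR_fact_neq_0 n).
    assert (INR (S n) <> 0) by (apply not_0_INR; easy). field. easy.
Qed.

(** The derivative of each remainder is minus the previous one, so the mean value theorem gains a
    factor t per step. *)
Lemma exp_tay_le (n : nat) : forall t, 0 <= t -> Rabs (exp (- t) - tay n t) <= t ^ n.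
Proof.
induction n; intros t Ht.
- unfold tay; simpl. rewrite Rminus_0_r, Rabs_pos_eq by (left; apply exp_pos).
  rewrite <- exp_0. apply exp_le. lra.
- assert (D : forall x : R, is_derive (fun x => exp (- x) - tay (S n) x) x (- exp (- x) - - tay n x)).
  { intros x. apply (is_derive_minus (V := R_NormedModule)); [|apply is_derive_tay].
    auto_derive; [easy|ring]. }
  destruct (MVT_gen (fun x => exp (- x) - tay (S n) x) 0 t (fun x => - exp (- x) - - tay n x)) as [c [Hc E]].
  + intros x _. apply D.
  + intros x _. apply continuity_pt_filterlim. exact (continuous_of_deriv _ _ _ (D x)).
  + rewrite Rmin_left, Rmax_right in Hc by lra.
    assert (E0 : exp (- 0) - tay (S n) 0 = 0).
    { unfold tay. rewrite rsum_S_l, Ropp_0, exp_0.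
      rewrite (rsum_ext _ (fun _ => 0)) by (intros; simpl; ring).
      assert (forall m, rsum (fun _ => 0) m = 0) as -> by (induction m; simpl; lra). simpl. field. }
    rewrite E0, !Rminus_0_r in E. rewrite E, Rabs_mult, (Rabs_pos_eq t) by easy.
    simpl. rewrite Rmult_comm. apply Rmult_le_compat_l; [easy|].
    replace (- exp (- c) - - tay n c) with (- (exp (- c) - tay n c)) by ring. rewrite Rabs_Ropp.
    eapply Rle_trans; [apply IHn; lra|]. apply pow_incr. lra.
Qed.

(** Index j belongs to t^(j-1), so the Taylor coefficients of e^(-t) are shifted by one and the
    coefficient of 1/t is 0. *)
Definition gam_coef (j : nat) : R :=
  match j with O => 0 | S i => (-1) ^ i / INR (fact i) end.

Definition gam_phi (t : R) : R := exp (- t).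

Lemma exp_nat_mul (n : nat) (v : R) : exp (INR n * v) = exp v ^ n.
Proof.
induction n; [simpl; now rewrite Rmult_0_l, exp_0|].
rewrite S_INR, Rmult_plus_distr_r, exp_plus, IHn, Rmult_1_l. simpl. ring.
Qed.

Lemma gam_data (n : nat) : mellin_data gam_phi gam_coef (S n) (INR n).
Proof.
split; [|split].
- intros v. unfold gam_phi. eapply continuous_of_deriv. auto_derive; [easy|reflexivity].
- exists 1. intros v Hv. rewrite Rmult_1_l. unfold mrem, psum.
  rewrite rsum_S_l. cbn [gam_coef]. rewrite Rmult_0_l, Rplus_0_l.
  replace (exp (- INR n * v)) with (exp (- v) ^ n) by (rewrite <- exp_nat_mul; f_equal; ring).
  rewrite (rsum_ext _ (fun i => (-1) ^ i / INR (fact i) * exp (- v) ^ i)).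
  + apply exp_tay_le. left; apply exp_pos.
  + intros j _. rewrite <- exp_nat_mul. f_equal. f_equal. rewrite S_INR. ring.
- intros q. destruct (exp_exp_decay 1 q Rlt_0_1) as [M HM]. exists M. intros v Hv.
  unfold gam_phi. rewrite Rabs_pos_eq by (left; apply exp_pos).
  replace (- exp v) with (- (1) * exp v) by ring. now apply HM.
Qed.

(** * Partial fractions of cosh((1/2 - a) t) / sinh(t / 2) *)

Lemma RInt_ext_Icc (f g : R -> R) (a b : R) : a <= b ->
  (forall x, a < x < b -> f x = g x) -> RInt f a b = RInt g a b.
Proof. intros H E. apply RInt_ext. intros x. rewrite Rmin_left, Rmax_right by easy. apply E. Qed.

Lemma continuous_cosh_abs (b p tau x : R) : continuous (fun x => cosh ((Rabs (x - b) - p) * tau)) x.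
Proof.
apply (continuous_comp_R (fun y => cosh ((y - p) * tau)) (fun x => Rabs (x - b))).
- apply (continuous_comp_R Rabs (fun x => x - b)); [|apply continuous_Rabs].
  apply continuous_minus_R; [apply continuous_id|apply continuous_const].
- unfold cosh. eapply continuous_of_deriv. auto_derive; [easy|reflexivity].
Qed.

Lemma cosh_neg (x : R) : cosh (- x) = cosh x.
Proof. unfold cosh. rewrite Ropp_involutive. field. Qed.

Lemma sinh_neg (x : R) : sinh (- x) = - sinh x.
Proof. unfold sinh. rewrite Ropp_involutive. field. Qed.

(** Explicit primitives on either side of the corner b. The contributions at 0 and 2 pi cancel, and
    at b only the jump of the sinh term survives. *)
Lemma fourier_coef_cosh (b tau : R) (n : nat) : 0 < b < 2 * PI -> 0 < tau ->
  RInt (fun x => cosh ((Rabs (x - b) - PI) * tau) * cos (INR n * x)) 0 (2 * PI) =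
  cos (INR n * b) * (2 * tau * sinh (PI * tau)) / (tau ^ 2 + INR n ^ 2).
Proof.
intros Hb Ht. set (m := INR n).
assert (Hm : 0 < tau ^ 2 + m ^ 2) by (pose proof (pow2_ge_0 m); pose proof (pow_lt tau 2 Ht); lra).
rewrite (RInt_Chasles_R _ 0 b (2 * PI)).
2: { intros. apply continuous_mult_R; [apply continuous_cosh_abs|apply continuous_cos_lin]. }
rewrite (RInt_ext_Icc _ (fun x => cosh ((b - x - PI) * tau) * cos (m * x)) 0 b); [|lra|].
2: { intros x Hx. rewrite Rabs_left by lra. do 2 f_equal. ring. }
rewrite (RInt_ext_Icc _ (fun x => cosh ((x - b - PI) * tau) * cos (m * x)) b (2 * PI)); [|lra|].
2: { intros x Hx. rewrite Rabs_pos_eq by lra. easy. }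
assert (C : forall f : R -> R, (forall x, ex_derive f x) -> forall x, continuous (fun x => f x * cos (m * x)) x).
{ intros f Hf x. apply continuous_mult_R; [apply (ex_derive_continuous (V := R_NormedModule)), Hf|apply continuous_cos_lin]. }
rewrite (RInt_of_primitive (fun x => (- tau * sinh ((b - x - PI) * tau) * cos (m * x) +
  m * cosh ((b - x - PI) * tau) * sin (m * x)) / (tau ^ 2 + m ^ 2))).
2: { intros x. unfold sinh, cosh. auto_derive; [easy|]. unfold Rminus. field. simpl in Hm. lra. }
2: { apply C. intros x. unfold cosh. auto_derive. easy. }
rewrite (RInt_of_primitive (fun x => (tau * sinh ((x - b - PI) * tau) * cos (m * x) +
  m * cosh ((x - b - PI) * tau) * sin (m * x)) / (tau ^ 2 + m ^ 2))).
2: { intros x. unfold sinh, cosh. auto_derive; [easy|]. unfold Rminus. field. simpl in Hm. lra. }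
2: { apply C. intros x. unfold cosh. auto_derive. easy. }

replace ((b - b - PI) * tau) with (- (PI * tau)) by ring.
replace ((b - 0 - PI) * tau) with (- ((2 * PI - b - PI) * tau)) by ring.
rewrite !sinh_neg, !cosh_neg. unfold m. rewrite cos_nat_2PI, sin_nat_2PI, Rmult_0_r, cos_0, sin_0.
fold m. to_R. field. lra.
Qed.

Lemma sum_n_RInt_dirk (g : R -> R) (N : nat) : (forall x, continuous g x) ->
  RInt (fun x => g x * dirk (S N) x) 0 (2 * PI) =
  RInt g 0 (2 * PI) + sum_n (fun n => 2 * RInt (fun x => g x * cos (INR (S n) * x)) 0 (2 * PI)) N.
Proof.
intros HC.
assert (St : forall N, RInt (fun x => g x * dirk (S N) x) 0 (2 * PI) =
  RInt (fun x => g x * dirk N x) 0 (2 * PI) + 2 * RInt (fun x => g x * cos (INR (S N) * x)) 0 (2 * PI)).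
{ intros n. cbn [dirk].
  rewrite (RInt_ext _ (fun v => g v * dirk n v + 2 * (g v * cos (INR (S n) * v)))).
  2: { intros x _. to_R. ring. }
  rewrite RInt_plus_R, RInt_scal_R; [easy| | |].
  + intros; apply continuous_mult_R; [easy|apply continuous_cos_lin].
  + intros; apply continuous_mult_R; [easy|apply continuous_dirk].
  + intros. apply continuous_mult_R; [apply continuous_const|].
    apply continuous_mult_R; [easy|apply continuous_cos_lin]. }
induction N.
- rewrite sum_O, St. f_equal. apply RInt_ext. intros x _. simpl. to_R. ring.
- rewrite sum_Sn, St, IHN. change plus with Rplus. simpl. to_R. ring.
Qed.

(** Fourier series of x -> cosh((|x - b| - pi) tau) on [0, 2 pi], read at x = 0. The values at 0 and
    2 pi agree, and placing b inside turns the end point into a free parameter. *)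
Lemma is_series_cosh (b tau : R) : 0 < b < 2 * PI -> 0 < tau ->
  is_series (fun n => 2 * (cos (INR (S n) * b) * (2 * tau * sinh (PI * tau)) / (tau ^ 2 + INR (S n) ^ 2)))
    (2 * PI * cosh ((b - PI) * tau) - 2 * sinh (PI * tau) / tau).
Proof.
intros Hb Ht. pose proof PI_RGT_0.
set (g := fun x => cosh ((Rabs (x - b) - PI) * tau)).
assert (HC : forall x, continuous g x) by (intros; apply continuous_cosh_abs).
assert (D0 : exists a, is_derive g 0 a).
{ eexists. apply (is_derive_ext_loc (fun x => cosh ((b - x - PI) * tau))).
  - exists (mkposreal b (proj1 Hb)). intros y Hy. change (Rabs (y - 0) < b) in Hy. apply Rabs_def2 in Hy.
    unfold g. rewrite Rabs_left by lra. do 2 f_equal. ring.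
  - unfold cosh. auto_derive; [easy|reflexivity]. }
assert (D1 : exists a, is_derive g (2 * PI) a).
{ eexists. apply (is_derive_ext_loc (fun x => cosh ((x - b - PI) * tau))).
  - assert (He : 0 < 2 * PI - b) by lra. exists (mkposreal _ He). intros y Hy.
    change (Rabs (y - 2 * PI) < 2 * PI - b) in Hy. apply Rabs_def2 in Hy.
    unfold g. rewrite Rabs_pos_eq by lra. easy.
  - unfold cosh. auto_derive; [easy|reflexivity]. }
destruct D0 as [d0 D0], D1 as [d1 D1].
assert (Hp : g (2 * PI) = g 0).
{ unfold g. rewrite Rabs_pos_eq, Rabs_left by lra.
  replace ((2 * PI - b - PI) * tau) with (- ((- (0 - b) - PI) * tau)) by ring. apply cosh_neg. }
pose proof (dirichlet_fourier g d0 d1 HC D0 D1 Hp) as L.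
apply is_lim_seq_incr_1 in L.
assert (E0 : RInt g 0 (2 * PI) = 2 * sinh (PI * tau) / tau).
{ pose proof (fourier_coef_cosh b tau 0 Hb Ht) as E. simpl (INR 0) in E.
  rewrite Rmult_0_l, cos_0 in E. transitivity (1 * (2 * tau * sinh (PI * tau)) / (tau ^ 2 + 0 ^ 2)).
  - rewrite <- E. apply RInt_ext. intros x _. rewrite Rmult_0_l, cos_0. unfold g. to_R. ring.
  - to_R. field. lra. }
change (is_lim_seq (sum_n (fun n => 2 * (cos (INR (S n) * b) * (2 * tau * sinh (PI * tau)) / (tau ^ 2 + INR (S n) ^ 2))))
  (2 * PI * cosh ((b - PI) * tau) - 2 * sinh (PI * tau) / tau)).
replace (cosh ((b - PI) * tau)) with (g 0).
2: { unfold g. rewrite Rabs_left by lra. do 2 f_equal. ring. }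
apply (is_lim_seq_ext (fun N => RInt (fun x => g x * dirk (S N) x) 0 (2 * PI) - 2 * sinh (PI * tau) / tau)).
- intros N. rewrite sum_n_RInt_dirk, E0 by easy.
  rewrite (sum_n_ext _ (fun n => 2 * (cos (INR (S n) * b) * (2 * tau * sinh (PI * tau)) / (tau ^ 2 + INR (S n) ^ 2)))).
  + to_R. ring.
  + intros n. f_equal. now apply fourier_coef_cosh.
- apply is_lim_seq_minus'; [easy|apply is_lim_seq_const].
Qed.

Definition wn (n : nat) : R := 2 * PI * INR (S n).
Definition cn (a : R) (n : nat) : R := cos (wn n * a).
Definition hfun (a t : R) : R := (exp (- a * t) + exp (- (1 - a) * t)) / (1 - exp (- t)).
(** Up to sign and a power of t, the remainder of the Lorentzian sum [Sk a 0] after k terms of its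
    expansion in t^2, whose coefficients are the [sig]. *)
Definition Sk (a : R) (k : nat) (t : R) : R := Series (fun n => cn a n / (wn n ^ (2 * k) * (t ^ 2 + wn n ^ 2))).
Definition sig (a : R) (k : nat) : R := Series (fun n => cn a n / wn n ^ (2 * k)).

Lemma wn_gt (n : nat) : INR (S n) < wn n.
Proof.
unfold wn. pose proof PI2_3_2. assert (0 < INR (S n)) by (apply lt_0_INR; lia).
assert (3 < PI) by lra. nra.
Qed.

Lemma wn_ge_1 (n : nat) : 1 < wn n.
Proof. pose proof (wn_gt n). rewrite S_INR in H. pose proof (pos_INR n). lra. Qed.

Lemma cn_bound (a : R) (n : nat) : Rabs (cn a n) <= 1.
Proof. apply Rabs_le, COS_bound. Qed.

(** Comparison with the telescoping series of 2 / (n (n + 1)). *)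
Lemma ex_series_inv_sq : ex_series (fun n => / INR (S n) ^ 2).
Proof.
apply (ex_series_le (K := R_AbsRing) (V := R_CompleteNormedModule) _
  (fun n => 2 * (/ INR (S n) - / INR (S (S n))))).
- intros n. change (Rabs (/ INR (S n) ^ 2) <= 2 * (/ INR (S n) - / INR (S (S n)))).
  assert (0 < INR (S n)) by (apply lt_0_INR; lia).
  rewrite Rabs_pos_eq by (left; apply Rinv_0_lt_compat, pow_lt; easy).
  rewrite (S_INR (S n)). assert (1 <= INR (S n)) by (rewrite S_INR; pose proof (pos_INR n); lra).
  set (x := INR (S n)) in *. clearbody x.
  apply Rmult_le_reg_r with (x ^ 2 * (x + 1)); [apply Rmult_lt_0_compat; [apply pow_lt|]; lra|].
  replace (/ x ^ 2 * (x ^ 2 * (x + 1))) with (x + 1) by (field; lra).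
  replace (2 * (/ x - / (x + 1)) * (x ^ 2 * (x + 1))) with (2 * x) by (field; lra). lra.
- exists (2 * 1). apply (is_series_scal (K := R_AbsRing) (V := R_NormedModule) 2 (fun n => / INR (S n) - / INR (S (S n))) 1).
  change (is_lim_seq (sum_n (fun n => / INR (S n) - / INR (S (S n)))) 1).
  apply (is_lim_seq_ext (fun n => 1 - / INR (S (S n)))).
  + intros n. induction n; [rewrite sum_O; simpl; field|].
    rewrite sum_Sn, <- IHn.
    match goal with |- _ = plus ?u ?v => change (1 - / INR (S (S (S n))) = u + v) end. lra.
  + replace 1 with (1 - 0) at 1 by ring. apply is_lim_seq_minus'; [apply is_lim_seq_const|].
    apply (is_lim_seq_inv _ p_infty); [|easy].
    apply (is_lim_seq_ext (fun n => INR (n + 2))); [intros n; f_equal; lia|].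
    apply (is_lim_seq_incr_n INR 2 p_infty), is_lim_seq_INR.
Qed.

Lemma inv_wn_sq_le (n : nat) : / wn n ^ 2 <= / INR (S n) ^ 2.
Proof.
apply Rinv_le_contravar; [apply pow_lt, lt_0_INR; lia|].
apply pow_incr. split; [apply pos_INR|left; apply wn_gt].
Qed.

Lemma Sk_term_le (a t : R) (k n : nat) :
  Rabs (cn a n / (wn n ^ (2 * k) * (t ^ 2 + wn n ^ 2))) <= / INR (S n) ^ 2.
Proof.
pose proof (wn_ge_1 n). pose proof (pow2_ge_0 t).
assert (1 <= wn n ^ (2 * k)) by (apply pow_R1_Rle; lra).
assert (0 < wn n ^ 2) by (apply pow_lt; lra).
unfold Rdiv. rewrite Rabs_mult, Rabs_inv.
rewrite (Rabs_pos_eq (_ * _)) by (apply Rmult_le_pos; lra).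
eapply Rle_trans; [|apply inv_wn_sq_le].
rewrite <- (Rmult_1_l (/ wn n ^ 2)).
apply Rmult_le_compat; [apply Rabs_pos| |apply cn_bound|].
- left. apply Rinv_0_lt_compat. apply Rmult_lt_0_compat; lra.
- apply Rinv_le_contravar; [easy|]. nra.
Qed.

Lemma ex_series_Sk (a t : R) (k : nat) : ex_series (fun n => cn a n / (wn n ^ (2 * k) * (t ^ 2 + wn n ^ 2))).
Proof.
apply (ex_series_le (K := R_AbsRing) (V := R_CompleteNormedModule) _ (fun n => / INR (S n) ^ 2)).
- intros n. apply Sk_term_le.
- apply ex_series_inv_sq.
Qed.

Lemma ex_series_sig (a : R) (k : nat) : (1 <= k)%nat -> ex_series (fun n => cn a n / wn n ^ (2 * k)).
Proof.
intros Hk. destruct k as [|k]; [lia|].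
apply (ex_series_ext (fun n => cn a n / (wn n ^ (2 * k) * (0 ^ 2 + wn n ^ 2)))); [|apply ex_series_Sk].
intros n. pose proof (wn_ge_1 n).
replace (wn n ^ (2 * S k)) with (wn n ^ (2 * k) * wn n ^ 2) by (rewrite <- pow_add; f_equal; lia).
f_equal. ring.
Qed.

Lemma Sk_bound (a t : R) (k : nat) : Rabs (Sk a k t) <= Series (fun n => / INR (S n) ^ 2).
Proof.
assert (E : ex_series (fun n => Rabs (cn a n / (wn n ^ (2 * k) * (t ^ 2 + wn n ^ 2))))).
{ apply (ex_series_le (K := R_AbsRing) (V := R_CompleteNormedModule) _ (fun n => / INR (S n) ^ 2)).
  - intros n. match goal with |- norm ?x <= _ => change (Rabs x <= / INR (S n) ^ 2) end.
    rewrite Rabs_Rabsolu. apply Sk_term_le.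
  - apply ex_series_inv_sq. }
eapply Rle_trans; [apply Series_Rabs, E|].
apply Series_le; [|apply ex_series_inv_sq].
intros n. split; [apply Rabs_pos|apply Sk_term_le].
Qed.

(** Termwise 1 / (t^2 + w^2) = 1 / w^2 - t^2 / (w^2 (t^2 + w^2)). *)
Lemma Sk_rec (a t : R) (k : nat) : Sk a k t = sig a (S k) - t ^ 2 * Sk a (S k) t.
Proof.
unfold Sk, sig. rewrite <- Series_scal_l.
rewrite <- Series_minus; [|apply ex_series_sig; lia|].
2: { apply (ex_series_scal (K := R_AbsRing) (V := R_NormedModule) (t ^ 2)), ex_series_Sk. }
apply Series_ext. intros n. pose proof (wn_ge_1 n). pose proof (pow2_ge_0 t).
replace (wn n ^ (2 * S k)) with (wn n ^ (2 * k) * wn n ^ 2) by (rewrite <- pow_add; f_equal; lia).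
assert (0 < wn n ^ 2) by (apply pow_lt; lra).
field. repeat split; try lra. apply pow_nonzero; lra.
Qed.

Lemma hfun_partial_fractions (a t : R) : 0 < a < 1 -> 0 < t ->
  hfun a t = 2 / t + 4 * t * Sk a 0 t.
Proof.
intros Ha Ht. pose proof PI_RGT_0.
(* Then (b - pi) tau = (1/2 - a) t and pi tau = t / 2, while cos(n b) = cos(2 pi n a). *)
set (b := 2 * PI * (1 - a)). set (tau := t / (2 * PI)).
assert (Hb : 0 < b < 2 * PI) by (unfold b; nra).
assert (Htau : 0 < tau) by (apply Rdiv_lt_0_compat; lra).
pose proof (is_series_unique _ _ (is_series_cosh b tau Hb Htau)) as E.
replace ((b - PI) * tau) with ((1 / 2 - a) * t) in E by (unfold b, tau; field; lra).
replace (PI * tau) with (t / 2) in E by (unfold tau; field; lra).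
assert (Hsh : 0 < sinh (t / 2)).
{ unfold sinh. pose proof (exp_increasing (- (t / 2)) (t / 2) ltac:(lra)). lra. }
rewrite (Series_ext _ (fun n => (8 * PI * t * sinh (t / 2)) * (cn a n / (wn n ^ (2 * 0) * (t ^ 2 + wn n ^ 2))))) in E.
2: { intros n. replace (cos (INR (S n) * b)) with (cn a n).
  - pose proof (pow2_ge_0 (INR (S n))). pose proof (pow_lt t 2 Ht). unfold tau, wn. simpl (_ ^ (2 * 0)).
    assert (0 < PI ^ 2) by (apply pow_lt; lra).
    field. repeat split; try lra; nra.
  - unfold cn, wn, b.
    replace (INR (S n) * (2 * PI * (1 - a))) with (INR (S n) * (2 * PI) - 2 * PI * INR (S n) * a) by ring.
    rewrite cos_minus, cos_nat_2PI, sin_nat_2PI. ring. }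
rewrite Series_scal_l in E. fold (Sk a 0 t) in E.
assert (E2 : cosh ((1 / 2 - a) * t) = sinh (t / 2) * (2 / t + 4 * t * Sk a 0 t)).
{ apply (Rmult_eq_reg_l (2 * PI)); [|lra].
  replace (2 * sinh (t / 2) / tau) with (2 * PI * (2 * sinh (t / 2) / t)) in E by (unfold tau; field; lra).
  assert (E3 : 2 * PI * cosh ((1 / 2 - a) * t) = 8 * PI * t * sinh (t / 2) * Sk a 0 t + 2 * PI * (2 * sinh (t / 2) / t)) by lra.
  rewrite E3. field. lra. }
assert (Hden : 1 - exp (- t) <> 0).
{ assert (exp (- t) < exp 0) by (apply exp_increasing; lra). rewrite exp_0 in H0. lra. }
apply (Rmult_eq_reg_r (1 - exp (- t))); [|easy].
unfold hfun. unfold Rdiv at 1. rewrite Rmult_assoc, Rinv_l, Rmult_1_r by easy.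
transitivity (2 * exp (- (t / 2)) * cosh ((1 / 2 - a) * t)).
- unfold cosh. transitivity (exp (- (t / 2)) * exp ((1 / 2 - a) * t) + exp (- (t / 2)) * exp (- ((1 / 2 - a) * t))); [|field].
  rewrite <- !exp_plus. f_equal; f_equal; field.
- rewrite E2. unfold sinh.
  transitivity ((exp (- (t / 2)) * exp (t / 2) - exp (- (t / 2)) * exp (- (t / 2))) * (2 / t + 4 * t * Sk a 0 t)); [field; lra|].
  rewrite <- !exp_plus. replace (- (t / 2) + t / 2) with 0 by ring. rewrite exp_0.
  replace (- (t / 2) + - (t / 2)) with (- t) by field. ring.
Qed.

(** Coefficient of t^(j-1) in h, so that odd j, the even powers, give 0. For even j this is 2 B_j(a)
    / j! with B_j the Bernoulli polynomial, kept here as a cosine series. *)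
Definition hcoef (a : R) (j : nat) : R :=
  match j with
  | O => 2
  | _ => if Nat.even j then - 4 * (-1) ^ (Nat.div2 j) * sig a (Nat.div2 j) else 0
  end.

Lemma hcoef_odd (a : R) (k : nat) : hcoef a (2 * k + 1) = 0.
Proof.
unfold hcoef. replace (2 * k + 1)%nat with (S (2 * k)) by lia.
rewrite Nat.even_succ, <- Nat.negb_even. replace (Nat.even (2 * k)) with true; [easy|].
symmetry. apply Nat.even_spec. now exists k.
Qed.

Lemma hcoef_even (a : R) (k : nat) : hcoef a (2 * S k) = - 4 * (-1) ^ S k * sig a (S k).
Proof.
unfold hcoef. replace (Nat.even (2 * S k)) with true.
- rewrite Nat.div2_double. replace (2 * S k)%nat with (S (S (2 * k))) by lia. easy.
- symmetry. apply Nat.even_spec. now exists (S k).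
Qed.

(** An exact identity for every t > 0, not only an expansion near 0; it is applied on t < 1 for the
    remainder and on t > 1 in [mel_hfun_at_neg_even]. *)
Lemma hfun_expansion (a t : R) (k : nat) : 0 < a < 1 -> 0 < t ->
  hfun a t = rsum (fun j => hcoef a j * (t ^ j / t)) (2 * k + 2) + 4 * (-1) ^ k * t ^ (2 * k + 1) * Sk a k t.
Proof.
intros Ha Ht. induction k.
- rewrite hfun_partial_fractions by easy. simpl. field. lra.
- rewrite IHk. replace (2 * S k + 2)%nat with (S (S (2 * k + 2))) by lia. cbn [rsum].
  replace (S (2 * k + 2)) with (2 * (S k) + 1)%nat by lia. rewrite hcoef_odd.
  replace (2 * k + 2)%nat with (2 * S k)%nat by lia. rewrite hcoef_even.
  rewrite (Sk_rec a t k).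
  replace (t ^ (2 * S k + 1)) with (t ^ (2 * k + 1) * t ^ 2) by (rewrite <- pow_add; f_equal; lia).
  replace (t ^ (2 * S k)) with (t ^ (2 * k + 1) * t) by (rewrite <- (pow_1 t) at 2; rewrite <- pow_add; f_equal; lia).
  simpl ((-1) ^ S k). field. lra.
Qed.

Lemma mrem_hfun (a : R) (k : nat) (v : R) : 0 < a < 1 ->
  mrem (hfun a) (hcoef a) (2 * k + 2) v = 4 * (-1) ^ k * exp (- v) ^ (2 * k + 1) * Sk a k (exp (- v)).
Proof.
intros Ha. unfold mrem, psum. pose proof (exp_pos (- v)). rewrite (hfun_expansion a (exp (- v)) k) by easy.
rewrite (rsum_ext (fun j => hcoef a j * exp (- (INR j - 1) * v)) (fun j => hcoef a j * (exp (- v) ^ j / exp (- v)))).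
- ring.
- intros j _. f_equal. rewrite <- exp_nat_mul. unfold Rdiv. rewrite <- exp_Ropp, <- exp_plus. f_equal. ring.
Qed.

Lemma hfun_den (v : R) : 0 < 1 - exp (- exp v).
Proof.
pose proof (exp_pos v). assert (exp (- exp v) < exp 0) by (apply exp_increasing; lra). rewrite exp_0 in H0. lra.
Qed.

Lemma hfun_data (a : R) (k : nat) : 0 < a < 1 ->
  mellin_data (hfun a) (hcoef a) (2 * k + 2) (INR (2 * k + 1)).
Proof.
intros Ha. split; [|split].
- intros v. unfold hfun. pose proof (hfun_den v). eapply continuous_of_deriv. auto_derive; [lra|reflexivity].
- exists (4 * Series (fun n => / INR (S n) ^ 2)). intros v Hv. rewrite mrem_hfun by easy.
  replace (exp (- INR (2 * k + 1) * v)) with (exp (- v) ^ (2 * k + 1)) by (rewrite <- exp_nat_mul; f_equal; ring).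
  assert (0 < exp (- v) ^ (2 * k + 1)) by (apply pow_lt, exp_pos).
  rewrite !Rabs_mult, (Rabs_pos_eq 4), pow_1_abs, (Rabs_pos_eq (exp _ ^ _)) by lra.
  pose proof (Sk_bound a (exp (- v)) k). nra.
(* For t >= 1 both exponentials are at most e^(-d t) and the denominator is at least 1 - 1/e. *)
- intros q. set (d := Rmin a (1 - a)).
  assert (Hd : 0 < d) by (apply Rmin_pos; lra).
  destruct (exp_exp_decay d q Hd) as [M HM].
  set (c := 1 - exp (- 1)).
  assert (Hc : 0 < c). { unfold c. assert (exp (-1) < exp 0) by (apply exp_increasing; lra). rewrite exp_0 in H. lra. }
  exists (2 / c * M). intros v Hv. specialize (HM v Hv).
  unfold hfun. pose proof (exp_pos v). pose proof (hfun_den v).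
  assert (1 <= exp v) by (rewrite <- exp_0; now apply exp_le).
  rewrite Rabs_pos_eq.
  2: { apply Rmult_le_pos; [|left; now apply Rinv_0_lt_compat].
       pose proof (exp_pos (- a * exp v)). pose proof (exp_pos (- (1 - a) * exp v)). lra. }
  assert (X1 : exp (- a * exp v) <= exp (- d * exp v)).
  { apply exp_le. pose proof (Rmin_l a (1 - a)). fold d in H2. nra. }
  assert (X2 : exp (- (1 - a) * exp v) <= exp (- d * exp v)).
  { apply exp_le. pose proof (Rmin_r a (1 - a)). fold d in H2. nra. }
  assert (X3 : c <= 1 - exp (- exp v)).
  { unfold c. assert (exp (- exp v) <= exp (-1)) by (apply exp_le; lra). lra. }
  apply Rle_trans with ((2 * (M * exp (- q * v))) * / c).
  + apply Rmult_le_compat; [|left; now apply Rinv_0_lt_compat|lra|].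
    * pose proof (exp_pos (- a * exp v)). pose proof (exp_pos (- (1 - a) * exp v)). lra.
    * now apply Rinv_le_contravar.
  + right. field. lra.
Qed.

(** * Hurwitz zeta function as a Mellin transform *)

Lemma exp_le_1 (x : R) : x <= 0 -> exp x <= 1.
Proof. intros H. rewrite <- exp_0. now apply exp_le. Qed.

Lemma cdom_mker_pos (phi : R -> R) (s : C) (M q : R) :
  (forall v, continuous (fun v => phi (exp v)) v) ->
  (forall v, 0 <= v -> Rabs (phi (exp v)) <= M * exp (- q * v)) -> Re s < q ->
  cdom (mker s phi) M (q - Re s).
Proof.
intros HC Hb Hs.
apply (cdom_ext (fun v => cexp (- (- s * RtoC v)) * RtoC (phi (exp v)))%C).
- intros v. unfold mker. f_equal. f_equal. ring.
- replace (q - Re s) with (Re (- s)%C + q) by (unfold Re; simpl; ring).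
  apply (cdom_lap (fun v => phi (exp v))); [easy|easy|]. unfold Re in *; simpl; lra.
Qed.

Lemma cdom_mker_neg (phi : R -> R) (s : C) (M p : R) :
  (forall v, continuous (fun v => phi (exp v)) v) ->
  (forall v, 0 <= v -> Rabs (phi (exp (- v))) <= M * exp (p * v)) -> p < Re s ->
  cdom (fun v => mker s phi (- v)) M (Re s - p).
Proof.
intros HC Hb Hs.
apply (cdom_ext (fun v => cexp (- (s * RtoC v)) * RtoC (phi (exp (- v))))%C).
- intros v. unfold mker. f_equal. f_equal. rewrite RtoC_opp. ring.
- apply (cdom_lap (fun v => phi (exp (- v))) s M (- p)); [| |lra].
  + intros v. apply (continuous_comp_R (fun v => phi (exp v)) Ropp); [|apply HC].
    eapply continuous_of_deriv. auto_derive; [easy|reflexivity].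
  + intros v Hv. rewrite Ropp_involutive. now apply Hb.
Qed.

Lemma cpow_neg_cexp (b : R) (s : C) : cpow_neg b s = cexp (- (s * RtoC (ln b)))%C.
Proof. unfold cpow_neg, cexp, Re, Im; simpl. f_equal; f_equal; f_equal; ring. Qed.

(** The substitution t -> c t in the Gamma integral, carried out as the translation v -> v + ln
    c. *)
Lemma wint_exp_scaled (s : C) (c : R) : 0 < c -> 0 < Re s -> wdom (mker s gam_phi) ->
  wdom (mker s (fun t => exp (- c * t))) /\
  wint (mker s (fun t => exp (- c * t))) = (cpow_neg c s * wint (mker s gam_phi))%C.
Proof.
intros Hc Hs HW.
assert (Cc : forall v, continuous (fun v => exp (- c * exp v)) v).
{ intros v. eapply continuous_of_deriv. auto_derive; [easy|reflexivity]. }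
assert (W : wdom (mker s (fun t => exp (- c * t)))).
{ split.
  - destruct (exp_exp_decay c (Re s + 1) Hc) as [M HM]. exists M. eexists.
    apply (cdom_mker_pos _ s M (Re s + 1)); [easy| |lra].
    intros v Hv. rewrite Rabs_pos_eq by (left; apply exp_pos). now apply HM.
  - exists 1. eexists. apply (cdom_mker_neg _ s 1 0); [easy| |lra].
    intros v Hv. rewrite Rabs_pos_eq by (left; apply exp_pos). rewrite Rmult_0_l, exp_0, Rmult_1_l.
    rewrite <- exp_0. apply exp_le. pose proof (exp_pos (- v)). nra. }
assert (E : forall v, mker s gam_phi (v + ln c) = (cexp (s * RtoC (ln c)) * mker s (fun t => exp (- c * t)) v)%C).
{ intros v. unfold mker, gam_phi. rewrite RtoC_plus.
  replace (s * (RtoC v + RtoC (ln c)))%C with (s * RtoC (ln c) + s * RtoC v)%C by ring.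
  rewrite cexp_plus, exp_plus, exp_ln by easy. rewrite <- Cmult_assoc. f_equal. f_equal. f_equal. f_equal. ring. }
split; [easy|].
assert (W2 : wdom (fun v => mker s gam_phi (v + ln c))).
{ eapply wdom_ext; [intros; symmetry; apply E|]. now apply wdom_scal. }
rewrite <- (wint_shift (mker s gam_phi) (ln c)) by easy.
rewrite (wint_ext _ _ E), wint_scal, cpow_neg_cexp by easy.
rewrite Cmult_assoc, <- cexp_plus.
replace (- (s * RtoC (ln c)) + s * RtoC (ln c))%C with (RtoC 0) by ring. rewrite cexp_0. ring.
Qed.

(** The exact tail n >= N of the geometric expansion of h, so that exchanging sum and integral
    reduces to one estimate. *)
Definition hrem (a : R) (N : nat) (t : R) : R := exp (- INR N * t) * hfun a t.

Lemma hrem_S (a : R) (N : nat) (t : R) : 0 < t ->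
  hrem a N t = exp (- (INR N + a) * t) + exp (- (INR N + (1 - a)) * t) + hrem a (S N) t.
Proof.
intros Ht. unfold hrem, hfun.
assert (exp (- t) < 1) by (rewrite <- exp_0; apply exp_increasing; lra).
replace (- (INR N + a) * t) with (- INR N * t + - a * t) by ring.
replace (- (INR N + (1 - a)) * t) with (- INR N * t + - (1 - a) * t) by ring.
rewrite S_INR. replace (- (INR N + 1) * t) with (- INR N * t + - t) by ring.
rewrite !exp_plus. field. lra.
Qed.

Lemma hfun_nonneg (a t : R) : 0 < t -> 0 <= hfun a t.
Proof.
intros Ht. unfold hfun. assert (exp (- t) < 1) by (rewrite <- exp_0; apply exp_increasing; lra).
pose proof (exp_pos (- a * t)). pose proof (exp_pos (- (1 - a) * t)).
apply Rmult_le_pos; [lra|]. left. apply Rinv_0_lt_compat. lra.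
Qed.

Lemma hfun_neg_bound (a v : R) : 0 < a < 1 -> 0 <= v -> Rabs (hfun a (exp (- v))) <= 2 * exp 1 * exp (1 * v).
Proof.
intros Ha Hv. set (t := exp (- v)).
assert (Ht : 0 < t) by apply exp_pos.
assert (Ht1 : t <= 1) by (unfold t; rewrite <- exp_0; apply exp_le; lra).
rewrite Rabs_pos_eq by now apply hfun_nonneg.
(* From e^t >= 1 + t one gets 1 - e^(-t) >= t e^(-t), and t <= 1; thus h is O(1/t) at 0. *)
assert (D : t * exp (- 1) <= 1 - exp (- t)).
{ pose proof (exp_ineq1_le t). apply Rle_trans with (t * exp (- t)).
  - apply Rmult_le_compat_l; [lra|]. apply exp_le. lra.
  - assert (exp t * exp (- t) = 1) by (rewrite <- exp_plus, Rplus_opp_r; apply exp_0).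
    apply (Rmult_le_compat_r (exp (- t))) in H; [lra|left; apply exp_pos]. }
assert (Hp : 0 < t * exp (- 1)) by (apply Rmult_lt_0_compat; [easy|apply exp_pos]).
assert (A1 : exp (- a * t) <= 1) by (apply exp_le_1; nra).
assert (A2 : exp (- (1 - a) * t) <= 1) by (apply exp_le_1; nra).
pose proof (exp_pos (- a * t)). pose proof (exp_pos (- (1 - a) * t)).
unfold hfun. apply Rle_trans with (2 * / (t * exp (- 1))).
- apply Rmult_le_compat; [lra|left; apply Rinv_0_lt_compat; lra|lra|].
  now apply Rinv_le_contravar.
- right. assert (exp 1 * exp (- 1) = 1) by (rewrite <- exp_plus, Rplus_opp_r; apply exp_0).
  assert (exp (1 * v) * t = 1) by (unfold t; rewrite <- exp_plus, Rmult_1_l, Rplus_opp_r; apply exp_0).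
  apply (Rmult_eq_reg_r (t * exp (- 1))); [|lra].
  rewrite Rmult_assoc, Rinv_l by lra.
  replace (2 * exp 1 * exp (1 * v) * (t * exp (- 1))) with (2 * (exp 1 * exp (- 1)) * (exp (1 * v) * t)) by ring.
  rewrite H1, H2. ring.
Qed.

Lemma continuous_hfun_exp (a v : R) : continuous (fun v => hfun a (exp v)) v.
Proof.
unfold hfun. pose proof (hfun_den v). eapply continuous_of_deriv. auto_derive; [lra|reflexivity].
Qed.

(** The bound e^(-n t) <= 1 / (n t) gains 1/n at the price of one power of t. Near 0 the integrand
    is then t^(s-1) O(t^(-2)), hence the condition Re s > 2. *)
Lemma hrem_le (a t : R) (N : nat) : 0 < t -> Rabs (hrem a (S N) t) <= / INR (S N) * (/ t * hfun a t).
Proof.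
intros Ht. pose proof (hfun_nonneg a t Ht). unfold hrem.
assert (0 < INR (S N)) by (apply lt_0_INR; lia). set (n := INR (S N)) in *. clearbody n.
rewrite Rabs_pos_eq by (apply Rmult_le_pos; [left; apply exp_pos|easy]).
rewrite <- Rmult_assoc. apply Rmult_le_compat_r; [easy|].
rewrite <- Rinv_mult. replace (- n * t) with (- (n * t)) by ring. rewrite exp_Ropp.
assert (0 < n * t) by (apply Rmult_lt_0_compat; easy).
apply Rinv_le_contravar; [easy|]. pose proof (exp_ineq1_le (n * t)). lra.
Qed.

Lemma wint_hrem_small (a : R) (s : C) : 0 < a < 1 -> 2 < Re s ->
  exists M, forall N, wdom (mker s (hrem a (S N))) /\ Cmod (wint (mker s (hrem a (S N)))) <= M * / INR (S N).
Proof.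
intros Ha Hs.
destruct (proj2 (proj2 (hfun_data a 0 Ha)) (Re s + 1)) as [M1 HM1].
assert (HM0 : 0 <= M1).
{ specialize (HM1 0 (Rle_refl 0)). rewrite Rmult_0_r, exp_0, Rmult_1_r in HM1.
  pose proof (Rabs_pos (hfun a 1)). lra. }
exists (2 * (2 * exp 1) / (Re s - 2) + 2 * M1). intros N.
assert (Hn : 0 < / INR (S N)) by (apply Rinv_0_lt_compat, lt_0_INR; lia).
assert (HC : forall v, continuous (fun v => hrem a (S N) (exp v)) v).
{ intros v. apply continuous_mult_R; [|apply continuous_hfun_exp].
  set (n := INR (S N)); clearbody n. eapply continuous_of_deriv. auto_derive; [easy|reflexivity]. }
assert (D1 : cdom (mker s (hrem a (S N))) (/ INR (S N) * M1) (Re s + 1 - Re s)).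
{ apply cdom_mker_pos; [easy| |lra]. intros v Hv.
  assert (1 <= exp v) by (rewrite <- exp_0; now apply exp_le).
  eapply Rle_trans; [apply hrem_le, exp_pos|]. rewrite Rmult_assoc. apply Rmult_le_compat_l; [lra|].
  pose proof (hfun_nonneg a (exp v) (exp_pos v)). specialize (HM1 v Hv). rewrite Rabs_pos_eq in HM1 by easy.
  assert (/ exp v <= 1) by (rewrite <- Rinv_1; apply Rinv_le_contravar; lra). nra. }
assert (D2 : cdom (fun v => mker s (hrem a (S N)) (- v)) (/ INR (S N) * (2 * exp 1)) (Re s - 2)).
{ apply cdom_mker_neg; [easy| |lra]. intros v Hv.
  eapply Rle_trans; [apply hrem_le, exp_pos|]. rewrite Rmult_assoc. apply Rmult_le_compat_l; [lra|].
  pose proof (hfun_neg_bound a v Ha Hv) as B. rewrite Rabs_pos_eq in B by apply hfun_nonneg, exp_pos.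
  rewrite <- exp_Ropp, Ropp_involutive. replace (2 * v) with (v + 1 * v) by ring. rewrite exp_plus.
  pose proof (exp_pos v).
  replace (2 * exp 1 * (exp v * exp (1 * v))) with (exp v * (2 * exp 1 * exp (1 * v))) by ring.
  apply Rmult_le_compat_l; lra. }
split.
- split; eexists _, _; eassumption.
- unfold wint. eapply Rle_trans; [apply Cmod_triangle|].
  pose proof (chint_bound _ _ _ D1). pose proof (chint_bound _ _ _ D2).
  replace (Re s + 1 - Re s) with 1 in H by ring.
  replace ((2 * (2 * exp 1) / (Re s - 2) + 2 * M1) * / INR (S N)) with
    (2 * (/ INR (S N) * (2 * exp 1)) / (Re s - 2) + 2 * (/ INR (S N) * M1) / 1); [lra|].
  field. split; [apply not_0_INR; easy|lra].
Qed.

Lemma wint_hfun_partial (a : R) (s : C) (N : nat) : 0 < a < 1 -> 2 < Re s ->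
  wdom (mker s gam_phi) ->
  wint (mker s (hfun a)) =
    (wint (mker s gam_phi) * (sum_n (fun k => cpow_neg (INR k + a) s) N + sum_n (fun k => cpow_neg (INR k + (1 - a)) s) N)
     + wint (mker s (hrem a (S N))))%C.
Proof.
intros Ha Hs HG.
destruct (wint_hrem_small a s Ha Hs) as [M HM].
assert (St : forall n, wint (mker s (hrem a n)) =
  (wint (mker s gam_phi) * (cpow_neg (INR n + a) s + cpow_neg (INR n + (1 - a)) s) + wint (mker s (hrem a (S n))))%C).
{ intros n. pose proof (pos_INR n).
  destruct (wint_exp_scaled s (INR n + a)) as [W1 E1]; [lra|lra|easy|].
  destruct (wint_exp_scaled s (INR n + (1 - a))) as [W2 E2]; [lra|lra|easy|].
  rewrite (wint_ext _ (fun v => (mker s (fun t => exp (- (INR n + a) * t)) v + mker s (fun t => exp (- (INR n + (1 - a)) * t)) v)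
     + mker s (hrem a (S n)) v)%C).
  2: { intros v. unfold mker. rewrite hrem_S by apply exp_pos. rewrite !RtoC_plus. ring. }
  rewrite wint_plus; [|now apply wdom_plus|apply HM].
  rewrite wint_plus by easy. rewrite E1, E2. ring. }
assert (Z : wint (mker s (hfun a)) = wint (mker s (hrem a 0))).
{ apply wint_ext. intros v. unfold mker, hrem. f_equal. f_equal. simpl.
  replace (- 0 * exp v) with 0 by ring. rewrite exp_0. ring. }
rewrite Z. induction N.
- rewrite !sum_O. apply St.
- rewrite IHN, St, !sum_Sn. change plus with Cplus. simpl. ring.
Qed.

Lemma is_series_C_eps (u : nat -> C) (l : C) : is_series u l ->
  forall eps, 0 < eps -> exists N, forall n, (N <= n)%nat -> Cmod (sum_n u n - l)%C < eps.
Proof.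
(* Balls in C are products of intervals, so passing to the modulus costs a factor sqrt 2 < 2. *)
intros H eps He. assert (He2 : 0 < eps / 2) by lra.
destruct (proj1 (filterlim_locally (F := eventually) _ _) H (mkposreal _ He2)) as [N HN].
exists N. intros n Hn. specialize (HN n Hn).
pose proof (C_NormedModule_mixin_compat2 _ _ _ HN) as B.
change (Cmod (sum_n u n - l)%C < sqrt 2 * (eps / 2)) in B.
assert (sqrt 2 < 2). { rewrite <- (sqrt_square 2) at 2 by lra. apply sqrt_lt_1; lra. }
nra.
Qed.

Lemma C_eq_of_eps (z w : C) : (forall eps, 0 < eps -> Cmod (z - w)%C <= eps) -> z = w.
Proof.
intros H. assert (E : (z - w)%C = 0).
{ apply Cmod_eq_0. apply Rle_antisym; [|apply Cmod_ge_0]. apply Rnot_lt_le. intros K.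
  specialize (H (Cmod (z - w)%C / 2) ltac:(lra)). lra. }
replace z with ((z - w) + w)%C by ring. rewrite E. ring.
Qed.

Lemma gamma_hurwitz (a : R) (s za zb : C) (k : nat) : 0 < a < 1 -> 2 < Re s ->
  is_series (fun k => cpow_neg (INR k + a) s) za ->
  is_series (fun k => cpow_neg (INR k + (1 - a)) s) zb ->
  (mel gam_phi gam_coef (2 * k + 2) s * (za + zb))%C = mel (hfun a) (hcoef a) (2 * k + 2) s.
Proof.
intros Ha Hs H1 H2. pose proof (pos_INR (2 * k + 1)).
pose proof (gam_data (2 * k + 1)) as GD. replace (S (2 * k + 1)) with (2 * k + 2)%nat in GD by lia.
destruct (mel_conv _ _ _ _ s GD ltac:(lra) ltac:(lra)) as [W1 ->].
destruct (mel_conv _ _ _ _ s (hfun_data a k Ha) ltac:(lra) ltac:(lra)) as [W2 ->].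
apply C_eq_of_eps. intros eps He.
destruct (wint_hrem_small a s Ha Hs) as [M HM].
set (G := wint (mker s gam_phi)).
pose proof (Cmod_ge_0 G) as HG.
set (e := eps / (3 * (Cmod G + 1))).
assert (He' : 0 < e) by (apply Rdiv_lt_0_compat; lra).
destruct (is_series_C_eps _ _ H1 e He') as [N1 HN1]. destruct (is_series_C_eps _ _ H2 e He') as [N2 HN2].
destruct (INR_unbounded (3 * M / eps)) as [N3 HN3].
set (N := (N1 + N2 + N3)%nat).
specialize (HN1 N ltac:(unfold N; lia)). specialize (HN2 N ltac:(unfold N; lia)).
rewrite (wint_hfun_partial a s N Ha Hs W1). fold G.
set (S1 := sum_n (fun k => cpow_neg (INR k + a) s) N : C) in *.
set (S2 := sum_n (fun k => cpow_neg (INR k + (1 - a)) s) N : C) in *. set (R0 := wint (mker s (hrem a (S N)))).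
replace (G * (za + zb) - (G * (S1 + S2) + R0))%C with (- (G * ((S1 - za) + (S2 - zb)) + R0))%C by ring.
rewrite Cmod_opp. eapply Rle_trans; [apply Cmod_triangle|]. rewrite Cmod_mult.
pose proof (Cmod_triangle (S1 - za)%C (S2 - zb)%C).
assert (B1 : Cmod G * Cmod (S1 - za + (S2 - zb))%C <= 2 * eps / 3).
{ apply Rle_trans with ((Cmod G + 1) * (2 * e)).
  - apply Rmult_le_compat; [easy|apply Cmod_ge_0|lra|]. lra.
  - right. unfold e. field. lra. }
assert (B2 : Cmod R0 <= eps / 3).
{ eapply Rle_trans; [apply HM|].
  assert (0 < INR (S N)) by (apply lt_0_INR; lia).
  apply Rmult_le_reg_r with (INR (S N)); [easy|]. rewrite Rmult_assoc, Rinv_l, Rmult_1_r by lra.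
  assert (INR N3 <= INR (S N)) by (apply le_INR; unfold N; lia).
  assert (Hlt : 3 * M / eps < INR (S N)) by lra.
  apply (Rmult_lt_compat_r (eps / 3)) in Hlt; [|lra].
  replace (3 * M / eps * (eps / 3)) with M in Hlt by (field; lra). lra. }
lra.
Qed.

(** * Derivative of the Hurwitz zeta function at -2k *)

Lemma pole_avoid_im (s : C) (j : nat) : Im s <> 0 -> (s + RtoC (INR j - 1))%C <> 0.
Proof. intros H E. apply H. apply (f_equal Im) in E. unfold Im in *; simpl in E. lra. Qed.

Lemma cderiv_mel_upper (phi : R -> R) (beta : nat -> R) (K : nat) (p : R) (s : C) :
  mellin_data phi beta K p -> - p < Re s -> Im s <> 0 -> exists d, cderiv (mel phi beta K) s d.
Proof.
intros H Hs Hi. apply (cderiv_mel_partial phi beta K K p s); [easy|easy|].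
intros j _. right. now apply pole_avoid_im.
Qed.

Lemma hurwitz_mellin_upper (a : R) (k : nat) (za zb : C -> C) (x t : R) : 0 < a < 1 ->
  is_hurwitz_zeta a za -> is_hurwitz_zeta (1 - a) zb -> 0 < t < 1 -> - INR (2 * k) <= x ->
  (mel gam_phi gam_coef (2 * k + 2) (x, t) * (za (x, t) + zb (x, t)))%C =
  mel (hfun a) (hcoef a) (2 * k + 2) (x, t).
Proof.
intros Ha [Da Sa] [Db Sb] Ht Hx.
assert (GD : mellin_data gam_phi gam_coef (2 * k + 2) (INR (2 * k + 1))).
{ pose proof (gam_data (2 * k + 1)) as GD. now replace (S (2 * k + 1)) with (2 * k + 2)%nat in GD by lia. }
pose proof (hfun_data a k Ha) as HD.
set (D := fun s => (mel gam_phi gam_coef (2 * k + 2) s * (za s + zb s) + - mel (hfun a) (hcoef a) (2 * k + 2) s)%C).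
assert (HDD : forall s, - INR (2 * k + 1) < Re s -> 0 < Im s -> exists d, cderiv D s d).
{ intros s Hs Hi.
  destruct (cderiv_mel_upper _ _ _ _ s GD Hs ltac:(lra)) as [d1 H1].
  destruct (cderiv_mel_upper _ _ _ _ s HD Hs ltac:(lra)) as [d2 H2].
  assert (Hs1 : s <> RtoC 1) by (intros ->; simpl in Hi; lra).
  destruct (Da s Hs1) as [d3 H3]. destruct (Db s Hs1) as [d4 H4].
  apply cderiv_of_is_derive in H3, H4. eexists.
  apply cderiv_plus; [apply cderiv_mult; [exact H1|apply cderiv_plus; [exact H3|exact H4]]|apply cderiv_opp, H2]. }
assert (D0 : forall s, 2 < Re s -> D s = 0).
{ intros s Hs. unfold D. rewrite (gamma_hurwitz a s _ _ k Ha Hs (Sa s ltac:(lra)) (Sb s ltac:(lra))). ring. }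
(* March to the left in steps t / 2. The disc of radius t about (y, t) stays above the real axis
   and, as t < 1, right of -2k - 1; its half lies in the disc about (y + t / 2, t) already treated.
   At the start, centres with y >= 3 give discs inside Re s > 2. *)
assert (P : forall n (y : R), - INR (2 * k) <= y -> 3 - INR n * (t / 2) <= y ->
  forall z, Cmod (z - (y, t))%C < t -> D z = 0).
{ induction n; intros y Hy Hn z Hz.
  - apply D0. simpl in Hn. pose proof (re_le_Cmod (z - (y, t))%C) as B.
    apply Rabs_le_between in B. unfold Re in *; simpl in B. lra.
  - apply (disc_identity D (y, t) t (t / 2)); [lra| | |exact Hz].
    + intros w Hw. pose proof (re_le_Cmod (w - (y, t))%C) as B1. pose proof (im_le_Cmod (w - (y, t))%C) as B2.
      apply Rabs_le_between in B1. apply Rabs_le_between in B2.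
      apply HDD; unfold Re, Im in *; simpl in B1, B2; [rewrite plus_INR; simpl (INR 1); lra|lra].
    + intros w Hw. apply (IHn (y + t / 2)); [lra|rewrite S_INR in Hn; lra|].
      replace (w - ((y + t / 2)%R, t))%C with ((w - (y, t)) + - RtoC (t / 2))%C.
      * eapply Rle_lt_trans; [apply Cmod_triangle|]. rewrite Cmod_opp, Cmod_R, Rabs_pos_eq by lra. lra.
      * destruct w. unfold Cminus, Cplus, Copp, RtoC; simpl. f_equal; ring. }
destruct (INR_unbounded ((3 - x) / (t / 2))) as [n Hn].
assert (Hn' : 3 - INR n * (t / 2) <= x).
{ apply Rgt_lt, (Rmult_lt_compat_r (t / 2)) in Hn; [|lra].
  replace ((3 - x) / (t / 2) * (t / 2)) with (3 - x) in Hn by (field; lra). lra. }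
assert (E : D (x, t) = 0).
{ apply (P n x Hx Hn'). replace ((x, t) - (x, t))%C with (RtoC 0) by ring. rewrite Cmod_0. lra. }
unfold D in E. rewrite <- (Cplus_0_r (mel (hfun a) _ _ _)), <- E. ring.
Qed.

Lemma C_zero_of_eps (z : C) (K : R) : (forall eps, 0 < eps < 1 -> Cmod z <= eps * K) -> z = 0.
Proof.
intros H. apply Cmod_eq_0. apply Rle_antisym; [|apply Cmod_ge_0]. apply Rnot_lt_le. intros Hz.
pose proof (H (/ 2) ltac:(lra)) as H1.
assert (HK : 0 < K) by lra.
specialize (H (Rmin (/ 2) (Cmod z / (2 * K)))).
assert (0 < Cmod z / (2 * K)) by (apply Rdiv_lt_0_compat; lra).
assert (Rmin (/ 2) (Cmod z / (2 * K)) * K <= Cmod z / 2).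
{ apply Rle_trans with (Cmod z / (2 * K) * K); [apply Rmult_le_compat_r; [lra|apply Rmin_r]|right; field; lra]. }
pose proof (Rmin_l (/ 2) (Cmod z / (2 * K))).
assert (0 < Rmin (/ 2) (Cmod z / (2 * K))) by (apply Rmin_pos; lra).
specialize (H ltac:(lra)). lra.
Qed.

(* [G0 s + g / (s - s0)] stands for Gamma near its pole [s0]; the pole forces [F s0 = 0]. *)
Lemma derivative_at_pole (G0 F H : C -> C) (s0 g d dG dH : C) :
  g <> 0 -> cderiv F s0 d -> cderiv G0 s0 dG -> cderiv H s0 dH ->
  (forall y, 0 < y < 1 -> ((G0 (s0 + (0, y)) * (0, y) + g) * F (s0 + (0, y)) = (0, y) * H (s0 + (0, y)))%C) ->
  (g * d)%C = H s0.
Proof.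
intros Hg HF HG HH E.
assert (Lim : forall eps, 0 < eps < 1 -> exists y, 0 < y < eps /\
  Cmod (F (s0 + (0, y)) - F s0)%C <= eps /\ Cmod (F (s0 + (0, y)) - F s0 - (0, y) * d)%C <= eps * y /\
  Cmod (G0 (s0 + (0, y)))%C <= Cmod (G0 s0) + 1 /\ Cmod (H (s0 + (0, y)) - H s0)%C <= eps).
{ intros eps He.
  destruct (cderiv_continuous _ _ _ HF eps (proj1 He)) as [e1 [P1 Q1]].
  destruct (HF eps (proj1 He)) as [e2 [P2 Q2]].
  destruct (cderiv_continuous _ _ _ HG 1 Rlt_0_1) as [e3 [P3 Q3]].
  destruct (cderiv_continuous _ _ _ HH eps (proj1 He)) as [e4 [P4 Q4]].
  set (y := Rmin eps (Rmin (Rmin e1 e2) (Rmin e3 e4)) / 2).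
  assert (Hm : 0 < Rmin eps (Rmin (Rmin e1 e2) (Rmin e3 e4))) by (repeat apply Rmin_pos; lra).
  pose proof (Rmin_l eps (Rmin (Rmin e1 e2) (Rmin e3 e4))). pose proof (Rmin_r eps (Rmin (Rmin e1 e2) (Rmin e3 e4))).
  pose proof (Rmin_l (Rmin e1 e2) (Rmin e3 e4)). pose proof (Rmin_r (Rmin e1 e2) (Rmin e3 e4)).
  pose proof (Rmin_l e1 e2). pose proof (Rmin_r e1 e2). pose proof (Rmin_l e3 e4). pose proof (Rmin_r e3 e4).
  assert (Hy : Cmod (0, y) = y).
  { replace (0, y) with (Ci * RtoC y)%C by (unfold Ci, RtoC, Cmult; simpl; f_equal; ring).
    rewrite Cmod_mult, Cmod_Ci, Cmod_R, Rabs_pos_eq by (unfold y; lra). ring. }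
  exists y. split; [unfold y; lra|].
  specialize (Q1 (0, y)). specialize (Q2 (0, y)). specialize (Q3 (0, y)). specialize (Q4 (0, y)).
  rewrite Hy in *.
  split; [left; apply Q1; unfold y; lra|]. split; [apply Q2; unfold y; lra|].
  split; [|left; apply Q4; unfold y; lra].
  specialize (Q3 ltac:(unfold y; lra)).
  replace (G0 (s0 + (0, y)))%C with ((G0 (s0 + (0, y)) - G0 s0) + G0 s0)%C by ring.
  eapply Rle_trans; [apply Cmod_triangle|]. lra. }
assert (My : forall y, 0 < y -> Cmod (0, y) = y).
{ intros y Hy. replace (0, y) with (Ci * RtoC y)%C by (unfold Ci, RtoC, Cmult; simpl; f_equal; ring).
  rewrite Cmod_mult, Cmod_Ci, Cmod_R, Rabs_pos_eq by lra. ring. }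
set (b := Cmod (G0 s0) + 1). pose proof (Cmod_ge_0 (G0 s0)) as Hb0. pose proof (Cmod_ge_0 g) as Hg0.
pose proof (Cmod_ge_0 (H s0)) as HH0. pose proof (Cmod_ge_0 (F s0)) as HF0.
(* Every term of the identity except g F carries a factor y, so letting y -> 0 leaves g F(s0) =
   0. *)
assert (F0 : F s0 = 0).
{ assert (X : (g * F s0)%C = 0).
  { apply (C_zero_of_eps _ ((Cmod (H s0) + 1) + b * (Cmod (F s0) + 1) + Cmod g)). intros eps He.
    destruct (Lim eps He) as (y & Hy & B1 & _ & B3 & B4). fold b in B3.
    specialize (E y ltac:(lra)). set (h := (0, y) : C) in *.
    assert (Hh : Cmod h = y) by (apply My; lra).
    replace (g * F s0)%C with (h * H (s0 + h) - h * (G0 (s0 + h) * F (s0 + h)) - g * (F (s0 + h) - F s0))%C.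
    2: { rewrite <- E. ring. }
    assert (T1 : Cmod (H (s0 + h))%C <= Cmod (H s0) + 1).
    { replace (H (s0 + h))%C with ((H (s0 + h) - H s0) + H s0)%C by ring.
      eapply Rle_trans; [apply Cmod_triangle|]. lra. }
    assert (T2 : Cmod (F (s0 + h))%C <= Cmod (F s0) + 1).
    { replace (F (s0 + h))%C with ((F (s0 + h) - F s0) + F s0)%C by ring.
      eapply Rle_trans; [apply Cmod_triangle|]. lra. }
    unfold Cminus at 1 2. eapply Rle_trans; [apply Cmod_triangle|].
    eapply Rle_trans; [apply Rplus_le_compat_r, Cmod_triangle|].
    rewrite !Cmod_opp, !Cmod_mult, Hh.
    pose proof (Cmod_ge_0 (H (s0 + h))%C). pose proof (Cmod_ge_0 (F (s0 + h))%C). pose proof (Cmod_ge_0 (G0 (s0 + h))%C).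
    assert (y * Cmod (H (s0 + h))%C <= eps * (Cmod (H s0) + 1)) by (apply Rmult_le_compat; lra).
    assert (Cmod (G0 (s0 + h))%C * Cmod (F (s0 + h))%C <= b * (Cmod (F s0) + 1)) by (apply Rmult_le_compat; lra).
    assert (y * (Cmod (G0 (s0 + h))%C * Cmod (F (s0 + h))%C) <= eps * (b * (Cmod (F s0) + 1))).
    { apply Rmult_le_compat; [lra| |lra|easy]. now apply Rmult_le_pos. }
    assert (Cmod g * Cmod (F (s0 + h) - F s0)%C <= Cmod g * eps) by (apply Rmult_le_compat_l; lra).
    lra. }
  replace (F s0) with (/ g * (g * F s0))%C by (field; easy). rewrite X. ring. }
(* Now F(s0 + i y) tends to 0, so after division by i y the regular part G0 F disappears and the
   limit is g d = H(s0). *)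
assert (X : (g * d - H s0)%C = 0).
{ apply (C_zero_of_eps _ (1 + b + Cmod g)). intros eps He.
  destruct (Lim eps He) as (y & Hy & B1 & B2 & B3 & B4). fold b in B3.
  specialize (E y ltac:(lra)). set (h := (0, y) : C) in *.
  assert (Hh : Cmod h = y) by (apply My; lra).
  assert (Hh0 : h <> 0) by (apply Cmod_gt_0; lra).
  rewrite F0 in B1, B2. replace (F (s0 + h) - 0)%C with (F (s0 + h))%C in B1 by ring.
  apply (Rmult_le_reg_l y); [lra|]. rewrite <- Hh at 1. rewrite <- Cmod_mult.
  replace (h * (g * d - H s0))%C with
    (h * (H (s0 + h) - H s0) - h * (G0 (s0 + h) * F (s0 + h)) - g * (F (s0 + h) - 0 - h * d))%C.
  2: { replace (h * (H (s0 + h) - H s0))%C with (h * H (s0 + h) - h * H s0)%C by ring. rewrite <- E. ring. }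
  unfold Cminus at 1 2. eapply Rle_trans; [apply Cmod_triangle|].
  eapply Rle_trans; [apply Rplus_le_compat_r, Cmod_triangle|].
  rewrite !Cmod_opp, !Cmod_mult, Hh.
  pose proof (Cmod_ge_0 (F (s0 + h))%C). pose proof (Cmod_ge_0 (G0 (s0 + h))%C).
  assert (y * Cmod (H (s0 + h) - H s0)%C <= y * eps) by (apply Rmult_le_compat_l; lra).
  assert (Cmod (G0 (s0 + h))%C * Cmod (F (s0 + h))%C <= b * eps) by (apply Rmult_le_compat; lra).
  assert (y * (Cmod (G0 (s0 + h))%C * Cmod (F (s0 + h))%C) <= y * (b * eps)) by (apply Rmult_le_compat_l; lra).
  assert (Cmod g * Cmod (F (s0 + h) - 0 - h * d)%C <= Cmod g * (eps * y)) by (apply Rmult_le_compat_l; lra).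
  lra. }
replace (g * d)%C with ((g * d - H s0) + H s0)%C by ring. rewrite X. ring.
Qed.

Lemma hurwitz_derivative_mellin (a : R) (k : nat) (za zb : C -> C) (da db : C) : 0 < a < 1 ->
  is_hurwitz_zeta a za -> is_hurwitz_zeta (1 - a) zb ->
  is_derive za (RtoC (- INR (2 * k))) da -> is_derive zb (RtoC (- INR (2 * k))) db ->
  (da + db)%C = (RtoC (INR (fact (2 * k))) * mel (hfun a) (hcoef a) (2 * k + 2) (RtoC (- INR (2 * k))))%C.
Proof.
intros Ha Ia Ib Hda Hdb. apply cderiv_of_is_derive in Hda, Hdb.
set (s0 := RtoC (- INR (2 * k))) in *.
assert (GD : mellin_data gam_phi gam_coef (2 * k + 2) (INR (2 * k + 1))).
{ pose proof (gam_data (2 * k + 1)) as GD. now replace (S (2 * k + 1)) with (2 * k + 2)%nat in GD by lia. }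
pose proof (hfun_data a k Ha) as HD.
assert (Hs0 : - INR (2 * k + 1) < Re s0).
{ unfold s0; simpl (Re _). apply Ropp_lt_contravar, lt_INR. lia. }
assert (Np : forall j, (j < 2 * k + 1)%nat -> (s0 + RtoC (INR j - 1))%C <> 0).
{ intros j Hj Ej. apply (f_equal Re) in Ej. unfold s0, Cplus, RtoC, Re in Ej; cbn [fst snd] in Ej.
  apply lt_INR in Hj. rewrite plus_INR in Hj. simpl (INR 1) in Hj. lra. }
(* Gamma without its last polar term, index 2k + 1, which is the one with pole at -2k and residue 1
   / (2k)!. *)
destruct (cderiv_mel_partial gam_phi gam_coef (2 * k + 2) (2 * k + 1) _ s0 GD Hs0) as [dG HG].
{ intros j Hj. right. now apply Np. }
(* For h the term with pole at -2k has coefficient 0, so all polar terms may stay. *)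
destruct (cderiv_mel_partial (hfun a) (hcoef a) (2 * k + 2) (2 * k + 2) _ s0 HD Hs0) as [dH HH].
{ intros j Hj. destruct (Nat.eq_dec j (2 * k + 1)) as [->|Hne]; [left; apply hcoef_odd|].
  right. apply Np. lia. }
pose proof (INR_fact_lt_0 (2 * k)) as Hf.
assert (Hg : RtoC (/ INR (fact (2 * k))) <> 0).
{ intros E0. apply RtoC_inj in E0. pose proof (Rinv_0_lt_compat _ Hf). lra. }
assert (X := derivative_at_pole _ _ _ s0 _ _ _ _ Hg (cderiv_plus _ _ _ _ _ Hda Hdb) HG HH).
change (mel_partial (hfun a) (hcoef a) (2 * k + 2) (2 * k + 2)) with (mel (hfun a) (hcoef a) (2 * k + 2)) in X.
rewrite <- X.
- rewrite Cmult_assoc, <- RtoC_mult, Rinv_r by lra. ring.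
- intros y Hy.
  assert (Es : (s0 + (0, y))%C = (- INR (2 * k), y)) by (unfold s0, Cplus, RtoC; simpl; f_equal; ring).
  rewrite Es.
  rewrite <- (hurwitz_mellin_upper a k za zb (- INR (2 * k)) y Ha Ia Ib Hy (Rle_refl _)).
  assert (Ey : (0, y) <> RtoC 0).
  { intros E0. injection E0 as E0. lra. }
  assert (EG : (mel gam_phi gam_coef (2 * k + 2) ((- INR (2 * k))%R, y) =
    mel_partial gam_phi gam_coef (2 * k + 2) (2 * k + 1) ((- INR (2 * k))%R, y) + RtoC (/ INR (fact (2 * k))) / (0, y))%C).
  { unfold mel, mel_partial. set (A := lap _ _). set (B := lap _ _).
    replace (2 * k + 2)%nat with (S (2 * k + 1)) by lia. cbn [csum]. set (Cs := csum _ _).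
    replace (((- INR (2 * k))%R, y) + RtoC (INR (2 * k + 1) - 1))%C with ((0, y) : C).
    2: { rewrite plus_INR. simpl (INR 1). unfold Cplus, RtoC; simpl (fst _); simpl (snd _). f_equal; ring. }
    replace (gam_coef (2 * k + 1)) with (/ INR (fact (2 * k))).
    2: { replace (2 * k + 1)%nat with (S (2 * k)) by lia. cbn [gam_coef]. rewrite pow_1_even. field. lra. }
    ring. }
  rewrite EG. field. exact Ey.
Qed.

(** * Abel summation and the value of the Mellin transform at -2k *)

Lemma abel_block (c lam : nat -> R) (B : R) (N p : nat) :
  (forall n, Rabs (sum_n c n) <= B) -> (forall n, lam (S n) <= lam n) -> (forall n, 0 <= lam n) ->
  Rabs (sum_n (fun n => c n * lam n) (N + p) - sum_n (fun n => c n * lam n) N) <= 2 * B * lam (S N).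
Proof.
intros HB Hd Hp.
assert (HB0 : 0 <= B) by (eapply Rle_trans; [apply Rabs_pos|apply (HB O)]).
destruct p as [|p].
{ rewrite Nat.add_0_r, Rminus_diag, Rabs_R0. pose proof (Hp (S N)). nra. }
assert (St : forall (f : nat -> R) n, sum_n f (S n) = sum_n f n + f (S n)).
{ intros f n. now rewrite sum_Sn. }
(* Summation by parts: with the boundary term at N + p removed, each induction step adds a partial
   sum of c times lam m - lam (m + 1), and these increments telescope. *)
assert (P : Rabs (sum_n (fun n => c n * lam n) (N + S p) - sum_n (fun n => c n * lam n) N
  - sum_n c (N + S p) * lam (N + S p)%nat) <= B * lam (S N) + B * (lam (S N) - lam (N + S p)%nat)).
{ induction p.
  - replace (N + 1)%nat with (S N) by lia. rewrite !St.
    replace (_ - _ - _) with (- (sum_n c N * lam (S N))) by ring.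
    rewrite Rabs_Ropp, Rabs_mult, (Rabs_pos_eq (lam _)) by apply Hp.
    pose proof (HB N). pose proof (Hp (S N)). nra.
  - replace (N + S (S p))%nat with (S (N + S p)) by lia. rewrite !St.
    set (m := (N + S p)%nat) in *.
    replace (_ - _ - _) with ((sum_n (fun n => c n * lam n) m - sum_n (fun n => c n * lam n) N - sum_n c m * lam m)
      + sum_n c m * (lam m - lam (S m))) by ring.
    eapply Rle_trans; [apply Rabs_triang|]. rewrite (Rabs_mult (sum_n c m)).
    pose proof (HB m). pose proof (Hd m). rewrite (Rabs_pos_eq (lam m - lam (S m))) by lra.
    assert (Rabs (sum_n c m) * (lam m - lam (S m)) <= B * (lam m - lam (S m))) by (apply Rmult_le_compat_r; lra).
    lra. }
set (X := sum_n _ (N + S p) - _) in *. set (Y := sum_n c (N + S p) * _) in *.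
replace X with ((X - Y) + Y) by ring.
eapply Rle_trans; [apply Rabs_triang|].
assert (Rabs Y <= B * lam (N + S p)%nat).
{ unfold Y. rewrite Rabs_mult, (Rabs_pos_eq (lam _)) by apply Hp. apply Rmult_le_compat_r; [apply Hp|apply HB]. }
lra.
Qed.

Lemma abel_series (c lam : nat -> R) (B : R) :
  (forall n, Rabs (sum_n c n) <= B) -> (forall n, lam (S n) <= lam n) -> (forall n, 0 <= lam n) ->
  is_lim_seq lam 0 ->
  is_series (fun n => c n * lam n) (Series (fun n => c n * lam n)) /\
  forall N, Rabs (Series (fun n => c n * lam n) - sum_n (fun n => c n * lam n) N) <= 2 * B * lam (S N).
Proof.
intros HB Hd Hp HL.
assert (HB0 : 0 <= B) by (eapply Rle_trans; [apply Rabs_pos|apply (HB O)]).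
assert (E : ex_series (fun n => c n * lam n)).
{ apply (proj2 (ex_lim_seq_cauchy_corr (sum_n (fun n => c n * lam n)))). intros eps. pose proof (cond_pos eps) as He.
    assert (He2 : 0 < eps / (2 * (B + 1))) by (apply Rdiv_lt_0_compat; lra).
    destruct (proj2 (is_lim_seq_spec _ _) HL (mkposreal _ He2)) as [N HN]. simpl in HN.
    assert (W : forall n m, (N <= n)%nat -> (n <= m)%nat ->
      Rabs (sum_n (fun n => c n * lam n) m - sum_n (fun n => c n * lam n) n) < eps).
    { intros n m Hn Hm. replace m with (n + (m - n))%nat by lia.
      eapply Rle_lt_trans; [now apply (abel_block c lam B)|].
      specialize (HN (S n) ltac:(lia)). rewrite Rminus_0_r in HN. rewrite Rabs_pos_eq in HN by apply Hp.
      apply (Rmult_lt_compat_l (2 * (B + 1))) in HN; [|lra].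
      replace (2 * (B + 1) * (eps / (2 * (B + 1)))) with (pos eps) in HN by (field; lra).
      pose proof (Hp (S n)). nra. }
    exists N. intros n m Hn Hm. destruct (Nat.le_ge_cases n m).
    + rewrite Rabs_minus_sym. now apply W.
    + now apply W. }
split; [now apply Series_correct|].
intros N.
assert (HS := Series_correct _ E).
assert (L : is_lim_seq (fun p => Rabs (sum_n (fun n => c n * lam n) (p + N) - sum_n (fun n => c n * lam n) N))
   (Rabs (Series (fun n => c n * lam n) - sum_n (fun n => c n * lam n) N))).
{ apply (is_lim_seq_abs _ (Finite _)). apply is_lim_seq_minus'; [|apply is_lim_seq_const].
  apply (is_lim_seq_incr_n (sum_n (fun n => c n * lam n)) N (Finite _)). exact HS. }
refine (is_lim_seq_le_loc _ (fun _ => 2 * B * lam (S N)) _ (Finite _) _ L (is_lim_seq_const _)).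
exists O. intros p _. rewrite Nat.add_comm. now apply abel_block.
Qed.

Lemma sum_n_lim (f : nat -> nat -> R) (g : nat -> R) (N : nat) :
  (forall m, is_lim_seq (fun n => f n m) (g m)) -> is_lim_seq (fun n => sum_n (f n) N) (sum_n g N).
Proof.
intros H. induction N.
- rewrite sum_O. apply (is_lim_seq_ext (fun n => f n O)); [intros; now rewrite sum_O|apply H].
- rewrite sum_Sn. apply (is_lim_seq_ext (fun n => sum_n (f n) N + f n (S N))).
  + intros; now rewrite sum_Sn.
  + apply is_lim_seq_plus'; [easy|apply H].
Qed.

(** Replaces dominated convergence for series that converge only conditionally: L tends to 0 but
    need not be summable, and it makes the Abel tail bounds uniform in n. *)
Lemma abel_limit (c : nat -> R) (B : R) (lam : nat -> nat -> R) (mu L : nat -> R) :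
  (forall n, Rabs (sum_n c n) <= B) -> (forall n m, lam n (S m) <= lam n m) ->
  (forall n m, 0 <= lam n m <= L m) -> is_lim_seq L 0 ->
  (forall m, is_lim_seq (fun n => lam n m) (mu m)) ->
  is_series (fun m => c m * mu m) (Series (fun m => c m * mu m)) /\
  is_lim_seq (fun n => Series (fun m => c m * lam n m)) (Series (fun m => c m * mu m)).
Proof.
intros HB Hd Hb HL Hm.
assert (HB0 : 0 <= B) by (eapply Rle_trans; [apply Rabs_pos|apply (HB O)]).
assert (Hmd : forall m, mu (S m) <= mu m).
{ intros m. refine (is_lim_seq_le _ _ (Finite _) (Finite _) _ (Hm (S m)) (Hm m)). intros n; apply Hd. }
assert (Hmb : forall m, 0 <= mu m <= L m).
{ intros m. split.
  - refine (is_lim_seq_le _ _ (Finite _) (Finite _) _ (is_lim_seq_const 0) (Hm m)). intros n; apply Hb.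
  - refine (is_lim_seq_le _ _ (Finite _) (Finite _) _ (Hm m) (is_lim_seq_const (L m))). intros n; apply Hb. }
assert (Z : forall f : nat -> R, (forall m, 0 <= f m <= L m) -> is_lim_seq f 0).
{ intros f Hf. apply (is_lim_seq_le_le (fun _ => 0) f L); [easy|apply is_lim_seq_const|easy]. }
destruct (abel_series c mu B HB Hmd (fun m => proj1 (Hmb m)) (Z _ Hmb)) as [S1 T1].
split; [easy|].
apply is_lim_seq_spec. intros eps. pose proof (cond_pos eps) as He.
assert (He2 : 0 < eps / (8 * (B + 1))) by (apply Rdiv_lt_0_compat; lra).
destruct (proj2 (is_lim_seq_spec _ _) HL (mkposreal _ He2)) as [N HN]. simpl in HN.
specialize (HN (S N) ltac:(lia)). rewrite Rminus_0_r in HN.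
assert (HN2 : 2 * B * L (S N) < eps / 3).
{ pose proof (Hmb (S N)). rewrite Rabs_pos_eq in HN by lra.
  apply (Rmult_lt_compat_l (2 * (B + 1))) in HN; [|lra].
  replace (2 * (B + 1) * (eps / (8 * (B + 1)))) with (eps / 4) in HN by (field; lra). nra. }
assert (HF : is_lim_seq (fun n => sum_n (fun m => c m * lam n m) N) (sum_n (fun m => c m * mu m) N)).
{ apply (sum_n_lim (fun n m => c m * lam n m)). intros m. apply (is_lim_seq_scal_l _ _ (Finite _)), Hm. }
assert (He3 : 0 < eps / 3) by lra.
destruct (proj2 (is_lim_seq_spec _ _) HF (mkposreal _ He3)) as [n0 Hn0]. simpl in Hn0.
exists n0. intros n Hn. specialize (Hn0 n Hn).
destruct (abel_series c (lam n) B HB (Hd n) (fun m => proj1 (Hb n m)) (Z _ (Hb n))) as [_ T2].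
specialize (T1 N). specialize (T2 N).
assert (2 * B * lam n (S N) <= 2 * B * L (S N)) by (apply Rmult_le_compat_l; [lra|apply Hb]).
assert (2 * B * mu (S N) <= 2 * B * L (S N)) by (apply Rmult_le_compat_l; [lra|apply Hmb]).
set (A := Series (fun m => c m * lam n m)) in *. set (A' := Series (fun m => c m * mu m)) in *.
set (P := sum_n (fun m => c m * lam n m) N) in *. set (P' := sum_n (fun m => c m * mu m) N) in *.
replace (A - A') with ((A - P) + ((P - P') + - (A' - P'))) by ring.
eapply Rle_lt_trans; [apply Rabs_triang|].
eapply Rle_lt_trans; [apply Rplus_le_compat_l, Rabs_triang|]. rewrite Rabs_Ropp. lra.
Qed.

(** The partial sums are Dirichlet kernels at 2 pi a, bounded by 1 / sin(pi a) since a is not an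
    integer. *)
Lemma cn_sum_bound (a : R) : 0 < a < 1 -> exists B, forall n, Rabs (sum_n (cn a) n) <= B.
Proof.
intros Ha. pose proof PI_RGT_0.
assert (Hs : 0 < sin (PI * a)) by (apply sin_gt_0; nra).
exists ((/ sin (PI * a) + 1) / 2). intros n.
assert (E : 1 + 2 * sum_n (cn a) n = dirk (S n) (2 * PI * a)).
{ induction n.
  - rewrite sum_O. simpl. unfold cn, wn. rewrite (Rmult_1_l (2 * PI * a)). simpl. do 3 f_equal. ring.
  - rewrite sum_Sn. change (dirk (S (S n)) (2 * PI * a)) with (dirk (S n) (2 * PI * a) + 2 * cos (INR (S (S n)) * (2 * PI * a))).
    rewrite <- IHn. change plus with Rplus. unfold cn at 2, wn.
    replace (INR (S (S n)) * (2 * PI * a)) with (2 * PI * INR (S (S n)) * a) by ring. simpl. to_R. ring. }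
pose proof (dirk_sin (S n) (2 * PI * a)) as D. rewrite <- E in D.
replace (2 * PI * a / 2) with (PI * a) in D by field.
assert (D2 : Rabs (1 + 2 * sum_n (cn a) n) <= / sin (PI * a)).
{ apply (Rmult_le_reg_l (sin (PI * a))); [easy|]. rewrite Rinv_r by lra.
  rewrite <- (Rabs_pos_eq (sin (PI * a))) at 1 by lra. rewrite <- Rabs_mult, D. apply Rabs_le, SIN_bound. }
apply Rabs_le_between in D2. apply Rabs_le. lra.
Qed.

Definition rdom (f : R -> R) : Prop := exists M q, exp_dom f M q.

Lemma rdom_plus (f g : R -> R) : rdom f -> rdom g ->
  rdom (fun v => f v + g v) /\ hint (fun v => f v + g v) = hint f + hint g.
Proof.
intros (M & q & H) (M' & q' & H'). split; [|eapply hint_plus; eassumption].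
assert (Hq : 0 < Rmin q q') by (apply Rmin_pos; [apply H|apply H']).
apply (exp_dom_weaken _ _ _ M (Rmin q q')) in H; [|lra|split; [easy|apply Rmin_l]].
apply (exp_dom_weaken _ _ _ M' (Rmin q q')) in H'; [|lra|split; [easy|apply Rmin_r]].
destruct H as (A1 & A2 & A3), H' as (B1 & B2 & B3).
exists (M + M'), (Rmin q q'). repeat split; [|easy|].
- intros v. now apply continuous_plus_R.
- intros v Hv. eapply Rle_trans; [apply Rabs_triang|]. rewrite Rmult_plus_distr_r.
  apply Rplus_le_compat; auto.
Qed.

Lemma rdom_scal (c : R) (f : R -> R) : rdom f ->
  rdom (fun v => c * f v) /\ hint (fun v => c * f v) = c * hint f.
Proof.
intros (M & q & H). split; [|eapply hint_scal; eassumption].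
destruct H as (A1 & A2 & A3). exists (Rabs c * M), q. repeat split; [|easy|].
- intros v. apply continuous_mult_R; [apply continuous_const|easy].
- intros v Hv. rewrite Rabs_mult, Rmult_assoc. apply Rmult_le_compat_l; [apply Rabs_pos|auto].
Qed.

Lemma rdom_ext (f g : R -> R) : (forall v, f v = g v) -> rdom f -> rdom g.
Proof.
intros E (M & q & A1 & A2 & A3). exists M, q. repeat split; [|easy|].
- intros v. now apply (continuous_ext f).
- intros v Hv. rewrite <- E. auto.
Qed.

Lemma hint_zero : hint (fun _ => 0) = 0.
Proof.
apply hint_lim_unique. apply (is_lim_seq_ext (fun _ => 0)); [|apply is_lim_seq_const].
intros n. rewrite RInt_const. change scal with Rmult. simpl. to_R. ring.
Qed.

Lemma rdom_exp (c : R) : 0 < c -> rdom (fun v => exp (- c * v)) /\ hint (fun v => exp (- c * v)) = / c.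
Proof.
intros Hc.
assert (HC : forall v, continuous (fun v => exp (- c * v)) v).
{ intros v. eapply continuous_of_deriv. auto_derive; [easy|reflexivity]. }
split.
- exists 1, c. repeat split; [easy|easy|]. intros v Hv. rewrite Rabs_pos_eq by (left; apply exp_pos). lra.
- rewrite (hint_primitive (fun v => - / c * exp (- c * v)) _ 0).
  + rewrite Rmult_0_r, exp_0. ring.
  + intros v. auto_derive; [easy|]. to_R. field. lra.
  + easy.
  + now apply exp_decay_lim.
Qed.

Lemma lap_real (phi : R -> R) (x : R) : lap phi (RtoC x) = RtoC (hint (fun v => exp (- x * v) * phi v)).
Proof.
transitivity ((hint (fun v => exp (- x * v) * phi v), 0) : C); [|easy].
unfold lap, chint. f_equal.
- apply hint_ext. intros v. unfold cexp, Cmult, Copp, RtoC, Re, Im; simpl.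
  replace (- (x * 0 + 0 * v)) with 0 by ring. rewrite cos_0, sin_0.
  replace (- (x * v - 0 * 0)) with (- x * v) by ring. ring.
- rewrite <- hint_zero. apply hint_ext. intros v. unfold cexp, Cmult, Copp, RtoC, Re, Im; simpl.
  replace (- (x * 0 + 0 * v)) with 0 by ring. rewrite sin_0. ring.
Qed.

(** S_k(t) dt written in v = ln t. *)
Definition fS (a : R) (k : nat) (v : R) : R := exp v * Sk a k (exp v).

(** Integrals over t > 1 of t^(-2k-1) beta_j t^(j-1); they cancel the polar terms of [mel] at s =
    -2k. *)
Lemma hint_polar (beta : nat -> R) (k L : nat) : (L <= 2 * k + 1)%nat ->
  let f := fun v => rsum (fun j => beta j * exp (- (INR (2 * k + 1) - INR j) * v)) L in
  rdom f /\ hint f = rsum (fun j => beta j / (INR (2 * k + 1) - INR j)) L.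
Proof.
intros HL. simpl. induction L as [|L IH].
- split; [|apply hint_zero]. exists 0, 1. repeat split; [intros; apply continuous_const|lra|].
  intros v _. simpl. rewrite Rabs_R0. lra.
- destruct IH as [I1 I2]; [lia|]. cbn [rsum].
  assert (Hc : 0 < INR (2 * k + 1) - INR L) by (assert (INR L < INR (2 * k + 1)) by (apply lt_INR; lia); lra).
  destruct (rdom_exp _ Hc) as [E1 E2]. destruct (rdom_scal (beta L) _ E1) as [E3 E4].
  destruct (rdom_plus _ _ I1 E3) as [E5 E6]. split; [exact E5|].
  etransitivity; [exact E6|]. rewrite I2, E4, E2. easy.
Qed.

Lemma pow_neg1_sq (k : nat) : (-1) ^ k * (-1) ^ k = 1.
Proof. rewrite <- Rpow_mult_distr. replace (-1 * -1) with 1 by ring. apply pow1. Qed.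

(** At s = -2k the factor t^(s-1) exactly absorbs the power in the remainder 4 (-1)^k t^(2k+1)
    S_k(t). The continued transform is thus 4 (-1)^k times the plain integral of S_k over (0,
    oo). *)
Lemma mel_hfun_at_neg_even (a : R) (k : nat) : 0 < a < 1 ->
  rdom (fS a k) /\ rdom (fun v => fS a k (- v)) /\
  mel (hfun a) (hcoef a) (2 * k + 2) (RtoC (- INR (2 * k))) =
  RtoC (4 * (-1) ^ k * (hint (fun v => fS a k (- v)) + hint (fS a k))).
Proof.
intros Ha. destruct (hfun_data a k Ha) as (HC & [M HM] & Hi).
set (kap := 4 * (-1) ^ k).
(* Inverting this constant carries the known decay of h and its remainder over to [fS]. *)
assert (Hk : kap * ((-1) ^ k / 4) = 1) by (unfold kap; replace (4 * (-1) ^ k * ((-1) ^ k / 4)) with ((-1) ^ k * (-1) ^ k) by field; apply pow_neg1_sq).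
assert (E1 : forall v, exp (- - INR (2 * k) * v) * mrem (hfun a) (hcoef a) (2 * k + 2) v = kap * fS a k (- v)).
{ intros v. rewrite mrem_hfun by easy. unfold fS, kap. rewrite <- exp_nat_mul.
  replace (exp (- v)) with (exp (- - INR (2 * k) * v) * exp (INR (2 * k + 1) * - v)) at 2; [ring|].
  rewrite <- exp_plus. f_equal. rewrite plus_INR. simpl (INR 1). ring. }
assert (D1 : rdom (fun v => exp (- - INR (2 * k) * v) * mrem (hfun a) (hcoef a) (2 * k + 2) v)).
{ exists M, 1. repeat split; [|lra|].
  - intros v. apply continuous_mult_R; [|now apply continuous_mrem].
    set (c := INR (2 * k)); clearbody c. eapply continuous_of_deriv. auto_derive; [easy|reflexivity].
  - intros v Hv. rewrite Rabs_mult, Rabs_pos_eq by (left; apply exp_pos).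
    apply Rle_trans with (exp (- - INR (2 * k) * v) * (M * exp (- INR (2 * k + 1) * v))).
    + apply Rmult_le_compat_l; [left; apply exp_pos|now apply HM].
    + right. replace (exp (- (1) * v)) with (exp (- - INR (2 * k) * v) * exp (- INR (2 * k + 1) * v)); [ring|].
      rewrite <- exp_plus. f_equal. rewrite plus_INR. simpl (INR 1). ring. }
assert (D1' : rdom (fun v => fS a k (- v))).
{ apply (rdom_ext (fun v => ((-1) ^ k / 4) * (exp (- - INR (2 * k) * v) * mrem (hfun a) (hcoef a) (2 * k + 2) v))).
  - intros v. rewrite E1, <- Rmult_assoc, (Rmult_comm _ kap), Hk. ring.
  - now apply rdom_scal. }
set (pol := fun v => rsum (fun j => hcoef a j * exp (- (INR (2 * k + 1) - INR j) * v)) (2 * k + 1)).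
destruct (hint_polar (hcoef a) k (2 * k + 1) (le_n _)) as [P1 P2]. fold pol in P1, P2.
assert (E2 : forall v, exp (- INR (2 * k) * v) * hfun a (exp v) = pol v + kap * fS a k v).
{ intros v. pose proof (exp_pos v). rewrite (hfun_expansion a (exp v) k) by easy.
  replace (2 * k + 2)%nat with (S (2 * k + 1)) by lia. cbn [rsum]. rewrite hcoef_odd, Rmult_0_l, Rplus_0_r.
  rewrite Rmult_plus_distr_l. f_equal.
  - unfold pol. clear -H. set (L := (2 * k + 1)%nat) at 1 3. clearbody L.
    induction L; [simpl; ring|]. cbn [rsum]. rewrite Rmult_plus_distr_l, IHL. f_equal.
    rewrite <- exp_nat_mul. unfold Rdiv. rewrite <- exp_Ropp.
    replace (exp (- (INR (2 * k + 1) - INR L) * v)) with (exp (- INR (2 * k) * v) * (exp (INR L * v) * exp (- v))); [ring|].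
    rewrite <- !exp_plus. f_equal. rewrite plus_INR. simpl (INR 1). ring.
  - unfold kap, fS. rewrite <- exp_nat_mul.
    replace (exp v) with (exp (- INR (2 * k) * v) * exp (INR (2 * k + 1) * v)) at 2; [ring|].
    rewrite <- exp_plus. f_equal. rewrite plus_INR. simpl (INR 1). ring. }
assert (D2 : rdom (fun v => exp (- INR (2 * k) * v) * hfun a (exp v))).
{ destruct (Hi 1) as [M' HM']. exists M', 1. repeat split; [|lra|].
  - intros v. apply continuous_mult_R; [|apply HC].
    set (c := INR (2 * k)); clearbody c. eapply continuous_of_deriv. auto_derive; [easy|reflexivity].
  - intros v Hv. rewrite Rabs_mult, Rabs_pos_eq by (left; apply exp_pos).
    assert (exp (- INR (2 * k) * v) <= 1) by (apply exp_le_1; pose proof (pos_INR (2 * k)); nra).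
    specialize (HM' v Hv). pose proof (Rabs_pos (hfun a (exp v))). pose proof (exp_pos (- INR (2 * k) * v)). nra. }
assert (D2' : rdom (fS a k)).
{ apply (rdom_ext (fun v => ((-1) ^ k / 4) * (exp (- INR (2 * k) * v) * hfun a (exp v) + (-1) * pol v))).
  - intros v. rewrite E2. transitivity ((kap * ((-1) ^ k / 4)) * fS a k v); [ring|rewrite Hk; ring].
  - apply rdom_scal, rdom_plus; [easy|now apply rdom_scal]. }
split; [easy|split; [easy|]].
unfold mel. rewrite lap_real, <- RtoC_opp, lap_real.
rewrite (hint_ext _ _ E1), (proj2 (rdom_scal kap _ D1')).
rewrite Ropp_involutive, (hint_ext _ _ E2).
rewrite (proj2 (rdom_plus _ _ P1 (proj1 (rdom_scal kap _ D2')))), (proj2 (rdom_scal kap _ D2')), P2.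
assert (EC : csum (fun j => RtoC (hcoef a j) / (RtoC (- INR (2 * k)) + RtoC (INR j - 1)))%C (2 * k + 2) =
  RtoC (- rsum (fun j => hcoef a j / (INR (2 * k + 1) - INR j)) (2 * k + 1))).
{ replace (2 * k + 2)%nat with (S (2 * k + 1)) by lia. cbn [csum]. rewrite hcoef_odd.
  assert (G : forall L, (L <= 2 * k + 1)%nat ->
    csum (fun j => RtoC (hcoef a j) / (RtoC (- INR (2 * k)) + RtoC (INR j - 1)))%C L =
    RtoC (- rsum (fun j => hcoef a j / (INR (2 * k + 1) - INR j)) L)).
  { induction L; intros HL; [simpl; now rewrite Ropp_0|]. cbn [csum rsum]. rewrite IHL by lia.
    assert (INR L < INR (2 * k + 1)) by (apply lt_INR; lia).
    rewrite plus_INR in *. simpl (INR 1) in *.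
    rewrite <- RtoC_plus, <- RtoC_div by lra. rewrite <- RtoC_plus. f_equal. field. lra. }
  rewrite G by lia. unfold Cdiv. ring. }
rewrite EC, <- !RtoC_plus. f_equal. ring.
Qed.

(** * The cosine series *)

Lemma Series_tail_le (f b : nat -> R) (M : nat) : (forall n, Rabs (f n) <= b n) -> ex_series b ->
  Rabs (Series f - sum_n f M) <= Series b - sum_n b M.
Proof.
intros H E.
assert (EA : ex_series (fun n => Rabs (f n))).
{ apply (ex_series_le (K := R_AbsRing) (V := R_CompleteNormedModule) _ b); [|easy].
  intros n. match goal with |- norm ?x <= _ => change (Rabs x <= b n) end. now rewrite Rabs_Rabsolu. }
assert (EF : ex_series f) by now apply ex_series_Rabs.
rewrite (Series_incr_n f (S M)), (Series_incr_n b (S M)) by (lia || easy).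
simpl (Init.Nat.pred (S M)). rewrite !sum_n_Reals.
replace (sum_f_R0 f M + Series (fun k => f (S M + k)%nat) - sum_f_R0 f M) with (Series (fun k => f (S M + k)%nat)) by ring.
replace (sum_f_R0 b M + Series (fun k => b (S M + k)%nat) - sum_f_R0 b M) with (Series (fun k => b (S M + k)%nat)) by ring.
assert (EA' : ex_series (fun k => Rabs (f (S M + k)%nat))) by now apply (ex_series_incr_n (fun k => Rabs (f k)) (S M)).
eapply Rle_trans; [apply Series_Rabs, EA'|].
apply Series_le; [intros n; split; [apply Rabs_pos|apply H]|now apply (ex_series_incr_n b (S M))].
Qed.

Definition fS_term (a : R) (k m : nat) (v : R) : R := exp v * (cn a m / (wn m ^ (2 * k) * (exp v ^ 2 + wn m ^ 2))).

(** Integral of one Lorentzian 1 / (w^(2k) (t^2 + w^2)) over 0 < t < x. *)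
Definition atan_coef (k : nat) (x : R) (m : nat) : R := atan (x / wn m) / wn m ^ (2 * k + 1).

Lemma continuous_fS_term (a : R) (k m : nat) (v : R) : continuous (fS_term a k m) v.
Proof.
unfold fS_term. pose proof (wn_ge_1 m). set (w := wn m) in *. clearbody w.
assert (0 < w ^ (2 * k)) by (apply pow_lt; lra). set (p := w ^ (2 * k)) in *. clearbody p.
pose proof (pow_lt _ 2 (exp_pos v)). pose proof (pow2_ge_0 w).
assert (0 < p * (exp v ^ 2 + w ^ 2)) by (apply Rmult_lt_0_compat; lra).
eapply continuous_of_deriv. auto_derive; [simpl in *; lra|reflexivity].
Qed.

Lemma RInt_fS_term (a : R) (k m : nat) (x y : R) :
  RInt (fS_term a k m) x y = cn a m * (atan_coef k (exp y) m - atan_coef k (exp x) m).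
Proof.
rewrite (RInt_of_primitive (fun v => cn a m * atan_coef k (exp v) m)); [to_R; ring| |apply continuous_fS_term].
intros v. unfold fS_term, atan_coef. pose proof (wn_ge_1 m).
replace (wn m ^ (2 * k + 1)) with (wn m ^ (2 * k) * wn m) by (rewrite <- (pow_1 (wn m)) at 2; now rewrite <- pow_add).
set (w := wn m) in *. clearbody w.
assert (0 < w ^ (2 * k)) by (apply pow_lt; lra). set (p := w ^ (2 * k)) in *. clearbody p.
set (c := cn a m). clearbody c. pose proof (exp_pos v). pose proof (pow_lt _ 2 (exp_pos v)).
assert (D : is_derive (fun v => exp v / w) v (exp v / w)) by (auto_derive; [easy|]; to_R; unfold Rdiv; ring).
pose proof (is_derive_comp (K := R_AbsRing) (V := R_NormedModule) atan (fun v => exp v / w) v _ _ (is_derive_atan _) D) as D2.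
apply (is_derive_ext (fun v => c / (p * w) * atan (exp v / w))).
{ intros t. to_R. field. lra. }
replace (exp v * (c / (p * (exp v ^ 2 + w ^ 2)))) with (c / (p * w) * (exp v / w * / (1 + Rsqr (exp v / w)))).
- apply is_derive_scal. exact D2.
- pose proof (pow2_ge_0 w). unfold Rsqr. field. repeat split; try lra; nra.
Qed.

Lemma continuous_sum_n (f : nat -> R -> R) (M : nat) (v : R) : (forall m, continuous (f m) v) ->
  continuous (fun v => sum_n (fun m => f m v) M) v.
Proof.
intros H. induction M.
- apply (continuous_ext (f O)); [intros; now rewrite sum_O|easy].
- apply (continuous_ext (fun v => sum_n (fun m => f m v) M + f (S M) v)); [intros; now rewrite sum_Sn|].
  now apply continuous_plus_R.
Qed.

Lemma RInt_sum_n (f : nat -> R -> R) (M : nat) (x y : R) : (forall m v, continuous (f m) v) ->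
  RInt (fun v => sum_n (fun m => f m v) M) x y = sum_n (fun m => RInt (f m) x y) M.
Proof.
intros H. induction M.
- rewrite sum_O. apply RInt_ext. intros v _. now rewrite sum_O.
- rewrite sum_Sn, <- IHM.
  rewrite (RInt_ext _ (fun v => sum_n (fun m => f m v) M + f (S M) v)); [|intros; now rewrite sum_Sn].
  apply RInt_plus_R; [|easy]. intros v. now apply continuous_sum_n.
Qed.

(** On a bounded segment the terms are dominated by e^y / n^2, so termwise integration is justified
    by uniform convergence. *)
Lemma is_series_RInt_fS (a : R) (k : nat) (x y : R) : x <= y -> (forall v, continuous (fS a k) v) ->
  is_series (fun m => cn a m * (atan_coef k (exp y) m - atan_coef k (exp x) m)) (RInt (fS a k) x y).
Proof.
intros Hxy HC.
change (is_lim_seq (sum_n (fun m => cn a m * (atan_coef k (exp y) m - atan_coef k (exp x) m))) (RInt (fS a k) x y)).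
set (b := fun n : nat => / INR (S n) ^ 2).
assert (T : is_lim_seq (fun M => (y - x) * (exp y * (Series b - sum_n b M))) 0).
{ replace (Finite 0) with (Finite ((y - x) * (exp y * (Series b - Series b)))) by (f_equal; ring).
  apply (is_lim_seq_scal_l _ _ (Finite _)). apply (is_lim_seq_scal_l _ _ (Finite _)).
  apply is_lim_seq_minus'; [apply is_lim_seq_const|]. exact (Series_correct _ ex_series_inv_sq). }
apply is_lim_seq_spec. intros eps.
destruct (proj2 (is_lim_seq_spec _ _) T eps) as [N HN]. exists N. intros M HM. specialize (HN M HM).
rewrite Rminus_0_r in HN. eapply Rle_lt_trans; [|eapply Rle_lt_trans; [apply Rle_abs|exact HN]].
rewrite (sum_n_ext _ (fun m => RInt (fS_term a k m) x y)) by (intros; now rewrite RInt_fS_term).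
rewrite <- RInt_sum_n by (intros; apply continuous_fS_term).
rewrite Rabs_minus_sym.
assert (CS : forall v, continuous (fun v => sum_n (fun m => fS_term a k m v) M) v).
{ intros v. apply continuous_sum_n. intros; apply continuous_fS_term. }
rewrite <- (RInt_minus (V := R_CompleteNormedModule)) by now apply ex_RInt_cont.
apply (abs_RInt_le_cont (fun v => fS a k v - sum_n (fun m => fS_term a k m v) M)); [easy| |].
- intros v. now apply continuous_minus_R.
- intros v Hv.
  replace (fS a k v - sum_n (fun m => fS_term a k m v) M) with
    (exp v * (Sk a k (exp v) - sum_n (fun n => cn a n / (wn n ^ (2 * k) * (exp v ^ 2 + wn n ^ 2))) M)).
  + rewrite Rabs_mult, (Rabs_pos_eq (exp v)) by (left; apply exp_pos).
    apply Rmult_le_compat; [left; apply exp_pos|apply Rabs_pos|apply exp_le; lra|].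
    apply Series_tail_le; [|apply ex_series_inv_sq]. intros n. apply Sk_term_le.
  + unfold fS. rewrite Rmult_minus_distr_l. f_equal. symmetry.
    apply (sum_n_mult_l (K := R_Ring)).
Qed.

Lemma atan_nonneg (x : R) : 0 <= x -> 0 <= atan x.
Proof. intros [H| <-]; [rewrite <- atan_0; left; now apply atan_increasing|rewrite atan_0; lra]. Qed.

Lemma atan_le (x y : R) : x <= y -> atan x <= atan y.
Proof. intros [H| ->]; [left; now apply atan_increasing|lra]. Qed.

Lemma wn_lt_S (m : nat) : wn m < wn (S m).
Proof. unfold wn. rewrite (S_INR (S m)). pose proof PI_RGT_0. nra. Qed.

Lemma inv_wn_pow_bound (k m : nat) : 0 < / wn m ^ (2 * k + 1) <= / INR (S m).
Proof.
pose proof (wn_ge_1 m). pose proof (wn_gt m).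
split; [apply Rinv_0_lt_compat, pow_lt; lra|].
apply Rinv_le_contravar; [apply lt_0_INR; lia|].
replace (2 * k + 1)%nat with (S (2 * k)) by lia. simpl (_ ^ S _).
assert (1 <= wn m ^ (2 * k)) by (apply pow_R1_Rle; lra).
simpl (k + (k + 0))%nat in *. change (k + (k + 0))%nat with (2 * k)%nat. nra.
Qed.

Lemma atan_coef_decr (k m : nat) (x : R) : 0 <= x -> atan_coef k x (S m) <= atan_coef k x m.
Proof.
intros Hx. unfold atan_coef. pose proof (wn_ge_1 m). pose proof (wn_lt_S m).
assert (I : / wn (S m) <= / wn m) by (apply Rinv_le_contravar; lra).
apply Rmult_le_compat.
- apply atan_nonneg. apply Rmult_le_pos; [easy|left; apply Rinv_0_lt_compat; lra].
- left; apply inv_wn_pow_bound.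
- apply atan_le. now apply Rmult_le_compat_l.
- apply Rinv_le_contravar; [apply pow_lt; lra|]. apply pow_incr; lra.
Qed.

Lemma atan_coef_bound (k m : nat) (x : R) : 0 <= x -> 0 <= atan_coef k x m <= PI / 2 * / INR (S m).
Proof.
intros Hx. pose proof (inv_wn_pow_bound k m). pose proof (wn_ge_1 m). unfold atan_coef, Rdiv at 1 3.
assert (0 <= atan (x / wn m)).
{ apply atan_nonneg. apply Rmult_le_pos; [easy|left; apply Rinv_0_lt_compat; lra]. }
pose proof (atan_bound (x / wn m)).
split; [apply Rmult_le_pos; lra|]. apply Rmult_le_compat; lra.
Qed.

Lemma is_lim_seq_inv_INR_S (c : R) : is_lim_seq (fun m => c * / INR (S m)) 0.
Proof.
replace (Finite 0) with (Finite (c * 0)) by (f_equal; ring).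
apply (is_lim_seq_scal_l _ _ (Finite _)). apply (is_lim_seq_inv _ p_infty); [|easy].
apply (is_lim_seq_incr_1 INR p_infty), is_lim_seq_INR.
Qed.

Lemma atan_exp_neg_lim (c : R) : is_lim_seq (fun n => atan (c * exp (- INR n))) 0.
Proof.
rewrite <- atan_0.
apply (is_lim_seq_continuous atan (fun n => c * exp (- INR n)) 0).
- apply derivable_continuous_pt. apply derivable_pt_atan.
- apply (is_lim_seq_ext (fun n => c * exp (- (1) * INR n))); [intros; f_equal; f_equal; ring|].
  apply exp_decay_lim. lra.
Qed.

Lemma atan_coef_lim_0 (k m : nat) : is_lim_seq (fun n => atan_coef k (exp (- INR n)) m) 0.
Proof.
replace (Finite 0) with (Finite (/ wn m ^ (2 * k + 1) * 0)) by (f_equal; ring).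
apply (is_lim_seq_ext (fun n => / wn m ^ (2 * k + 1) * atan (/ wn m * exp (- INR n)))).
- intros n. unfold atan_coef, Rdiv. rewrite Rmult_comm. f_equal. f_equal. ring.
- apply (is_lim_seq_scal_l _ _ (Finite _)), atan_exp_neg_lim.
Qed.

Lemma atan_coef_lim_infty (k m : nat) : is_lim_seq (fun n => atan_coef k (exp (INR n)) m) (PI / 2 / wn m ^ (2 * k + 1)).
Proof.
pose proof (wn_ge_1 m).
replace (PI / 2 / wn m ^ (2 * k + 1)) with (/ wn m ^ (2 * k + 1) * (PI / 2 - 0)) by (unfold Rdiv; ring).
(* The relation atan(1 / y) = pi/2 - atan y for y > 0 moves the limit at infinity to 0. *)
apply (is_lim_seq_ext (fun n => / wn m ^ (2 * k + 1) * (PI / 2 - atan (wn m * exp (- INR n))))).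
- intros n. unfold atan_coef, Rdiv at 2. rewrite Rmult_comm. f_equal.
  rewrite <- atan_inv by (apply Rmult_lt_0_compat; [lra|apply exp_pos]).
  f_equal. rewrite Rinv_mult, exp_Ropp, Rinv_inv. unfold Rdiv. ring.
- apply (is_lim_seq_scal_l _ _ (Finite _)). apply is_lim_seq_minus'; [apply is_lim_seq_const|apply atan_exp_neg_lim].
Qed.

(** The integral over e^(-n) < t < e^n is a difference of two arctangent series. [abel_limit] takes
    n to infinity in each: the weights at the upper end tend to (pi/2) / w^(2k+1), those at the
    lower end to 0. *)
Lemma hint_fS (a : R) (k : nat) : 0 < a < 1 ->
  rdom (fS a k) -> rdom (fun v => fS a k (- v)) ->
  ex_series (fun m => cn a m / wn m ^ (2 * k + 1)) /\
  hint (fun v => fS a k (- v)) + hint (fS a k) = PI / 2 * Series (fun m => cn a m / wn m ^ (2 * k + 1)).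
Proof.
intros Ha (M1 & q1 & D1) (M2 & q2 & D2).
pose proof (proj1 D1) as HC. pose proof PI_RGT_0 as Hpi.
destruct (cn_sum_bound a Ha) as [B HB].
destruct (abel_limit (cn a) B (fun n m => atan_coef k (exp (INR n)) m) (fun m => PI / 2 / wn m ^ (2 * k + 1))
  (fun m => PI / 2 * / INR (S m)) HB) as [U1 U2].
{ intros n m. apply atan_coef_decr. left; apply exp_pos. }
{ intros n m. apply atan_coef_bound. left; apply exp_pos. }
{ apply is_lim_seq_inv_INR_S. }
{ intros m. apply atan_coef_lim_infty. }
destruct (abel_limit (cn a) B (fun n m => atan_coef k (exp (- INR n)) m) (fun m => 0)
  (fun m => PI / 2 * / INR (S m)) HB) as [V1 V2].
{ intros n m. apply atan_coef_decr. left; apply exp_pos. }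
{ intros n m. apply atan_coef_bound. left; apply exp_pos. }
{ apply is_lim_seq_inv_INR_S. }
{ intros m. apply atan_coef_lim_0. }
assert (EX : forall x, 0 <= x -> ex_series (fun m => cn a m * atan_coef k x m)).
{ intros x Hx. eexists. apply (abel_series (cn a) (atan_coef k x) B HB).
  - intros n. now apply atan_coef_decr.
  - intros n. now apply atan_coef_bound.
  - apply (is_lim_seq_le_le (fun _ => 0) _ (fun m => PI / 2 * / INR (S m))).
    + intros n. now apply atan_coef_bound.
    + apply is_lim_seq_const.
    + apply is_lim_seq_inv_INR_S. }
assert (EI : forall n, RInt (fun v => fS a k (- v)) 0 (INR n) + RInt (fS a k) 0 (INR n) =
  Series (fun m => cn a m * atan_coef k (exp (INR n)) m) - Series (fun m => cn a m * atan_coef k (exp (- INR n)) m)).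
{ intros n. rewrite RInt_reflect, <- RInt_Chasles_R by easy. pose proof (pos_INR n).
  rewrite <- (is_series_unique _ _ (is_series_RInt_fS a k (- INR n) (INR n) ltac:(lra) HC)).
  rewrite <- Series_minus by (apply EX; left; apply exp_pos).
  apply Series_ext. intros m. ring. }
assert (E0 : ex_series (fun m => cn a m / wn m ^ (2 * k + 1))).
{ apply (ex_series_ext (fun m => 2 / PI * (cn a m * (PI / 2 / wn m ^ (2 * k + 1))))).
  - intros m. pose proof (wn_ge_1 m). to_R. field. repeat split; lra || (apply pow_nonzero; lra).
  - apply (ex_series_scal (K := R_AbsRing) (V := R_NormedModule) (2 / PI)). eexists; exact U1. }
split; [easy|].
assert (L1 : is_lim_seq (fun n => RInt (fun v => fS a k (- v)) 0 (INR n) + RInt (fS a k) 0 (INR n))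
  (hint (fun v => fS a k (- v)) + hint (fS a k))).
{ apply is_lim_seq_plus'; eapply hint_lim; eassumption. }
assert (L2 : is_lim_seq (fun n => RInt (fun v => fS a k (- v)) 0 (INR n) + RInt (fS a k) 0 (INR n))
  (Series (fun m => cn a m * (PI / 2 / wn m ^ (2 * k + 1))) - Series (fun m => cn a m * 0))).
{ eapply is_lim_seq_ext; [intros n; symmetry; apply EI|]. now apply is_lim_seq_minus'. }
apply is_lim_seq_unique in L1. apply is_lim_seq_unique in L2. rewrite L1 in L2. apply Rbar_finite_eq in L2. rewrite L2.
rewrite (Series_ext (fun m => cn a m * 0) (fun m => 0 * (cn a m / wn m ^ (2 * k + 1)))) by (intros; ring).
rewrite (Series_scal_l 0), Rmult_0_l, Rminus_0_r, <- Series_scal_l.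
apply Series_ext. intros m. unfold Rdiv. ring.
Qed.

Lemma hurwitz_derivative_series (a : R) (k : nat) (za zb : C -> C) (da db : C) : 0 < a < 1 ->
  is_hurwitz_zeta a za -> is_hurwitz_zeta (1 - a) zb ->
  is_derive za (RtoC (- INR (2 * k))) da -> is_derive zb (RtoC (- INR (2 * k))) db ->
  exists T, is_series (fun m => cn a m / wn m ^ (2 * k + 1)) T /\
  (da + db)%C = RtoC (INR (fact (2 * k)) * (-1) ^ k * (2 * PI) * T).
Proof.
intros Ha Ia Ib Hda Hdb.
destruct (mel_hfun_at_neg_even a k Ha) as (D1 & D2 & E).
destruct (hint_fS a k Ha D1 D2) as [E1 E2].
eexists. split; [apply Series_correct, E1|].
rewrite (hurwitz_derivative_mellin a k za zb da db Ha Ia Ib Hda Hdb), E, E2, <- RtoC_mult.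
f_equal. field.
Qed.

(** * Passage to the alternating series *)

Lemma alternating_series (u : nat -> R) (l1 l2 : R) :
  is_series u l1 -> is_series (fun j => u (2 * j + 1)%nat) l2 ->
  is_series (fun n => (-1) ^ n * u n) (l1 - 2 * l2).
Proof.
intros H1 H2.
assert (St : forall (f : nat -> R) n, sum_n f (S n) = sum_n f n + f (S n)) by (intros; now rewrite sum_Sn).
(* Index n stands for the integer n + 1, so the even integers are the odd indices 2 j + 1; stopping
   at such an index keeps the pairs complete. *)
assert (P : forall n, sum_n (fun n => (-1) ^ n * u n) (2 * n + 1) =
  sum_n u (2 * n + 1) - 2 * sum_n (fun j => u (2 * j + 1)%nat) n).
{ induction n.
  - simpl (2 * 0 + 1)%nat. rewrite !St, !sum_O. simpl. to_R. ring.
  - replace (2 * S n + 1)%nat with (S (S (2 * n + 1))) by lia.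
    rewrite !St, IHn. replace (2 * S n + 1)%nat with (S (S (2 * n + 1))) by lia.
    replace ((-1) ^ S (2 * n + 1)) with 1.
    2: { replace (S (2 * n + 1)) with (2 * (S n))%nat by lia. now rewrite pow_1_even. }
    replace ((-1) ^ S (S (2 * n + 1))) with (-1).
    2: { replace (S (S (2 * n + 1))) with (S (2 * (S n)))%nat by lia. now rewrite pow_1_odd. }
    to_R. ring. }
assert (L : is_lim_seq (fun n => sum_n (fun n => (-1) ^ n * u n) (2 * n + 1)) (l1 - 2 * l2)).
{ eapply is_lim_seq_ext; [intros; symmetry; apply P|].
  apply is_lim_seq_minus'.
  - apply (is_lim_seq_subseq (sum_n u) l1 (fun n => (2 * n + 1)%nat)); [|exact H1].
    apply eventually_subseq. intros; lia.
  - apply (is_lim_seq_scal_l _ _ (Finite _)). exact H2. }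
assert (Z : is_lim_seq u 0) by (apply ex_series_lim_0; now exists l1).
change (is_lim_seq (sum_n (fun n => (-1) ^ n * u n)) (l1 - 2 * l2)).
apply is_lim_seq_spec. intros eps.
assert (He : 0 < eps / 2) by (pose proof (cond_pos eps); lra).
destruct (proj2 (is_lim_seq_spec _ _) L (mkposreal _ He)) as [N1 HN1].
destruct (proj2 (is_lim_seq_spec _ _) Z (mkposreal _ He)) as [N2 HN2]. simpl in HN1, HN2.
exists (2 * N1 + N2 + 2)%nat. intros n Hn.
(* A sum stopping at an even index differs from the next one by a single term, which tends to 0. *)
destruct (Nat.Even_or_Odd n) as [[q ->]|[q ->]].
- specialize (HN1 q ltac:(lia)). specialize (HN2 (2 * q + 1)%nat ltac:(lia)). rewrite Rminus_0_r in HN2.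
  replace (q + (q + 0) + 1)%nat with (S (2 * q)) in HN1 by lia. rewrite St, pow_1_odd in HN1.
  replace (2 * q + 1)%nat with (S (2 * q)) in HN2 by lia.
  set (A := sum_n _ (2 * q)) in *.
  replace (A - (l1 - 2 * l2)) with ((A + -1 * u (S (2 * q)) - (l1 - 2 * l2)) + u (S (2 * q))) by ring.
  eapply Rle_lt_trans; [apply Rabs_triang|]. lra.
- specialize (HN1 q ltac:(lia)). simpl (2 * q)%nat. simpl in HN1. lra.
Qed.

Lemma is_series_RtoC (u : nat -> R) (l : R) : is_series u l -> is_series (fun n => RtoC (u n)) (RtoC l).
Proof.
intros H.
assert (E : forall n, sum_n (fun n => RtoC (u n)) n = RtoC (sum_n u n)).
{ induction n; [now rewrite !sum_O|]. rewrite !sum_Sn, IHn. change plus with Cplus at 1.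
  rewrite <- RtoC_plus. easy. }
apply filterlim_locally. intros eps.
destruct (proj1 (filterlim_locally (F := eventually) _ _) H eps) as [N HN].
exists N. intros n Hn. specialize (HN n Hn). rewrite E. split; [exact HN|apply ball_center].
Qed.

(* Z a = zeta(., a); dZ1..dZ4 are the s-derivatives zeta'(2-2m, a) at
   a = 1 - x/(2 pi), x/(2 pi), 1 - x/pi, x/pi respectively. *)
Theorem mainTheorem4 (m : nat) (x : R) (Z : R -> C -> C) (d1 d2 d3 d4 : C) :
  (1 <= m)%nat ->
  0 < x < PI ->
  (forall a : R, 0 < a <= 1 -> is_hurwitz_zeta a (Z a)) ->
  is_derive (Z (1 - x / (2 * PI))) (RtoC (2 - 2 * INR m)) d1 ->
  is_derive (Z (x / (2 * PI))) (RtoC (2 - 2 * INR m)) d2 ->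
  is_derive (Z (1 - x / PI)) (RtoC (2 - 2 * INR m)) d3 ->
  is_derive (Z (x / PI)) (RtoC (2 - 2 * INR m)) d4 ->
  is_series
    (fun n : nat => RtoC ((-1) ^ n * cos (INR (S n) * x) / INR (S n) ^ (2 * m - 1)))
    (Cmult (RtoC ((-1) ^ (m - 1) * PI ^ (2 * m - 2) / INR (fact (2 * m - 2))))
       (Cminus
          (Cminus
             (Cplus (Cmult (RtoC (2 ^ (2 * m - 2))) d1)
                    (Cmult (RtoC (2 ^ (2 * m - 2))) d2))
             d3)
          d4)).
Proof.
intros Hm Hx HZ H1 H2 H3 H4. pose proof PI_RGT_0 as Hpi.
(* With m = k + 1 the point 2 - 2m is -2k and the exponent 2m - 1 is 2k + 1. *)
destruct m as [|k]; [lia|].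
replace (S k - 1)%nat with k by lia. replace (2 * S k - 2)%nat with (2 * k)%nat by lia.
replace (2 * S k - 1)%nat with (2 * k + 1)%nat by lia.
replace (2 - 2 * INR (S k)) with (- INR (2 * k)) in *.
2: { rewrite S_INR, mult_INR. simpl (INR 2). ring. }
set (a := x / (2 * PI)) in *. set (a2 := x / PI) in *.
assert (Ha : 0 < a < 1).
{ split; [apply Rdiv_lt_0_compat; lra|]. apply (Rmult_lt_reg_r (2 * PI)); [lra|].
  unfold a. replace (x / (2 * PI) * (2 * PI)) with x by (field; lra). lra. }
assert (Ha2 : 0 < a2 < 1).
{ split; [apply Rdiv_lt_0_compat; lra|]. apply (Rmult_lt_reg_r PI); [lra|].
  unfold a2. replace (x / PI * PI) with x by (field; lra). lra. }
destruct (hurwitz_derivative_series a k (Z a) (Z (1 - a)) d2 d1 Ha) as (T1 & S1 & E1);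
  [apply HZ; lra|apply HZ; lra|easy|easy|].
destruct (hurwitz_derivative_series a2 k (Z a2) (Z (1 - a2)) d4 d3 Ha2) as (T2 & S2 & E2);
  [apply HZ; lra|apply HZ; lra|easy|easy|].
set (p := (2 * k + 1)%nat) in *.
set (u := fun n : nat => cos (INR (S n) * x) / INR (S n) ^ p).
assert (U1 : is_series u ((2 * PI) ^ p * T1)).
{ apply (is_series_ext (fun n => (2 * PI) ^ p * (cn a n / wn n ^ p))).
  - intros n. assert (INR (S n) <> 0) by (apply not_0_INR; easy).
    unfold u, cn, wn. rewrite !Rpow_mult_distr.
    replace (2 * PI * INR (S n) * a) with (INR (S n) * x) by (unfold a; field; lra).
    to_R. field. repeat split; apply pow_nonzero; easy || lra.
  - now apply (is_series_scal (K := R_AbsRing) (V := R_NormedModule) ((2 * PI) ^ p)). }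
(* The even part consists of cos(2 n x) / (2 n)^p, and 2 n x = 2 pi n (x / pi), so it is the series
   for a = x / pi; the condition x < pi keeps this a below 1. *)
assert (U2 : is_series (fun j => u (2 * j + 1)%nat) (PI ^ p * T2)).
{ apply (is_series_ext (fun n => PI ^ p * (cn a2 n / wn n ^ p))).
  - intros n. assert (INR (S n) <> 0) by (apply not_0_INR; easy).
    unfold u, cn, wn. replace (S (2 * n + 1)) with (2 * S n)%nat by lia. rewrite mult_INR. change (INR 2) with 2.
    replace (2 * PI * INR (S n) * a2) with (2 * INR (S n) * x) by (unfold a2; field; lra).
    rewrite !Rpow_mult_distr. to_R. field. repeat split; apply pow_nonzero; easy || lra.
  - now apply (is_series_scal (K := R_AbsRing) (V := R_NormedModule) (PI ^ p)). }
pose proof (is_series_RtoC _ _ (alternating_series u _ _ U1 U2)) as R.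
replace (Cmult _ _) with (RtoC ((2 * PI) ^ p * T1 - 2 * (PI ^ p * T2))).
- eapply is_series_ext; [|exact R]. intros n. unfold u. simpl. f_equal. unfold Rdiv. ring.
- symmetry.
  replace (RtoC (2 ^ (2 * k)) * d1 + RtoC (2 ^ (2 * k)) * d2 - d3 - d4)%C with
    (RtoC (2 ^ (2 * k)) * (d2 + d1) - (d4 + d3))%C by ring.
  rewrite E1, E2, <- RtoC_mult, <- RtoC_minus, <- RtoC_mult. f_equal.
  unfold p. rewrite !pow_add, !pow_1, !Rpow_mult_distr.
  pose proof (INR_fact_lt_0 (2 * k)).
  replace ((-1) ^ k * PI ^ (2 * k) / INR (fact (2 * k)) *
    (2 ^ (2 * k) * (INR (fact (2 * k)) * (-1) ^ k * (2 * PI) * T1) - INR (fact (2 * k)) * (-1) ^ k * (2 * PI) * T2))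
    with (((-1) ^ k * (-1) ^ k) * (PI ^ (2 * k) * (2 ^ (2 * k) * (2 * PI) * T1 - 2 * PI * T2))) by (field; lra).
  rewrite pow_neg1_sq. ring.
Qed.
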